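(* Let $0<\alpha<1$ and $\beta>0$, set $\gamma:=\pi e^{2\beta/\alpha}$, and define $h_\beta$ on $\mathbb{T}$ (identifying $h(\theta)$ with $h(e^{i\theta})$) by $$h_\beta(\theta):=\frac{1}{\theta^{\alpha/2}\,\log^{\beta}\frac{\gamma}{\theta}}\quad\text{for }\theta\in(0,\pi],\qquad h_\beta(\theta):=\frac{h_\beta(\pi)}{2}\quad\text{for }\theta\in(-\pi,0).$$ Then: 1. $N_\alpha(h_\beta)<+\infty$ if and only if $\beta>\frac12$. 2. $O_{h_\beta}\in\mathcal{D}_\alpha$ if and only if $\beta>1-\frac12\alpha$. 3. $\mathcal{C}_\alpha(h_\beta)<+\infty$ if and only if $\beta>1$.
   Context: $\mathbb{D}$ is the open unit disk, $\mathbb{T}=\partial\mathbb{D}$. For a non-negative $h\in L^2(\mathbb{T})$ with $\int_{-\pi}^{\pi}\log h>-\infty$, the associated outer function is $$O_h(z):=\exp\Big(\frac1{2\pi}\int_{-\pi}^{\pi}\frac{e^{i\varphi}+z}{e^{i\varphi}-z}\log h(\varphi)\,d\varphi\Big),\quad z\in\mathbb{D}.$$ $\mathcal{D}_\alpha$ is the space of analytic functions $f$ on $\mathbb{D}$ with $\mathcal{D}_\alpha(f):=\frac1\pi\int_{\mathbb{D}}|f'(z)|^2(1-|z|)^\alpha dA(z)<\infty$, where $A$ is area Lebesgue measure. Moreover $$N_\alpha(h):=\int_{-\pi}^{\pi}\int_{-\pi}^{\pi}\frac{|h(\varphi)-h(\theta)|^2}{|e^{i\varphi}-e^{i\theta}|^{2-\alpha}}\,d\varphi\,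 d\theta,\qquad \mathcal{C}_\alpha(h):=\int_{-\pi}^{\pi}\int_{-\pi}^{\pi}\frac{\big(h^2(\varphi)-h^2(\theta)\big)\log\frac{h(\varphi)}{h(\theta)}}{|e^{i\varphi}-e^{i\theta}|^{2-\alpha}}\,d\varphi\, d\theta.$$ The integrand of $\mathcal{C}_\alpha(h)$ is non-negative. *)

(* Defs.v *)
From HB Require Import structures.
From mathcomp Require Import all_boot all_order all_algebra.
From mathcomp Require Import complex.
From mathcomp Require Import all_classical all_reals all_analysis.

Set Implicit Arguments.
Unset Strict Implicit.
Unset Printing Implicit Defensive.

Import Order.TTheory GRing.Theory Num.Theory.
Import numFieldNormedType.Exports.
Import Normc.

Local Open Scope classical_set_scope.
Local Open Scope ring_scope.
Local Open Scope complex_scope.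

(* A function on the unit circle is represented by h : R -> R, where h theta
   is its value at e^{i theta} for theta in ]-pi, pi]; values of h elsewhere
   are never used. *)
Definition angles (R : realType) : set R := `]- pi, pi]%classic.

Definition cis (R : realType) (t : R) : R[i] := cos t +i* sin t.

Definition cexp (R : realType) (z : R[i]) : R[i] :=
  (expR (complex.Re z))%:C * cis (complex.Im z).

(* Lebesgue integral of a complex-valued function; meaningful when its real and
   imaginary parts are integrable. *)
Definition cintegral (R : realType) (D : set R) (f : R -> R[i]) : R[i] :=
  (\int[lebesgue_measure]_(t in D) complex.Re (f t)) +i*
  (\int[lebesgue_measure]_(t in D) complex.Im (f t)).

(* Meaningful when h > 0 a.e. and log h is integrable: ln takes the junk value 0
   on nonpositive reals, and Rintegral is 0 where the integral is infinite. *)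
Definition outer (R : realType) (h : R -> R) (z : R[i]) : R[i] :=
  cexp (((2 * pi)^-1)%:C *
    cintegral (@angles R) (fun phi =>
      (cis phi + z) / (cis phi - z) * (ln (h phi))%:C)).

Definition unit_disk (R : realType) : set R[i] := [set z | normc z < 1].

(* R[i]^o is R[i] as a normed space over itself, so that derivable and derive1
   refer to complex differentiation. *)
Definition analytic_on_disk (R : realType) (f : R[i] -> R[i]) : Prop :=
  forall z : R[i], unit_disk z -> derivable (f : R[i]^o -> R[i]^o) z 1.

Definition complex_deriv (R : realType) (f : R[i] -> R[i]) (z : R[i]) : R[i] :=
  derive1 (f : R[i] -> R[i]^o) z.

Definition of_plane (R : realType) (p : R * R) : R[i] := p.1 +i* p.2.

Definition dirichlet (R : realType) (alpha : R) (f : R[i] -> R[i]) : \bar R :=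
  ((pi^-1)%:E * \int[lebesgue_measure \x lebesgue_measure]_(p in
      (@of_plane R) @^-1` (@unit_disk R))
    (normc (complex_deriv f (of_plane p)) ^+ 2 *
       (1 - normc (of_plane p)) `^ alpha)%:E)%E.

Definition Dspace (R : realType) (alpha : R) : set (R[i] -> R[i]) :=
  [set f | analytic_on_disk f /\ (dirichlet alpha f < +oo)%E].

(* On the diagonal phi = theta, which is a null set, the integrands of Nalpha
   and Calpha are 0 / 0 = 0. *)
Definition Nalpha (R : realType) (alpha : R) (h : R -> R) : \bar R :=
  (\int[lebesgue_measure]_(theta in @angles R)
   \int[lebesgue_measure]_(phi in @angles R)
     (`|h phi - h theta| ^+ 2 /
      normc (cis phi - cis theta) `^ (2 - alpha))%:E)%E.

Definition Calpha (R : realType) (alpha : R) (h : R -> R) : \bar R :=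
  (\int[lebesgue_measure]_(theta in @angles R)
   \int[lebesgue_measure]_(phi in @angles R)
     ((h phi ^+ 2 - h theta ^+ 2) * ln (h phi / h theta) /
      normc (cis phi - cis theta) `^ (2 - alpha))%:E)%E.

Definition gamma_const (R : realType) (alpha beta : R) : R :=
  pi * expR (2 * beta / alpha).

Definition hbeta_pos (R : realType) (alpha beta theta : R) : R :=
  (theta `^ (alpha / 2) * ln (gamma_const alpha beta / theta) `^ beta)^-1.

(* The function is not specified at the single point theta = 0; it is given here
   the constant value that it has for theta < 0. *)
Definition hbeta (R : realType) (alpha beta theta : R) : R :=
  if 0 < theta then hbeta_pos alpha beta theta
  else hbeta_pos alpha beta pi / 2.

(* Main.v *)
Require Import Defs.
From HB Require Import structures.
From mathcomp Require Import all_boot all_order all_algebra.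
From mathcomp Require Import complex ring lra.
From mathcomp Require Import all_classical all_reals all_analysis.
From mathcomp Require Import measurable_realfun.

Set Implicit Arguments.
Unset Strict Implicit.
Unset Printing Implicit Defensive.

Import Order.TTheory GRing.Theory Num.Theory.
Import numFieldNormedType.Exports.
Import Normc.

Local Open Scope classical_set_scope.
Local Open Scope ring_scope.

(** Only the jump of h at the point 1 matters, and near it all three quantities reduce to one test.
    With [L t = loginv alpha beta t], which behaves like log(1/t) at 0, the integral of dt / (t
    L(t)^q) near 0 converges exactly when q > 1 ([integral_loginv_le], [integral_loginv_pinfty]).
    The exponent q is 2 beta for N, 2 beta + alpha - 1 for the Dirichlet integral and 2 beta - 1 for
    C, whence the thresholds 1/2, 1 - alpha/2 and 1.

    For N and C the cost comes from pairs of angles on opposite sides of 0. At scale t the numerator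
    is of order h(t)^2 = t^(-alpha) L^(-2 beta) for N; for C it carries an extra factor
    log(h(t)/h(-t)), of order L ([hgap_le], [hgap_ge]). Integrating the kernel in one angle at
    distance about t gives t^(alpha-1), which leaves 1/(t L^q). Pairs on the same side cost no more:
    log h is Lipschitz in log t and the numerator vanishes to second order on the diagonal. Pairs
    that meet around the point -1 contribute a finite amount. Both energies are treated at once in
    [energy_lt_pinfty] and [energy_pinfty].

    For the outer function O put d = 1 - |z|, r = |1 - z| and let g(t) = [hgap] be the jump of log h
    at scale t. Since log |O| is a Poisson integral and the negative arc has harmonic measure at
    least of order d/r at z, |O(z)| is at most a constant times h(r/2) exp(-c g d/r)
    ([normc_outer_upper]). A bound of the same shape holds from below for z on the side of the
    positive arc ([normc_outer_lower]). The logarithmic derivative O'/O is 1/pi times the integral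
    of log h against e^(it)/(e^(it) - z)^2. That kernel has the primitive i/(e^(it) - z), and
    integration by parts gives O'/O = -(g(r/2)/pi) i/(1 - z) up to an error of order (r d)^(-1/2) +
    1/|1 + z| ([kernel_log_formula]). So near 1 the main part of |O'|^2 d^alpha has size
    r^(-2-alpha) L^(2 - 2 beta) d^alpha exp(-c L d/r). The exponential confines the mass to the
    layer d < r/L, and integration across this layer leaves 1/(r L^(2 beta + alpha - 1)).

    Necessity integrates the lower bound [dirichlet_density_lower] over a thin strip of that layer.
    Sufficiency dominates the density by an explicit [majorant] ([dirichlet_density_le_majorant])
    whose integrals along horizontal lines can be estimated with primitives. *)

(** * Integrals of non-negative functions that need not be measurable *)

Section lower_integral.
Local Open Scope ereal_scope.
Context d (T : measurableType d) (R : realType)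
  (mu : {measure set T -> \bar R}).
Implicit Types (A B D N : set T) (f g : T -> \bar R).

Import HBNNSimple.

(** The integral of a non-negative function is a supremum over the simple functions below it, so it
    is monotone for any functions. Hence only the majorants and minorants of the energy and
    Dirichlet integrands ever have to be shown measurable. *)
Lemma ge0_le_integral_nonmeas D f g :
  (forall x, D x -> 0 <= f x) -> (forall x, D x -> f x <= g x) ->
  \int[mu]_(x in D) f x <= \int[mu]_(x in D) g x.
Proof.
move=> f0 fg.
have g0 x : D x -> 0 <= g x by move=> Dx; exact: le_trans (f0 x Dx) (fg x Dx).
rewrite !ge0_integralE//; apply: le_ereal_sup => _ [h /= hf <-]; exists h => //.
move=> x; apply: (le_trans (hf x)); rewrite !patchE.
by case: ifPn => // /set_mem; exact: fg.
Qed.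

Lemma ge0_subset_integral_nonmeas A B f :
  (forall x, B x -> 0 <= f x) -> A `<=` B ->
  \int[mu]_(x in A) f x <= \int[mu]_(x in B) f x.
Proof.
move=> f0 AB.
rewrite !ge0_integralE//; last by move=> x /AB; exact: f0.
apply: le_ereal_sup => _ [h /= hf <-]; exists h => //.
move=> x; apply: (le_trans (hf x)); rewrite !patchE.
case: ifPn => [/set_mem /AB Bx|_]; first by rewrite mem_set.
by case: ifPn => // /set_mem; exact: f0.
Qed.

(** A simple function below f on the union is measurable, so its own integral splits over A and B
    minus A, and each piece is bounded by the integral of f. Subadditivity thus survives without
    measurability of f. *)
Lemma ge0_integral_setU_le A B f : measurable A -> measurable B ->
  (forall x, (A `|` B) x -> 0 <= f x) ->
  \int[mu]_(x in A `|` B) f x <=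
  \int[mu]_(x in A) f x + \int[mu]_(x in B) f x.
Proof.
move=> mA mB f0; rewrite [leLHS]ge0_integralE//.
apply: ge_ereal_sup => _ [h /= hf <-].
pose h' : T -> R := h.
have mh D : measurable_fun D (EFin \o h').
  by apply/measurable_EFinP; exact: measurable_funTS.
have h0 x : 0 <= (h x)%:E by rewrite lee_fin.
have -> : sintegral mu h = \int[mu]_(x in A `|` B) (h x)%:E.
  rewrite integral_mkcond -integralT_nnsfun; apply: eq_integral => x _.
  rewrite patchE; case: ifPn => // xAB; have := hf x.
  rewrite patchE (negbTE xAB) => h00; apply/eqP.
  by rewrite eq_le; apply/andP; split.
have -> : A `|` B = A `|` (B `\` A) by rewrite setUDr; apply/seteqP; split => x /=; tauto.
rewrite ge0_integral_setU//; [|exact: measurableD|]; last first.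
  by rewrite disj_set2E setIDA; apply/eqP/seteqP; split => x //= -[[]].
apply: leeD.
- apply: ge0_le_integral_nonmeas => // x Ax; apply: (le_trans (hf x)).
  by rewrite patchE mem_set//; left.
- apply: le_trans (_ : \int[mu]_(x in B) (h x)%:E <= _).
    by apply: ge0_subset_integral_nonmeas => // x [].
  apply: ge0_le_integral_nonmeas => // x Bx; apply: (le_trans (hf x)).
  by rewrite patchE mem_set//; right.
Qed.

Lemma ge0_integral_null N f : measurable N -> mu N = 0 ->
  (forall x, N x -> 0 <= f x) -> \int[mu]_(x in N) f x = 0.
Proof.
move=> mN N0 f0; apply/eqP; rewrite eq_le integral_ge0// andbT.
apply: le_trans (_ : \int[mu]_(x in N) (cst +oo) x <= _).
  by apply: ge0_le_integral_nonmeas => // x _; rewrite leey.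
by rewrite null_set_integral.
Qed.

Lemma ge0_integral_nullU_le A N f B : measurable A -> measurable N ->
  mu N = 0 -> (forall x, (A `|` N) x -> 0 <= f x) -> B `<=` A `|` N ->
  \int[mu]_(x in B) f x <= \int[mu]_(x in A) f x.
Proof.
move=> mA mN N0 f0 BAN.
apply: le_trans (ge0_subset_integral_nonmeas f0 BAN) _.
apply: le_trans (ge0_integral_setU_le mA mN f0) _.
by rewrite (ge0_integral_null mN)// ?adde0// => x Nx; apply: f0; right.
Qed.

End lower_integral.

(** * Improper integrals through primitives, and derivation rules *)

Section open_ftc.
Context {R : realType}.
Local Notation mu := (@lebesgue_measure R).
Implicit Types (f F : R -> R) (a b c u v M : R).

Lemma is_derive_continuous f (x l : R) : is_derive x 1 f l ->
  {for x, continuous f}.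
Proof.
move=> [df _]; apply: differentiable_continuous.
exact/derivable1_diffP.
Qed.

Lemma FTC2_closed f F a b : a < b ->
  (forall x, a <= x <= b -> is_derive x 1 F (f x)) ->
  (forall x, a <= x <= b -> {for x, continuous f}) ->
  (\int[mu]_(x in `[a, b]) (f x)%:E = (F b - F a)%:E)%E.
Proof.
move=> ab dF cf; rewrite EFinB; apply: continuous_FTC2 => //.
- apply: continuous_in_subspaceT => x; rewrite inE/= in_itv/= => ?; exact: cf.
- split.
  + move=> x; rewrite in_itv/= => /andP[ax xb].
    by have [] := dF x; rewrite ?(ltW ax) ?(ltW xb).
  + apply: cvg_at_right_filter.
    by apply: is_derive_continuous; apply: dF; rewrite lexx ltW.
  + apply: cvg_at_left_filter.
    by apply: is_derive_continuous; apply: dF; rewrite lexx ltW.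
- move=> x; rewrite in_itv/= => /andP[ax xb].
  have [] := dF x; first by rewrite (ltW ax) (ltW xb).
  by move=> ?; rewrite derive1E.
Qed.

Lemma open_itv_continuous_measurable f a b :
  (forall x, a < x < b -> {for x, continuous f}) ->
  measurable_fun `]a, b[ (EFin \o f).
Proof.
move=> cf; apply/measurable_EFinP; apply: open_continuous_measurable_fun => //.
by move=> x; rewrite inE/= in_itv/=; exact: cf.
Qed.

(** Exhaust the open interval by compact ones, apply the fundamental theorem there, and pass to the
    limit by monotone convergence. Asking for a bound on the increments of F instead of its limits
    covers endpoint singularities of f and F. *)
Lemma ge0_integral_oo_le f F a b M : a < b ->
  (forall x, a < x < b -> 0 <= f x) ->
  (forall x, a < x < b -> {for x, continuous f}) ->
  (forall x, a < x < b -> is_derive x 1 F (f x)) ->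
  (forall u v, a < u -> u < v -> v < b -> F v - F u <= M) ->
  (\int[mu]_(x in `]a, b[) (f x)%:E <= M%:E)%E.
Proof.
move=> ab f0 cf dF FM.
(* With n + 3 in the denominator the interval from a + e n to b - e n is nondegenerate already for n
   = 0. *)
pose e (n : nat) : R := (b - a) / (n.+3)%:R.
have e_gt0 n : 0 < e n by rewrite divr_gt0// subr_gt0.
have e_lt n : a + e n < b - e n.
  rewrite ltrBrDr -addrA -ltrBrDl -mulr2n -mulr_natr /e.
  rewrite mulrAC -mulrA gtr_pMr ?subr_gt0// ltr_pdivrMr// mul1r.
  by rewrite ltr_nat.
have e_le m n : (m <= n)%N -> e n <= e m.
  move=> mn; rewrite ler_pM2l ?subr_gt0// lef_pV2 ?posrE//.
  by rewrite ler_nat !ltnS.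
pose S (n : nat) : set R := `[a + e n, b - e n]%classic.
have Soo : `]a, b[%classic = \bigcup_n S n.
  apply/seteqP; split => x /=; rewrite /S ?in_itv/=.
    move=> /andP[ax xb].
    pose m := Num.min (x - a) (b - x).
    have m0 : 0 < m by rewrite lt_min !subr_gt0 ax xb.
    have [n _ nm] : exists2 n : nat, True & (b - a) / m <= n%:R.
      exists (Num.trunc ((b - a) / m)).+1 => //; apply: ltW.
      by apply: truncnS_gt.
    have em : e n <= m.
      rewrite ler_pdivrMr// mulrC -ler_pdivrMr// (le_trans nm)// ler_nat.
      by rewrite -addn3 leq_addr.
    exists n => //; rewrite /= ?in_itv/=; move: em; rewrite le_min => /andP[e1 e2].
    by rewrite -lerBrDl e1/= lerBrDr -lerBrDl e2.
  move=> [n _]/=; rewrite ?in_itv/= => /andP[x1 x2]; apply/andP; split.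
    by rewrite (lt_le_trans _ x1)// ltrDl.
  by rewrite (le_lt_trans x2)// gtrBl.
have ndS : nondecreasing_seq S.
  move=> m n mn; rewrite subsetEset => x; rewrite /S/= !in_itv/= => /andP[x1 x2].
  by rewrite (le_trans _ x1) ?lerD2l ?e_le//= (le_trans x2)// lerD2l lerN2 e_le.
have Sab n x : S n x -> a < x < b.
  move=> Sx; have : `]a, b[%classic x by rewrite Soo; exists n.
  by rewrite /= ?in_itv.
have mS i : measurable (S i) by exact: measurable_itv.
have mf i : measurable_fun (S i) (EFin \o f).
  apply: (@measurable_funS _ _ _ _ `]a, b[%classic) => //.
    by move=> x /Sab xab /=; rewrite in_itv.
  exact: open_itv_continuous_measurable.
have fS i x : S i x -> (0 <= (EFin \o f) x)%E.
  by move=> /Sab /f0; rewrite /= lee_fin.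
have cv := @ge0_nondecreasing_set_cvg_integral _ (measurableTypeR R) R S
  (EFin \o f) mu ndS mS mf fS.
rewrite Soo -(cvg_lim _ cv)//; apply: lime_le.
  by apply/cvg_ex; eexists; exact: cv.
apply: nearW => n.
have Sab' x : a + e n <= x <= b - e n -> a < x < b.
  by move=> xS; apply: (Sab n); rewrite /S/= in_itv.
have := FTC2_closed (e_lt n) (fun x xS => dF x (Sab' x xS))
  (fun x xS => cf x (Sab' x xS)).
by rewrite /= => ->; rewrite lee_fin FM// ?ltrDl// gtrBl.
Qed.

Lemma le_ge0_integral_oo f F a b u v :
  (forall x, a < x < b -> 0 <= f x) ->
  (forall x, a < x < b -> {for x, continuous f}) ->
  (forall x, a < x < b -> is_derive x 1 F (f x)) ->
  a < u -> u < v -> v < b ->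
  ((F v - F u)%:E <= \int[mu]_(x in `]a, b[) (f x)%:E)%E.
Proof.
move=> f0 cf dF au uv vb.
have uvab x : u <= x <= v -> a < x < b.
  by move=> /andP[ux xv]; rewrite (lt_le_trans au)//= (le_lt_trans xv).
have <- := FTC2_closed uv (fun x xS => dF x (uvab x xS))
  (fun x xS => cf x (uvab x xS)).
apply: ge0_subset_integral_nonmeas => x /=; rewrite !in_itv/= => xab.
  by rewrite lee_fin f0.
exact: uvab.
Qed.

Lemma ge0_integral_oppr_oo (f : R -> \bar R) a b :
  measurable_fun `]a, b[ f -> (forall x, a < x < b -> (0 <= f x)%E) ->
  (\int[mu]_(x in `](- b)%R, (- a)%R[) f (- x)%R = \int[mu]_(x in `]a, b[) f x)%E.
Proof.
move=> mf f0.
have -> : `](- b)%R, (- a)%R[%classic =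
    (-%R : _ -> measurableTypeR R) @^-1` `]a, b[.
  by rewrite opp_preimage_itvbndbnd.
rewrite -(@ge0_integral_pushforward _ _ (measurableTypeR R) (measurableTypeR R)
  R (-%R : _ -> measurableTypeR R))//; last first.
  by move=> x; rewrite inE/= in_itv; exact: f0.
by apply: eq_measure_integral => //= A mA AS; exact: lebesgue_measureN.
Qed.

Lemma ge0_integral_norm_le (f : R -> \bar R) a :
  measurable_fun `]0, a[ f -> (forall x : R, 0 < x < a -> (0 <= f x)%E) ->
  (\int[mu]_(x in `](- a)%R, a[ `\ 0%R) f `|x|%R <=
    2%:E * \int[mu]_(x in `]0%R, a[) f x)%E.
Proof.
move=> mf f0.
have f1 x : (`](- a)%R, 0%R[ `|` `]0%R, a[)%classic x -> (0 <= f `|x|%R)%E.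
  rewrite /= !in_itv/= => -[|] /andP[x1 x2].
    by apply: f0; rewrite ltr0_norm// oppr_gt0 x2 ltrNl.
  by apply: f0; rewrite gtr0_norm// x1.
have -> : (`](- a)%R, a[ `\ 0%R = `](- a)%R, 0%R[ `|` `]0%R, a[)%classic.
  apply/seteqP; split => x /=; rewrite !in_itv/=.
    move=> [/andP[x1 x2] /eqP]; rewrite neq_lt => /orP[x0|x0]; [left|right];
      by rewrite ?x1 ?x2 x0.
  move=> [|] /andP[x1 x2]; (split; first by apply/andP; split; lra).
  - by move=> x0; move: x2; rewrite x0 ltxx.
  - by move=> x0; move: x1; rewrite x0 ltxx.
apply: le_trans (@ge0_integral_setU_le _ (measurableTypeR R) R mu _ _ _ _ _ f1) _ => //.
rewrite mule_natl mule2n leeD//.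
  rewrite -[leRHS](ge0_integral_oppr_oo mf f0) oppr0.
  rewrite le_eqVlt; apply/orP; left; apply/eqP; apply: eq_integral => x.
  by rewrite inE/= in_itv/= => /andP[_ x0]; rewrite ltr0_norm.
rewrite le_eqVlt; apply/orP; left; apply/eqP; apply: eq_integral => x.
by rewrite inE/= in_itv/= => /andP[x0 _]; rewrite gtr0_norm.
Qed.

End open_ftc.

Section derivation_rules.
Context {R : realType}.
Implicit Types (f g : R -> R) (x a b : R).

Lemma is_derive1D f g x a b : is_derive x 1 f a -> is_derive x 1 g b ->
  is_derive x 1 (fun t => f t + g t) (a + b).
Proof. exact: is_deriveD. Qed.

Lemma is_derive1N f x a : is_derive x 1 f a ->
  is_derive x 1 (fun t => - f t) (- a).
Proof. exact: is_deriveN. Qed.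

Lemma is_derive1M f g x a b : is_derive x 1 f a -> is_derive x 1 g b ->
  is_derive x 1 (fun t => f t * g t) (a * g x + f x * b).
Proof.
move=> da db.
have D : is_derive x 1 (fun t => f t * g t) (f x *: b + g x *: a).
  exact: is_deriveM.
apply: (is_derive_eq D).
by rewrite addrC /GRing.scale/= [g x * a]mulrC.
Qed.

Lemma is_derive1Z f k x a : is_derive x 1 f a ->
  is_derive x 1 (fun t => k * f t) (k * a).
Proof. exact: is_deriveZ. Qed.

Lemma is_derive1V f x a : f x != 0 -> is_derive x 1 f a ->
  is_derive x 1 (fun t => (f t)^-1) (- a / f x ^+ 2).
Proof.
move=> f0 da; have D := is_deriveV f0 da.
apply: (is_derive_eq D).
by rewrite /GRing.scale/= mulNr mulNr mulrC.
Qed.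

Lemma is_derive1_comp' f g x a b : is_derive (g x) 1 f a ->
  is_derive x 1 g b -> is_derive x 1 (fun t => f (g t)) (a * b).
Proof. exact: is_derive1_comp. Qed.

Lemma is_derive1_near f g x a : is_derive x 1 f a ->
  (\near x, f x = g x) -> is_derive x 1 g a.
Proof. by move=> df fg; apply: near_eq_is_derive df; rewrite ?oner_neq0. Qed.

End derivation_rules.

(** * The function h: monotonicity, variation of its logarithm, size of its jump *)

Definition loginv (R : realType) (alpha beta t : R) : R :=
  ln (gamma_const alpha beta / t).

Section hbeta_properties.
Context {R : realType} (alpha beta : R)
  (alpha_gt0 : 0 < alpha) (alpha_lt1 : alpha < 1) (beta_gt0 : 0 < beta).

Local Notation kap := (2 * beta / alpha).
Local Notation L := (loginv alpha beta).
Local Notation h := (hbeta alpha beta).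
Let pi0 : 0 < pi :> R := pi_gt0 R.

Let kap_gt0 : 0 < kap. Proof. by rewrite divr_gt0// mulr_gt0. Qed.

Lemma loginvE t : 0 < t -> L t = kap + ln pi - ln t.
Proof.
move=> t0; rewrite /loginv /gamma_const ln_div ?posrE ?mulr_gt0 ?expR_gt0//.
by rewrite lnM ?posrE ?expR_gt0// expRK [ln pi + _]addrC.
Qed.

Lemma loginv_ge t : 0 < t -> t <= pi -> kap <= L t.
Proof.
move=> t0 tpi; rewrite loginvE// -addrA lerDl subr_ge0.
by rewrite ler_ln ?posrE.
Qed.

Lemma loginv_gt0 t : 0 < t -> t <= pi -> 0 < L t.
Proof. by move=> t0 tpi; exact: lt_le_trans (loginv_ge t0 tpi). Qed.

Lemma loginv_le t u : 0 < t -> t <= u -> L u <= L t.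
Proof.
move=> t0 tu; have u0 := lt_le_trans t0 tu.
by rewrite !loginvE// lerD2l lerN2 ler_ln ?posrE.
Qed.

Lemma hbetaE t : 0 < t -> h t = hbeta_pos alpha beta t.
Proof. by move=> t0; rewrite /hbeta t0. Qed.

Lemma hbeta_le0 t : t <= 0 -> h t = h pi / 2.
Proof. by move=> t0; rewrite {1}/hbeta ltNge t0/= hbetaE. Qed.

Lemma hbeta_pos_gt0 t : 0 < t -> t <= pi -> 0 < h t.
Proof.
move=> t0 tpi; rewrite hbetaE// invr_gt0 mulr_gt0 ?powR_gt0//.
exact: loginv_gt0.
Qed.

Lemma hbeta_gt0 t : t <= pi -> 0 < h t.
Proof.
move=> tpi; have [t0|t0] := leP t 0; last exact: hbeta_pos_gt0.
by rewrite hbeta_le0// divr_gt0// hbeta_pos_gt0.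
Qed.

Lemma ln_hbeta t : 0 < t -> t <= pi ->
  ln (h t) = - (alpha / 2) * ln t - beta * ln (L t).
Proof.
move=> t0 tpi; rewrite hbetaE// /hbeta_pos -/(L t).
rewrite lnV ?posrE ?mulr_gt0 ?powR_gt0 ?loginv_gt0//.
by rewrite lnM ?posrE ?powR_gt0 ?loginv_gt0// !ln_powR opprD mulNr.
Qed.

Lemma hbeta_expR t : t <= pi -> h t = expR (ln (h t)).
Proof. by move=> tpi; rewrite lnK// posrE hbeta_gt0. Qed.

(* [beta / L u <= alpha / 2] since [kap <= L u]; this is what gamma is for. *)
Lemma ln_hbeta_le t u : 0 < t -> t <= u -> u <= pi -> ln (h u) <= ln (h t).
Proof.
move=> t0 tu upi; have u0 := lt_le_trans t0 tu.
rewrite !ln_hbeta ?(le_trans tu)//.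
have Lu := loginv_gt0 u0 upi.
have Lt := loginv_gt0 t0 (le_trans tu upi).
have LuLt := loginv_le t0 tu.
have H : ln (L t) - ln (L u) <= (ln u - ln t) / kap.
  rewrite -ln_div ?posrE//.
  have -> : L t / L u = 1 + (L t - L u) / L u by field; rewrite gt_eqF.
  have E0 : 0 <= (L t - L u) by rewrite subr_ge0.
  have E : 0 <= (L t - L u) / L u by rewrite divr_ge0// ltW.
  apply: le_trans (le_ln1Dx _) _; first by lra.
  have -> : ln u - ln t = L t - L u by rewrite !loginvE//; lra.
  by rewrite ler_wpM2l// lef_pV2 ?posrE// loginv_ge.
have -> : - (alpha / 2) * ln t - beta * ln (L t) =
    (- (alpha / 2) * ln u - beta * ln (L u)) +
    ((alpha / 2) * (ln u - ln t) - beta * (ln (L t) - ln (L u))) by ring.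
rewrite lerDl subr_ge0.
apply: le_trans (ler_wpM2l (ltW beta_gt0) H) _.
rewrite le_eqVlt; apply/orP; left; apply/eqP; field.
by rewrite !gt_eqF.
Qed.

(** The factor L^(-beta) increases with t, so it can only reduce the drop of ln h. Thus h varies at
    most like t^(-alpha/2), and this Lipschitz bound in ln t is the regularity used in all upper
    estimates. *)
Lemma ln_hbeta_sub_le t u : 0 < t -> t <= u -> u <= pi ->
  ln (h t) - ln (h u) <= (alpha / 2) * (ln u - ln t).
Proof.
move=> t0 tu upi; have u0 := lt_le_trans t0 tu.
rewrite !ln_hbeta ?(le_trans tu)//.
have : ln (L u) <= ln (L t).
  by rewrite ler_ln ?posrE ?loginv_gt0 ?(le_trans tu)// loginv_le.
by move=> H; have := ler_wpM2l (ltW beta_gt0) H; lra.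
Qed.

Lemma hbeta_le t u : 0 < t -> t <= u -> u <= pi -> h u <= h t.
Proof.
move=> t0 tu upi; have tpi := le_trans tu upi.
have := ln_hbeta_le t0 tu upi.
by rewrite ler_ln ?posrE; [|exact: hbeta_gt0|exact: hbeta_gt0].
Qed.

(** The jump of ln h across 0 as seen at scale t: [h pi / 2] is the constant value of h on the
    negative arc. *)
Definition hgap (t : R) : R := ln (h t) - ln (h pi / 2).

Lemma ln_hbeta_pi2 : ln (h pi / 2) = ln (h pi) - ln 2.
Proof. by rewrite ln_div ?posrE// hbeta_gt0. Qed.

Lemma hgap_ge_ln2 t : 0 < t -> t <= pi -> ln 2 <= hgap t.
Proof.
move=> t0 tpi; rewrite /hgap ln_hbeta_pi2.
by have := ln_hbeta_le t0 tpi (lexx _); lra.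
Qed.

Lemma hgap_le t : 0 < t -> t <= pi -> hgap t <= (alpha / 2 + ln 2 / kap) * L t.
Proof.
move=> t0 tpi; rewrite /hgap ln_hbeta_pi2 mulrDl.
have := ln_hbeta_sub_le t0 tpi (lexx _).
have : (alpha / 2) * (ln pi - ln t) <= alpha / 2 * L t.
  by rewrite ler_pM2l ?divr_gt0// loginvE//; have := kap_gt0; lra.
have : ln 2 <= ln 2 / kap * L t.
  rewrite -mulrA ler_pMr ?ln_gt0 ?ltr1n// mulrC ler_pdivlMr// mul1r.
  exact: loginv_ge.
lra.
Qed.

(** With q = (ln pi - ln t)/kap one has L = kap (1 + q) and hgap = ln 2 + beta (q - ln(1 + q)). The
    tangent to ln at 2 bounds q - ln(1 + q) below by (1 + q)/2 - ln 2. *)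
Lemma hgap_ge : exists2 c, 0 < c & forall t, 0 < t -> t <= pi -> c * L t <= hgap t.
Proof.
(* Capping beta at 1 makes b ln 2 at most ln 2, so the loss from the tangent line is absorbed by the
   term ln 2 of the gap. *)
pose b := Num.min beta 1.
have b0 : 0 < b by rewrite lt_min beta_gt0 ltr01.
exists (b / 2 / kap); first by rewrite divr_gt0// divr_gt0.
move=> t t0 tpi.
pose q := (ln pi - ln t) / kap.
have q0 : 0 <= q by rewrite divr_ge0 ?(ltW kap_gt0)// subr_ge0 ler_ln ?posrE.
have LE : L t = kap * (1 + q).
  by rewrite loginvE// /q; field; rewrite !gt_eqF.
have Lpi : L pi = kap by rewrite loginvE//; lra.
have -> : hgap t = ln 2 + beta * (q - ln (1 + q)).
  rewrite /hgap ln_hbeta_pi2 !ln_hbeta// Lpi LE.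
  rewrite lnM ?posrE ?ltr_wpDr//; rewrite /q; field.
  by rewrite !gt_eqF.
have -> : b / 2 / kap * L t = b / 2 * (1 + q).
  by rewrite LE; field; rewrite !gt_eqF.
have q1 : 0 < 1 + q by lra.
have H1 : 0 <= q - ln (1 + q) by rewrite subr_ge0; apply: le_ln1Dx; lra.
have H2 : ln (1 + q) <= ln 2 + (q - 1) / 2.
  have -> : 1 + q = 2 * (1 + (q - 1) / 2) by field.
  rewrite lnM ?posrE//; last by lra.
  by rewrite lerD2l; apply: le_ln1Dx; lra.
have H3 : b * (q - ln (1 + q)) <= beta * (q - ln (1 + q)).
  by rewrite ler_wpM2r// ge_min lexx.
have b1 : b <= 1 by rewrite ge_min lexx orbT.
have l2 : 0 <= ln 2 :> R by rewrite ln_ge0// ler1n.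
have : b * ln 2 <= ln 2 by rewrite ler_piMl.
have := ler_wpM2l (ltW b0) H2.
nra.
Qed.

Lemma sqr_hbeta t : 0 < t -> t <= pi ->
  h t ^+ 2 = t `^ (- alpha) * L t `^ (- (2 * beta)).
Proof.
move=> t0 tpi; rewrite hbetaE// /hbeta_pos -/(L t) exprVn exprMn.
rewrite invfM !powRN -!powR_mulrn ?powR_ge0// -!powRrM.
by rewrite mulfVK ?pnatr_eq0// [beta * _]mulrC.
Qed.

End hbeta_properties.

(** * Integrals of powers and the test integral of 1/(t L(t)^q) *)

Section power_integrals.
Context {R : realType}.
Local Notation mu := (@lebesgue_measure R).
Implicit Types (p a b t x : R).

Lemma continuous_powR p x : 0 < x -> {for x, continuous (@powR R ^~ p)}.
Proof. by move=> x0; apply: is_derive_continuous; exact: is_derive1_powR. Qed.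

Lemma integral_powR_le p b : 0 < p -> 0 < b ->
  (\int[mu]_(x in `]0%R, b[) (x `^ (p - 1))%:E <= (b `^ p / p)%:E)%E.
Proof.
move=> p0 b0; apply: (@ge0_integral_oo_le _ _ (fun t => p^-1 * t `^ p)) => //.
- by move=> x _; exact: powR_ge0.
- by move=> x /andP[x0 _]; exact: continuous_powR.
- move=> x /andP[x0 _]; apply: is_derive_eq.
    by apply: is_derive1Z; exact: is_derive1_powR.
  by rewrite mulrA mulVf ?gt_eqF// mul1r.
- move=> u v u0 uv vb; rewrite -mulrBr [leRHS]mulrC ler_wpM2l ?invr_ge0 ?(ltW p0)//.
  apply: le_trans (_ : v `^ p <= _); first by rewrite gerBl powR_ge0.
  have v0 := lt_trans u0 uv.
  by apply: ge0_ler_powR; rewrite ?nnegrE ?ltW.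
Qed.

Lemma integral_powR_tail_le p a b : p < 0 -> 0 < a -> a < b ->
  (\int[mu]_(x in `]a, b[) (x `^ (p - 1))%:E <= (a `^ p / - p)%:E)%E.
Proof.
move=> p0 a0 ab; apply: (@ge0_integral_oo_le _ _ (fun t => p^-1 * t `^ p)) => //.
- by move=> x _; exact: powR_ge0.
- by move=> x /andP[x0 _]; apply: continuous_powR; exact: lt_trans a0 x0.
- move=> x /andP[x0 _]; apply: is_derive_eq.
    by apply: is_derive1Z; apply: is_derive1_powR; exact: lt_trans a0 x0.
  by rewrite mulrA mulVf ?lt_eqF// mul1r.
- move=> u v u0 uv vb; have -> : p^-1 * v `^ p - p^-1 * u `^ p =
      (- p)^-1 * (u `^ p - v `^ p) by field; rewrite lt_eqF.
  rewrite [leRHS]mulrC ler_wpM2l ?invr_ge0 ?oppr_ge0 ?(ltW p0)//.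
  apply: le_trans (_ : u `^ p <= _); first by rewrite gerBl powR_ge0.
  rewrite -[p]opprK ![_ `^ (- - p)]powRN lef_pV2 ?posrE ?powR_gt0 ?(lt_trans a0 u0)//.
  by apply: ge0_ler_powR; rewrite ?nnegrE ?oppr_ge0; lra.
Qed.

Lemma integral_powRB_le p a b : 0 < p -> a < b ->
  (\int[mu]_(x in `]a, b[) ((b - x) `^ (p - 1))%:E <= ((b - a) `^ p / p)%:E)%E.
Proof.
move=> p0 ab.
have dB x : is_derive x 1 (fun t : R => b - t) (- 1).
  rewrite -[X in is_derive _ _ _ X]add0r.
  apply: (is_derive1D (f := cst b)); apply: (is_derive1N (f := id)).
apply: (@ge0_integral_oo_le _ _ (fun t => - p^-1 * (b - t) `^ p)) => //.
- by move=> x _; exact: powR_ge0.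
- move=> x /andP[_ xb].
  apply: is_derive_continuous; apply: (is_derive1_comp' (f := @powR R ^~ (p-1)) _ (dB x)).
  by apply: is_derive1_powR; rewrite subr_gt0.
- move=> x /andP[_ xb]; apply: is_derive_eq.
    apply: is_derive1Z; apply: (is_derive1_comp' (f := @powR R ^~ p) _ (dB x)).
    by apply: is_derive1_powR; rewrite subr_gt0.
  by rewrite mulrN1 mulrN mulNr opprK mulrA mulVf ?gt_eqF// mul1r.
- move=> u v u0 uv vb; rewrite -mulrBr mulNr -mulrN opprB [leRHS]mulrC.
  rewrite ler_wpM2l ?invr_ge0 ?(ltW p0)//.
  apply: le_trans (_ : (b - u) `^ p <= _); first by rewrite gerBl powR_ge0.
  have ub := lt_trans uv vb.
  by apply: ge0_ler_powR; rewrite ?nnegrE; lra.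
Qed.

End power_integrals.

Section loginv_integrals.
Context {R : realType} (alpha beta : R)
  (alpha_gt0 : 0 < alpha) (beta_gt0 : 0 < beta).
Implicit Types (t q a : R).
Local Notation mu := (@lebesgue_measure R).
Local Notation kap := (2 * beta / alpha).
Local Notation L := (loginv alpha beta).
Let kap_gt0 : 0 < kap. Proof. by rewrite divr_gt0// mulr_gt0. Qed.
Let gam_gt0 : 0 < gamma_const alpha beta.
Proof. by rewrite mulr_gt0 ?pi_gt0 ?expR_gt0. Qed.

Lemma is_derive_loginv t : 0 < t -> is_derive t 1 L (- t^-1).
Proof.
move=> t0; rewrite /loginv; apply: is_derive_eq.
  apply: (is_derive1_comp' (f := @ln R)); last first.
    apply: is_derive1Z; apply: (is_derive1V (f := id)); first by rewrite gt_eqF.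
  by apply: is_derive1_ln; rewrite divr_gt0.
by rewrite /=; field; rewrite !gt_eqF.
Qed.

Lemma is_derive_loginv_powR q t : 0 < t -> t <= pi ->
  is_derive t 1 (fun x => L x `^ q) (- (q * L t `^ (q - 1) / t)).
Proof.
move=> t0 tpi; apply: is_derive_eq.
  apply: (is_derive1_comp' (f := @powR R ^~ q)); last exact: is_derive_loginv.
  by apply: is_derive1_powR; exact: loginv_gt0.
by rewrite mulrN.
Qed.

Lemma continuous_inv_loginv q t : 0 < t -> t <= pi ->
  {for t, continuous (fun x : R => x^-1 * L x `^ q)}.
Proof.
move=> t0 tpi; apply: is_derive_continuous.
apply: is_derive1M; last exact: is_derive_loginv_powR.
by apply: (is_derive1V (f := id)); rewrite ?gt_eqF.
Qed.

Lemma integral_loginv_le q : 1 < q ->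
  (\int[mu]_(t in `]0%R, pi[) (t^-1 * L t `^ (- q))%:E <=
   (kap `^ (1 - q) / (q - 1))%:E)%E.
Proof.
move=> q1.
have q0 : q - 1 != 0 by rewrite subr_eq0 gt_eqF.
apply: (@ge0_integral_oo_le _ _ (fun t => (q - 1)^-1 * L t `^ (1 - q))).
- exact: pi_gt0.
- by move=> x /andP[x0 _]; rewrite mulr_ge0 ?powR_ge0// invr_ge0 ltW.
- by move=> x /andP[x0 xpi]; apply: continuous_inv_loginv; rewrite // ltW.
- move=> x /andP[x0 xpi]; apply: is_derive_eq.
    by apply: is_derive1Z; apply: is_derive_loginv_powR; rewrite // ltW.
  rewrite (_ : 1 - q - 1 = - q); last by ring.
  by field; rewrite gt_eqF.
- move=> u v u0 uv vpi; rewrite -mulrBr [leRHS]mulrC.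
  have v0 := lt_trans u0 uv.
  rewrite ler_wpM2l ?invr_ge0 ?subr_ge0 ?(ltW q1)//.
  apply: le_trans (_ : L v `^ (1 - q) <= _); first by rewrite gerBl powR_ge0.
  rewrite -opprB !powRN lef_pV2 ?posrE ?powR_gt0 ?loginv_gt0 ?(ltW vpi)//.
  by apply: ge0_ler_powR; rewrite ?nnegrE ?subr_ge0 ?(ltW q1) ?(ltW kap_gt0)//
    ?(ltW (loginv_gt0 _ _ _ _)) ?loginv_ge// ltW.
Qed.

(** Since L >= kap and q <= 1, L^(-q) is at least kap^(1-q) L^(-1), and 1/(t L) has the primitive
    -ln L, which is unbounded at 0. *)
Lemma integral_loginv_pinfty q a : q <= 1 -> 0 < a -> a <= pi ->
  (\int[mu]_(t in `]0%R, a[) (t^-1 * L t `^ (- q))%:E = +oo)%E.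
Proof.
move=> q1 a0 api; apply/eqyP => A A0.
pose c := kap `^ (1 - q).
have c0 : 0 < c by rewrite powR_gt0.
(* Chosen so that ln (L u) >= s makes the increment of the primitive between u and a/2, times c, at
   least A; the point u is then taken small enough for this. *)
pose s := A / c + ln (L (a / 2)).
have a2 : 0 < a / 2 by rewrite divr_gt0.
have a2a : a / 2 < a by lra.
have a2pi : a / 2 <= pi by lra.
pose u := Num.min (a / 4) (pi * expR (kap - expR s)).
have u0 : 0 < u by rewrite lt_min; apply/andP; split; [lra|rewrite mulr_gt0 ?pi_gt0 ?expR_gt0].
have uE : u <= a / 4 by rewrite ge_min lexx.
have Lu : expR s <= L u.
  have : u <= pi * expR (kap - expR s) by rewrite ge_min lexx orbT.
  rewrite -ler_ln ?posrE ?mulr_gt0 ?pi_gt0 ?expR_gt0//.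
  by rewrite lnM ?posrE ?pi_gt0 ?expR_gt0// expRK loginvE//; lra.
apply: (@le_trans _ _ (\int[mu]_(t in `]0%R, a[) (c * (t^-1 * L t `^ (-1)))%:E)%E);
  last first.
  apply: ge0_le_integral_nonmeas => x /=; rewrite in_itv/= => /andP[x0 xa].
    by rewrite lee_fin !mulr_ge0 ?powR_ge0// invr_ge0 ltW.
  have xpi : x <= pi by rewrite (le_trans (ltW xa)).
  rewrite lee_fin mulrCA ler_wpM2l ?invr_ge0 ?(ltW x0)//.
  have -> : - q = (1 - q) + -1 by ring.
  rewrite [leRHS]powRD; last by apply/implyP => _; rewrite gt_eqF// loginv_gt0.
  rewrite ler_wpM2r ?powR_ge0//.
  have Lk : kap <= L x by exact: loginv_ge.
  by apply: ge0_ler_powR; rewrite ?nnegrE; have := kap_gt0; lra.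
apply: le_trans (@le_ge0_integral_oo _ _ (fun t => c * - ln (L t)) _ _ u (a/2) _ _ _ u0 _ a2a).
- rewrite lee_fin -mulrBr opprK -ler_pdivrMl// mulrC.
  have : s <= ln (L u).
    by rewrite -[leLHS]expRK ler_ln ?posrE ?expR_gt0// (lt_le_trans _ Lu)// expR_gt0.
  rewrite /s; lra.
- by move=> x /andP[x0 xa]; rewrite !mulr_ge0 ?powR_ge0// ?(ltW c0)// invr_ge0 ltW.
- move=> x /andP[x0 xa]; apply: is_derive_continuous; apply: is_derive1Z.
  have xpi : x <= pi by rewrite (le_trans (ltW xa)).
  apply: is_derive1M; last exact: is_derive_loginv_powR.
  by apply: (is_derive1V (f := id)); rewrite ?gt_eqF.
- move=> x /andP[x0 xa]; have xpi : x <= pi by rewrite (le_trans (ltW xa)).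
  apply: is_derive_eq.
    apply: is_derive1Z; apply: is_derive1N.
    apply: (is_derive1_comp' (f := @ln R)); last exact: is_derive_loginv.
    by apply: is_derive1_ln; exact: loginv_gt0.
  rewrite powR_inv1 ?(ltW (loginv_gt0 _ _ _ _))//.
  by field; rewrite (gt_eqF x0) gt_eqF// loginv_gt0.
- lra.
Qed.

End loginv_integrals.

(** * Chord length against angle, and integrals over the circle *)

Section chord.
Context {R : realType}.
Implicit Types (x y a b t u : R).

Lemma ge0_derive_le (f df : R -> R) a b : a <= b ->
  (forall x, a <= x <= b -> is_derive x 1 f (df x)) ->
  (forall x, a <= x <= b -> 0 <= df x) -> f a <= f b.
Proof.
move=> ab dF df0; have [||c] := @MVT_segment _ f df _ _ ab.
- by move=> x; rewrite in_itv/= => /andP[? ?]; apply: dF; rewrite !ltW.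
- apply: continuous_in_subspaceT => x; rewrite inE/= in_itv/= => /dF.
  exact: is_derive_continuous.
- rewrite in_itv/= => cab; rewrite -subr_ge0 => ->.
  by rewrite mulr_ge0 ?subr_ge0// df0.
Qed.

Lemma sin_le x : 0 <= x -> sin x <= x.
Proof.
move=> x0; rewrite -subr_ge0.
have := @ge0_derive_le (fun t => t - sin t) (fun t => 1 - cos t) 0 x x0 _ _.
rewrite sin0 !subr0; apply.
by move=> t _; rewrite subr_ge0 cos_le1.
Qed.

Lemma norm_sin_le x : `|sin x| <= `|x|.
Proof.
wlog x0 : x / 0 <= x.
  move=> H; have [|x0] := leP 0 x; first exact: H.
  by rewrite -normrN -sinN -[leRHS]normrN; apply: H; rewrite oppr_ge0 ltW.
have [xpi|xpi] := leP x pi.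
  by rewrite !ger0_norm// ?sin_le// sin_ge0_pi// x0.
rewrite (ger0_norm x0); apply: (le_trans (sin_max _)).
by apply: le_trans (ltW xpi); have := pi_ge2 R; lra.
Qed.

(** From y cos y <= sin y at y = x/2 one gets sin x = 2 sin y cos y >= x cos(y)^2, and cos(y)^2 = (1
    + cos x)/2 is at least 1/2. *)
Lemma half_le_sin x : 0 <= x -> x <= pi / 2 -> x / 2 <= sin x.
Proof.
move=> x0 xpi.
have H : forall y, 0 <= y -> y <= pi / 4 -> y * cos y <= sin y.
  move=> y y0 y4; rewrite -subr_ge0.
  have := @ge0_derive_le (fun t => sin t - t * cos t) (fun t => t * sin t) 0 y y0 _ _.
  rewrite sin0 !mul0r subr0; apply.
  - move=> t _; apply: is_derive_eq.
    by rewrite /GRing.scale/=; ring.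
  - move=> t /andP[t0 ty]; rewrite mulr_ge0// sin_ge0_pi// t0/=.
    by have := pi_gt0 R; lra.
have cx : 0 <= cos x.
  by apply: cos_ge0_pihalf; have := pi_gt0 R; lra.
have Hx := H (x / 2) ltac:(lra) ltac:(lra).
have c0 : 0 <= cos (x / 2).
  by apply: cos_ge0_pihalf; have := pi_gt0 R; lra.
have E : sin x = 2 * (cos (x / 2) * sin (x / 2)).
  by rewrite -[in LHS](_ : (x / 2) *+ 2 = x) ?sin_mulr2n ?mulr_natl//; field.
have E2 : cos x = 2 * cos (x / 2) ^+ 2 - 1.
  by rewrite -[in LHS](_ : (x / 2) *+ 2 = x) ?cos_mulr2n ?mulr_natl//; field.
have := ler_wpM2l c0 Hx.
rewrite E. nra.
Qed.

Lemma normc_cisB x y :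
  normc (cis x - cis y) = 2 * `|sin ((x - y) / 2)|.
Proof.
rewrite /cis /=; set u := _ ^+ 2 + _.
have -> : u = (2 * sin ((x - y) / 2)) ^+ 2.
  have E : cos (x - y) = 1 - 2 * sin ((x - y) / 2) ^+ 2.
    rewrite -[in LHS](_ : ((x - y) / 2) *+ 2 = x - y); last by field.
    by rewrite cos_mulr2n mulr2n; have := cos2Dsin2 ((x - y) / 2); lra.
  have := cos2Dsin2 x; have := cos2Dsin2 y; rewrite cosB in E.
  rewrite /u; lra.
by rewrite sqrtr_sqr normrM ger0_norm.
Qed.

Lemma normc_cisB_le x y : normc (cis x - cis y) <= `|x - y|.
Proof.
rewrite normc_cisB; apply: le_trans (ler_wpM2l _ (norm_sin_le _)) _ => //.
by rewrite normrM (ger0_norm (_ : 0 <= 2^-1)) ?invr_ge0// mulrCA divff ?mulr1// pnatr_eq0.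
Qed.

Lemma normc_cisB_ge x y : `|x - y| <= pi -> `|x - y| / 2 <= normc (cis x - cis y).
Proof.
wlog xy : x y / y <= x.
  move=> H; have [|xy] := leP y x; first exact: H.
  rewrite distrC.
  have -> : normc (cis x - cis y) = normc (cis y - cis x).
    by rewrite !normc_cisB -normrN -sinN -mulNr opprB.
  by apply: H; exact: ltW.
rewrite normc_cisB ger0_norm ?subr_ge0// => xypi.
have H := @half_le_sin ((x - y) / 2) ltac:(lra) ltac:(lra).
rewrite ger0_norm; lra.
Qed.

(** Angles close to pi and to -pi are close on the circle: beyond a difference of pi the relevant
    arc has length 2 pi - (x - y). *)
Lemma normc_cisB_ge_wrap x y : pi <= x - y -> x - y <= 2 * pi ->
  (2 * pi - (x - y)) / 2 <= normc (cis x - cis y).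
Proof.
move=> d1 d2; rewrite normc_cisB.
have -> : sin ((x - y) / 2) = sin (pi - (x - y) / 2).
  by rewrite sinB sinpi cospi; ring.
have H := @half_le_sin (pi - (x - y) / 2) ltac:(lra) ltac:(lra).
rewrite ger0_norm; lra.
Qed.

End chord.

Section angles_integral.
Context {R : realType}.
Local Notation mu := (@lebesgue_measure R).

Lemma angles_integral_le (f B : R -> \bar R) :
  (forall x, angles x -> (0 <= f x)%E) ->
  measurable_fun `]0%R, pi[ B -> (forall x, 0 < x < pi -> (0 <= B x)%E) ->
  (forall x : R, x != 0 -> `|x| < pi -> (f x <= B `|x|%R)%E) ->
  (\int[mu]_(x in @angles R) f x <= 2%:E * \int[mu]_(x in `]0%R, pi[) B x)%E.
Proof.
move=> f0 mB B0 fB.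
have H : (\int[mu]_(x in @angles R) f x <=
          \int[mu]_(x in `](- pi)%R, pi[ `\ 0%R) f x)%E.
  have sub x : (`](- pi)%R, pi[ `\ (0 : R) `|` [set 0; pi])%classic x -> angles x.
    rewrite /angles/= !in_itv/= => -[[/andP[-> /ltW ->]]//|[->|->]].
      by have := pi_gt0 R; lra.
    by have := pi_gt0 R; lra.
  apply: (@ge0_integral_nullU_le _ (measurableTypeR R) R mu _ [set 0; pi]).
  - by apply: measurableD => //; exact: measurable_itv.
  - by apply: measurableU; exact: measurable_set1.
  - apply: countable_lebesgue_measure0; apply: finite_set_countable.
    exact: finite_set2.
  - by move=> x /sub; exact: f0.
  - rewrite /angles => x /=; rewrite !in_itv/= => /andP[x1 x2].
    have [->|x0] := eqVneq x 0; first by right; left.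
    have [->|xpi] := eqVneq x pi; first by right; right.
    by left; rewrite x1 lt_neqAle xpi x2; split => //; exact/eqP.
apply: (le_trans H); apply: le_trans (ge0_integral_norm_le mB B0).
apply: ge0_le_integral_nonmeas => x /= [].
  rewrite in_itv/= => /andP[x1 x2] _; apply: f0.
  by rewrite /angles/= in_itv/= x1 ltW.
by rewrite in_itv/= => x12 /eqP x0; apply: fB => //; rewrite ltr_norml.
Qed.

End angles_integral.

Section kernel.
Context {R : realType} (alpha : R) (alpha_gt0 : 0 < alpha) (alpha_lt1 : alpha < 1).
Implicit Types (x c k : R).

Lemma inv_powR_le x c k : 0 < x -> 1 <= c -> x / c <= k ->
  (k `^ (2 - alpha))^-1 <= c ^+ 2 * x `^ (alpha - 2).
Proof.
move=> x0 c1 xck.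
have c0 : 0 < c by lra.
have k0 : 0 < k by apply: lt_le_trans xck; rewrite divr_gt0.
rewrite -powRN opprB; apply: (@le_trans _ _ ((x / c) `^ (alpha - 2))).
  rewrite -opprB !powRN lef_pV2 ?posrE ?powR_gt0 ?divr_gt0//.
  apply: ge0_ler_powR => //; first by have := alpha_lt1; lra.
    by rewrite nnegrE divr_ge0// ltW.
  by rewrite nnegrE ltW.
rewrite powRM ?invr_ge0 ?(ltW x0) ?(ltW c0)// mulrC ler_wpM2r ?powR_ge0//.
rewrite -powR_inv1 ?(ltW c0)// -powRrM -powR_mulrn ?(ltW c0)//.
by apply: ler_powR => //; have := alpha_gt0; lra.
Qed.

End kernel.

Lemma measurable_fun_powRl d (T : measurableType d) (R : realType) (D : set T)
    (f : T -> R) (p : R) :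
  measurable_fun D f -> measurable_fun D (fun x => f x `^ p).
Proof.
by move=> mf; apply: (@measurableT_comp _ _ _ _ _ _ (@powR R ^~ p)).
Qed.

Lemma measurable_fun_ln d (T : measurableType d) (R : realType) (D : set T)
    (f : T -> R) : measurable_fun D f -> measurable_fun D (fun x => ln (f x)).
Proof.
by move=> mf; apply: (@measurableT_comp _ _ _ _ _ _ (@ln R)).
Qed.

Section integral_helpers.
Context {R : realType}.
Local Notation mu := (@lebesgue_measure R).

Lemma ge0_integral_lincomb_le (D : set R) (f g : R -> R) (c a b : R) :
  measurable D -> 0 <= c ->
  (forall x, D x -> 0 <= f x) -> (forall x, D x -> 0 <= g x) ->
  measurable_fun D f -> measurable_fun D g ->
  (\int[mu]_(x in D) (f x)%:E <= a%:E)%E ->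
  (\int[mu]_(x in D) (g x)%:E <= b%:E)%E ->
  (\int[mu]_(x in D) (c * (f x + g x))%:E <= (c * (a + b))%:E)%E.
Proof.
move=> mD c0 f0 g0 mf mg fa gb.
under eq_integral do rewrite EFinM EFinD.
rewrite ge0_integralZl//.
- rewrite EFinM lee_wpmul2l ?lee_fin//.
  rewrite ge0_integralD//.
  + by rewrite EFinD leeD.
  + by apply/measurable_EFinP.
  + by apply/measurable_EFinP.
- by apply: emeasurable_funD; apply/measurable_EFinP.
- by move=> x Dx; rewrite adde_ge0// lee_fin ?f0 ?g0.
Qed.

Lemma ge0_integralZ_le (D : set R) (f : R -> R) (c a : R) :
  measurable D -> 0 <= c -> (forall x, D x -> 0 <= f x) ->
  measurable_fun D f -> (\int[mu]_(x in D) (f x)%:E <= a%:E)%E ->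
  (\int[mu]_(x in D) (c * f x)%:E <= (c * a)%:E)%E.
Proof.
move=> mD c0 f0 mf fa.
under eq_integral do rewrite EFinM.
rewrite ge0_integralZl ?lee_fin//; first by rewrite EFinM lee_wpmul2l ?lee_fin//.
by apply/measurable_EFinP.
Qed.

Lemma ge0_integral_oo_split_le (f : R -> \bar R) (a b c : R) :
  a < b -> b < c -> (forall x, a < x < c -> (0 <= f x)%E) ->
  (\int[mu]_(x in `]a, c[) f x <=
   \int[mu]_(x in `]a, b[) f x + \int[mu]_(x in `]b, c[) f x)%E.
Proof.
move=> ab bc f0.
have sub x : ((`]a, b[ `|` `]b, c[) `|` [set b])%classic x -> a < x < c.
  rewrite /= !in_itv/= => -[[|]|->]; last by rewrite ab bc.
    by move=> /andP[-> xb]; rewrite (lt_trans xb).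
  by move=> /andP[xb ->]; rewrite (lt_trans _ xb).
have := @ge0_integral_setU_le _ (measurableTypeR R) R mu `]a, b[%classic `]b, c[%classic f
  (measurable_itv _) (measurable_itv _) _.
move=> /(_ _)/(le_trans _); apply; last by move=> x xab; apply/f0/sub; left.
apply: (@ge0_integral_nullU_le _ (measurableTypeR R) R mu _ [set b]).
- by apply: measurableU; exact: measurable_itv.
- exact: measurable_set1.
- exact: lebesgue_measure_set1.
- by move=> x /sub; exact: f0.
- move=> x /=; rewrite !in_itv/= => /andP[ax xc].
  have [xb|bx|->] := ltgtP x b; [left; left|left; right|by right];
  by rewrite ?ax ?xc.
Qed.

Lemma integral_powRB_tail_le (p a b c : R) : p < 0 -> a < c -> c < b ->
  (\int[mu]_(x in `]a, c[) ((b - x) `^ (p - 1))%:E <= ((b - c) `^ p / - p)%:E)%E.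
Proof.
move=> p0 ac cb.
have dB (x : R) : is_derive x 1 (fun t : R => b - t) (- 1).
  rewrite -[X in is_derive _ _ _ X]add0r.
  apply: (is_derive1D (f := cst b)); apply: (is_derive1N (f := id)).
apply: (@ge0_integral_oo_le _ _ (fun t => - p^-1 * (b - t) `^ p)) => //.
- by move=> x _; exact: powR_ge0.
- move=> x /andP[_ xc].
  apply: is_derive_continuous; apply: (is_derive1_comp' (f := @powR R ^~ (p-1)) _ (dB x)).
  by apply: is_derive1_powR; lra.
- move=> x /andP[_ xc]; apply: is_derive_eq.
    apply: is_derive1Z; apply: (is_derive1_comp' (f := @powR R ^~ p) _ (dB x)).
    by apply: is_derive1_powR; lra.
  by rewrite mulrN1 mulrN mulNr opprK mulrA mulVf ?lt_eqF// mul1r.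
- move=> u v u0 uv vb; rewrite -mulrBr invrN [leRHS]mulrC.
  rewrite ler_wpM2l ?oppr_ge0 ?invr_le0 ?(ltW p0)//.
  apply: le_trans (_ : (b - v) `^ p <= _); first by rewrite gerBl powR_ge0.
  rewrite -[p]opprK ![_ `^ (- - p)]powRN lef_pV2 ?posrE ?powR_gt0//; [|lra|lra].
  by apply: ge0_ler_powR; rewrite ?nnegrE ?oppr_ge0; lra.
Qed.

End integral_helpers.

(** * Double energies on the circle: finiteness and divergence criteria *)

Section energy.
Context {R : realType} (alpha beta : R)
  (alpha_gt0 : 0 < alpha) (alpha_lt1 : alpha < 1) (beta_gt0 : 0 < beta).
Implicit Types (x y p u v t : R).
Local Notation mu := (@lebesgue_measure R).
Local Notation kap := (2 * beta / alpha).
Local Notation L := (loginv alpha beta).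
Local Notation h := (hbeta alpha beta).
Local Notation k x y := (normc (cis x - cis y) `^ (2 - alpha)).
Let c0 := h pi / 2.
Let pi0 : 0 < pi :> R := pi_gt0 R.

(** One scheme for both energies: E is the numerator as a function of the two values of h, and q is
    2 beta for N and 2 beta - 1 for C. [E_le] is the crude size at scale p; [E_near] records that E
    vanishes quadratically on the diagonal in terms of ln a - ln b. *)
Context (E : R -> R -> R) (q W : R) (W_ge0 : 0 <= W).
Context (E_ge0 : forall a b, 0 < a -> 0 < b -> 0 <= E a b).
Context (EC : forall a b, E a b = E b a) (Exx : forall a, E a a = 0).
Context (E_le : forall p a b, 0 < p -> p <= pi -> c0 <= b -> b <= a ->
  a <= h p -> E a b <= W * (p `^ (- alpha) * L p `^ (- q))).
Context (E_near : forall p a b, 0 < p -> p <= pi -> 0 < b -> b <= a ->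
  a = h p -> E a b <= W * (p `^ (- alpha) * L p `^ (- q)) * (ln a - ln b) ^+ 2).

(** S bounds the energy density with p the smaller and v the larger absolute angle; T covers pairs
    that meet around the point -1. The cases below produce the constants 16, 4 and 36 in front of W
    S, hence the 40 in C; the second summand of C serves T. *)
Let S p v := p `^ (- alpha) * L p `^ (- q) * v `^ (alpha - 2).
Let T p v := ((pi - p) + (pi - v)) `^ (alpha - 2).
Let C := 40 * W + 4 * (W * ((pi / 2) `^ (- alpha) * L (pi / 2) `^ (- q))).

Let w t := t `^ (- alpha) * L t `^ (- q).

Let w_ge0 t : 0 <= w t. Proof. by rewrite mulr_ge0 ?powR_ge0. Qed.

Let S_ge0 p v : 0 <= S p v. Proof. by rewrite !mulr_ge0 ?powR_ge0. Qed.

Let T_ge0 p v : 0 <= T p v. Proof. exact: powR_ge0. Qed.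

Let h_gt0 t : t < pi -> 0 < h t.
Proof. by move=> tpi; apply: hbeta_gt0 => //; exact: ltW. Qed.

Let c0_le t : 0 < t -> t <= pi -> c0 <= h t.
Proof.
move=> t0 tpi; have := hbeta_le alpha_gt0 beta_gt0 t0 tpi (lexx _).
by have := hbeta_gt0 alpha_gt0 beta_gt0 (lexx pi); rewrite /c0; lra.
Qed.

Let C_ge d : d <= 40 * W -> d <= C.
Proof. by rewrite /C; have := mulr_ge0 W_ge0 (w_ge0 (pi / 2)); rewrite /w; lra. Qed.

(** If y >= 2x the chord is comparable to y and the crude bound on E is enough. If y < 2x then ln
    h(x) - ln h(y) <= (y - x)/y, and its square cancels the singularity of the kernel, leaving (y -
    x)^alpha / y^2, at most y^(alpha-2). *)
Let energy_same x y : 0 < x -> x <= y -> y < pi ->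
  E (h x) (h y) / k x y <= 40 * W * S x y.
Proof.
move=> x0 xy ypi; have a0 := alpha_gt0; have a1 := alpha_lt1; have W0 := W_ge0.
have y0 : 0 < y by exact: lt_le_trans xy.
have xpi : x < pi by exact: le_lt_trans ypi.
have Exy : 0 <= E (h x) (h y) by apply: E_ge0; exact: h_gt0.
have kd : (y - x) / 2 <= normc (cis x - cis y).
  have := @normc_cisB_ge R x y; rewrite distrC ger0_norm ?subr_ge0//.
  by apply; lra.
have hyx : h y <= h x by apply: hbeta_le => //; exact: ltW.
have [far|near] := leP (2 * x) y.
  have K := inv_powR_le a0 a1 y0 (_ : 1 <= 4) (_ : y / 4 <= normc (cis x - cis y)).
  apply: (@le_trans _ _ (W * w x * (4 ^+ 2 * y `^ (alpha - 2)))).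
    apply: ler_pM => //; first by rewrite invr_ge0 powR_ge0.
      by apply: E_le => //; [exact: ltW|apply: c0_le => //; exact: ltW].
    by apply: K; lra.
  have -> : W * w x * (4 ^+ 2 * y `^ (alpha - 2)) = 16 * W * S x y by rewrite /S /w; ring.
  by rewrite ler_wpM2r ?S_ge0//; lra.
have [xeq|xneq] := eqVneq x y.
  by rewrite xeq Exx mul0r !mulr_ge0 ?powR_ge0.
have d0 : 0 < y - x by rewrite subr_gt0 lt_neqAle xneq; lra.
have lnd : ln (h x) - ln (h y) <= (y - x) / y.
  apply: le_trans (ln_hbeta_sub_le alpha_gt0 beta_gt0 x0 xy (ltW ypi)) _.
  have : ln y - ln x <= (y - x) / x.
    rewrite -ln_div ?posrE// (_ : y / x = 1 + (y - x) / x); last by field; rewrite gt_eqF.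
    apply: le_ln1Dx; apply: lt_le_trans (_ : 0 <= _); first by lra.
    by rewrite divr_ge0 ?(ltW d0) ?(ltW x0).
  have : (y - x) / x <= 2 * ((y - x) / y).
    rewrite mulrCA ler_wpM2l ?(ltW d0)// -[leLHS]div1r ler_pdivrMr//.
    by rewrite mulrAC ler_pdivlMr// mul1r; lra.
  have : 0 <= (y - x) / y by rewrite divr_ge0 ?(ltW d0) ?(ltW y0).
  set A := (y - x) / y; set B := (y - x) / x; set D := ln y - ln x.
  move=> A0 BA DB; have := ler_wpM2l (ltW a0) DB; have := ler_wpM2l (ltW a0) BA.
  by have := ler_wpM2r A0 (ltW a1); lra.
have lnd0 : 0 <= ln (h x) - ln (h y).
  by rewrite subr_ge0; apply: ln_hbeta_le => //; exact: ltW.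
have K := inv_powR_le a0 a1 d0 (ler1n R 2) kd.
apply: (@le_trans _ _ (W * w x * ((y - x) / y) ^+ 2 * (2 ^+ 2 * (y - x) `^ (alpha - 2)))).
  apply: ler_pM => //; first by rewrite invr_ge0 powR_ge0.
  apply: le_trans (E_near x0 (ltW xpi) (h_gt0 ypi) hyx erefl) _.
  rewrite ler_wpM2l ?mulr_ge0 ?powR_ge0//.
  by rewrite lerXn2r ?nnegrE// divr_ge0 ?(ltW d0) ?(ltW y0).
have -> : W * w x * ((y - x) / y) ^+ 2 * (2 ^+ 2 * (y - x) `^ (alpha - 2)) =
    4 * W * w x * ((y - x) ^+ 2 * (y - x) `^ (alpha - 2)) / y ^+ 2.
  by field; rewrite gt_eqF.
rewrite -(powR_mulrn 2 (ltW d0)) -powRD; last by rewrite (gt_eqF d0) implybT.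
rewrite (_ : 2%:R + (alpha - 2) = alpha); last by ring.
rewrite /S -/(w x) powRD; last by rewrite (gt_eqF y0) implybT.
rewrite powRN powR_mulrn ?(ltW y0)//.
rewrite [leRHS](_ : _ = 40 * W * w x * y `^ alpha / y ^+ 2); last by ring.
rewrite ler_wpM2r ?invr_ge0 ?exprn_ge0 ?(ltW y0)//.
apply: ler_pM; rewrite ?mulr_ge0 ?powR_ge0//.
  by rewrite ler_wpM2r// ler_wpM2r// ler_nat.
by apply: ge0_ler_powR; rewrite ?nnegrE; lra.
Qed.

(** Here E is bounded only through h(x) <= h(m), and the chord only through x + u = m + M, so m and
    M can be x and u in either order. *)
Let energy_opp x u m M : 0 < m -> m <= M -> M < pi -> x + u = m + M -> m <= x ->
  x < pi ->
  E (h x) c0 / k x (- u) <= C * (S m M + T m M).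
Proof.
move=> m0 mM Mpi xu mx xpi.
have a0 := alpha_gt0; have a1 := alpha_lt1; have W0 := W_ge0; have pi_0 := pi0.
have x0 : 0 < x by exact: lt_le_trans mx.
have M0 : 0 < M by exact: lt_le_trans mM.
have mpi : m < pi by exact: le_lt_trans Mpi.
have c0x : c0 <= h x by apply: c0_le => //; exact: ltW.
have c00 : 0 < c0 by rewrite /c0 divr_gt0// hbeta_gt0.
have Exy : 0 <= E (h x) c0 by apply: E_ge0 => //; exact: h_gt0.
have hxm : h x <= h m by apply: hbeta_le => //; exact: ltW.
have Ew : E (h x) c0 <= W * w m by apply: E_le => //; exact: ltW.
have dE : x - - u = m + M by rewrite opprK.
(* For m < pi/2 the two points cannot approach each other around -1 and the chord is at least M/6.
   Otherwise the chord is compared with 2 pi - m - M, and m >= pi/2 keeps E bounded. *)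
have [mpi2|mpi2] := ltP m (pi / 2).
  have kd : M / 6 <= normc (cis x - cis (- u)).
    have [d1|d1] := leP (m + M) pi.
      have := @normc_cisB_ge R x (- u); rewrite dE ger0_norm; last by lra.
      by move=> /(_ d1); lra.
    have := @normc_cisB_ge_wrap R x (- u); rewrite dE.
    by move=> /(_ ltac:(lra) ltac:(lra)); lra.
  have K := inv_powR_le a0 a1 M0 (ler1n R 6) kd.
  apply: (@le_trans _ _ (W * w m * (6 ^+ 2 * M `^ (alpha - 2)))).
    by apply: ler_pM => //; rewrite invr_ge0 powR_ge0.
  have -> : W * w m * (6 ^+ 2 * M `^ (alpha - 2)) = 36 * W * S m M by rewrite /S /w; ring.
  apply: ler_pM; rewrite ?S_ge0 ?mulr_ge0//; first by apply: C_ge; lra.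
  by rewrite lerDl T_ge0.
have kd : ((pi - m) + (pi - M)) / 2 <= normc (cis x - cis (- u)).
  have := @normc_cisB_ge_wrap R x (- u); rewrite dE.
  by move=> /(_ ltac:(lra) ltac:(lra)); lra.
have K := inv_powR_le a0 a1 (_ : 0 < (pi - m) + (pi - M)) (ler1n R 2) kd.
apply: (@le_trans _ _ (W * w (pi / 2) * (2 ^+ 2 * T m M))).
  apply: ler_pM => //; first by rewrite invr_ge0 powR_ge0.
    apply: E_le => //; [lra|lra|].
    apply: hbeta_le => //; [lra|exact: le_trans mx|exact: ltW].
  by apply: K; lra.
have -> : W * w (pi / 2) * (2 ^+ 2 * T m M) = 4 * (W * w (pi / 2)) * T m M by ring.
have Ww : 0 <= W * w (pi / 2) := mulr_ge0 W_ge0 (w_ge0 _).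
apply: ler_pM; [by rewrite mulr_ge0|exact: T_ge0| |by rewrite lerDr S_ge0].
by rewrite /C -/(w (pi / 2)); move: Ww; set z := W * w (pi / 2); lra.
Qed.

Let energy_kernel_le x y : x != 0 -> y != 0 -> `|x| <= `|y| -> `|y| < pi ->
  E (h x) (h y) / k x y <= C * (S `|x| `|y| + T `|x| `|y|).
Proof.
move=> x0 y0 xy ypi.
have p0 : 0 < `|x| by rewrite normr_gt0.
have v0 : 0 < `|y| by rewrite normr_gt0.
have xpi : x < pi by apply: le_lt_trans (le_lt_trans xy ypi); exact: ler_norm.
have yypi : y < pi by apply: le_lt_trans ypi; exact: ler_norm.
have C0 : 0 <= C by apply: C_ge; rewrite mulr_ge0.
have [x_gt0|x_le0] := ltP 0 x; have [y_gt0|y_le0] := ltP 0 y.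
- rewrite !gtr0_norm// in xy *.
  apply: le_trans (energy_same x_gt0 xy yypi) _.
  apply: ler_pM; rewrite ?S_ge0 ?mulr_ge0//; first exact: C_ge.
  by rewrite lerDl T_ge0.
- rewrite (hbeta_le0 _ _ y_le0) -/c0 -[y in k x y]opprK.
  apply: energy_opp => //; last by rewrite (gtr0_norm x_gt0).
  by rewrite (gtr0_norm x_gt0) ler0_norm.
- rewrite (hbeta_le0 _ _ x_le0) -/c0 EC.
  have -> : k x y = k y (- - x) by rewrite opprK !normc_cisB -normrN -sinN -mulNr opprB.
  apply: energy_opp => //.
    by rewrite (gtr0_norm y_gt0) (ler0_norm x_le0) addrC.
  by move: xy; rewrite (gtr0_norm y_gt0).
- by rewrite (hbeta_le0 _ _ x_le0) (hbeta_le0 _ _ y_le0) Exx mul0r mulr_ge0// addr_ge0// ?S_ge0 ?T_ge0.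
Qed.

Let D := 2 * C / (1 - alpha).

Let C_ge0 : 0 <= C. Proof. by apply: C_ge; rewrite mulr_ge0. Qed.

(** With v = |y|, split the x-integral at |x| = v. Below v, L(|x|) >= L(v) lets the logarithm be
    frozen at v, and |x|^(-alpha) is integrable at 0; above v, |x|^(alpha-2) is integrable at
    infinity. Each side gives v^(-1) L(v)^(-q) / (1 - alpha), plus a term from T. *)
Let energy_inner_le y : 0 <= q -> y != 0 -> `|y| < pi ->
  (\int[mu]_(x in @angles R) (E (h x) (h y) / k x y)%:E <=
   (2 * (D * (`|y|^-1 * L `|y| `^ (- q) + (pi - `|y|) `^ (alpha - 1))))%:E)%E.
Proof.
move=> q0 y0 ypi; have a1 := alpha_lt1; have a0 := alpha_gt0.
have v0 : 0 < `|y| by rewrite normr_gt0.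
set v := `|y| in v0 ypi *.
pose B1 p := C * (L v `^ (- q) * v `^ (alpha - 2) * p `^ (1 - alpha - 1) + T p v).
pose B2 p := C * (w v * p `^ (alpha - 1 - 1) + T p v).
pose B p := if p < v then B1 p else B2 p.
have B10 p : 0 <= B1 p by rewrite mulr_ge0// addr_ge0 ?T_ge0// !mulr_ge0 ?powR_ge0.
have B20 p : 0 <= B2 p by rewrite mulr_ge0// addr_ge0 ?T_ge0// !mulr_ge0 ?powR_ge0.
have mT : measurable_fun setT (T ^~ v).
  apply: measurable_fun_powRl.
  by apply: measurable_funD => //; exact: measurable_funB.
have mB1 : measurable_fun setT B1.
  apply: measurable_funM => //; apply: measurable_funD => //.
  by apply: measurable_funM => //; exact: measurable_powR.
have mB2 : measurable_fun setT B2.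
  apply: measurable_funM => //; apply: measurable_funD => //.
  by apply: measurable_funM => //; exact: measurable_powR.
have mB : measurable_fun setT B.
  by apply: measurable_fun_ifT => //; exact: measurable_fun_ltr.
apply: le_trans (@angles_integral_le R _ (EFin \o B) _ _ _ _) _.
- move=> x; rewrite /angles/= in_itv/= => /andP[_ xpi].
  rewrite lee_fin divr_ge0 ?powR_ge0//.
  by apply: E_ge0; apply: hbeta_gt0 => //; apply: le_trans (ler_norm _) (ltW ypi).
- by apply/measurable_EFinP; exact: measurable_funTS.
- by move=> x _; rewrite /= lee_fin /B; case: ifP.
- move=> x x0 xpi; rewrite /= lee_fin /B; case: ltP => xv.
    apply: le_trans (energy_kernel_le x0 y0 (ltW xv) ypi) _.
    rewrite /B1 -/v ler_wpM2l// lerD2r /S (_ : 1 - alpha - 1 = - alpha); last by ring.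
    rewrite -mulrA [leRHS]mulrC ler_wpM2l ?powR_ge0// ler_wpM2r ?powR_ge0//.
    have x0' : 0 < `|x| by rewrite normr_gt0.
    rewrite !powRN lef_pV2 ?posrE ?powR_gt0 ?loginv_gt0 ?(ltW ypi) ?(ltW xpi)//.
    apply: ge0_ler_powR; rewrite ?nnegrE ?loginv_le// ?(ltW xv)//;
      by apply/ltW/loginv_gt0 => //; exact: ltW.
  rewrite EC; have -> : k x y = k y x by rewrite !normc_cisB -normrN -sinN -mulNr opprB.
  apply: le_trans (energy_kernel_le y0 x0 xv xpi) _.
  rewrite /B2 -/v ler_wpM2l// /S /w /T (_ : alpha - 1 - 1 = alpha - 2); last by ring.
  by rewrite [pi - v + _]addrC.
rewrite [in leRHS]EFinM lee_wpmul2l//.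
apply: le_trans (ge0_integral_oo_split_le v0 ypi _) _.
  by move=> x _; rewrite /= lee_fin /B; case: ifP.
have TI a c : a < c -> c <= pi ->
    (\int[mu]_(x in `]a, c[) (T x v)%:E <= ((pi - v) `^ (alpha - 1) / (1 - alpha))%:E)%E.
  move=> ac cpi.
  have := @integral_powRB_tail_le R (alpha - 1) a (2 * pi - v) c ltac:(lra) ac ltac:(lra).
  rewrite opprB => H; apply: le_trans (le_trans H _).
    rewrite le_eqVlt; apply/orP; left; apply/eqP; apply: eq_integral => x _.
    by congr (_%:E); rewrite /T; congr (_ `^ _); ring.
  rewrite lee_fin ler_wpM2r ?invr_ge0; [|lra|].
    done.
  rewrite (_ : alpha - 1 = - (1 - alpha)); last by ring.
  rewrite !powRN lef_pV2 ?posrE ?powR_gt0//; try lra.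
  by apply: ge0_ler_powR; rewrite ?nnegrE; lra.
have vv r : v `^ r * v `^ (alpha - 2) = v `^ (r + alpha - 2).
  by rewrite -addrA [RHS]powRD// (gt_eqF v0) implybT.
have I1 : (\int[mu]_(x in `]0%R, v[) (B x)%:E <=
    (C * (v^-1 * L v `^ (- q) / (1 - alpha) + (pi - v) `^ (alpha - 1) / (1 - alpha)))%:E)%E.
  apply: (@le_trans _ _ (\int[mu]_(x in `]0%R, v[) (B1 x)%:E)%E).
    apply: ge0_le_integral_nonmeas => x /=; rewrite in_itv/= => /andP[x0 xv].
      by rewrite lee_fin /B xv.
    by rewrite lee_fin /B xv.
  apply: ge0_integral_lincomb_le => //.
  - by move=> x _; rewrite !mulr_ge0 ?powR_ge0.
  - by apply: measurable_funM => //; apply: measurable_funTS; exact: measurable_powR.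
  - exact: measurable_funTS.
  - have -> : v^-1 * L v `^ (- q) / (1 - alpha) =
        L v `^ (- q) * v `^ (alpha - 2) * (v `^ (1 - alpha) / (1 - alpha)).
      have <- : v `^ (1 - alpha) * v `^ (alpha - 2) = v^-1.
        by rewrite vv -powR_inv1 ?(ltW v0)//; congr (_ `^ _); ring.
      ring.
    apply: ge0_integralZ_le => //.
    + by rewrite mulr_ge0 ?powR_ge0.
    + by move=> x _; exact: powR_ge0.
    + by apply: measurable_funTS; exact: measurable_powR.
    + by apply: integral_powR_le => //; lra.
  - by apply: TI => //; exact: ltW.
have I2 : (\int[mu]_(x in `]v, pi[) (B x)%:E <=
    (C * (v^-1 * L v `^ (- q) / (1 - alpha) + (pi - v) `^ (alpha - 1) / (1 - alpha)))%:E)%E.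
  apply: (@le_trans _ _ (\int[mu]_(x in `]v, pi[) (B2 x)%:E)%E).
    apply: ge0_le_integral_nonmeas => x /=; rewrite in_itv/= => /andP[x0 xv].
      by rewrite lee_fin /B; case: ifP.
    by rewrite lee_fin /B ltNge (ltW x0).
  apply: ge0_integral_lincomb_le => //.
  - by move=> x _; rewrite !mulr_ge0 ?powR_ge0.
  - by apply: measurable_funM => //; apply: measurable_funTS; exact: measurable_powR.
  - exact: measurable_funTS.
  - have -> : v^-1 * L v `^ (- q) / (1 - alpha) = w v * (v `^ (alpha - 1) / - (alpha - 1)).
      have <- : v `^ (- alpha) * v `^ (alpha - 1) = v^-1.
        rewrite -powRD; last by rewrite (gt_eqF v0) implybT.
        by rewrite -powR_inv1 ?(ltW v0)//; congr (_ `^ _); ring.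
      by rewrite /w opprB; ring.
    apply: ge0_integralZ_le => //.
    + by move=> x _; exact: powR_ge0.
    + by apply: measurable_funTS; exact: measurable_powR.
    + by apply: integral_powR_tail_le => //; lra.
  - by apply: TI => //.
apply: le_trans (leeD I1 I2) _; rewrite -EFinD lee_fin /D.
by rewrite le_eqVlt; apply/orP; left; apply/eqP; field; rewrite subr_eq0 (gt_eqF a1) (gt_eqF v0).
Qed.

Lemma energy_lt_pinfty : 1 < q ->
  (\int[mu]_(y in @angles R) \int[mu]_(x in @angles R)
     (E (h x) (h y) / k x y)%:E < +oo)%E.
Proof.
move=> q1; have a1 := alpha_lt1; have a0 := alpha_gt0; have pi_0 := pi0.
have D0 : 0 <= 2 * D by rewrite mulr_ge0// /D divr_ge0 ?mulr_ge0//; lra.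
pose B v := 2 * D * (v^-1 * L v `^ (- q) + (pi - v) `^ (alpha - 1)).
have m1 : measurable_fun `]0, pi[ (fun v => v^-1 * L v `^ (- q)).
  apply/measurable_EFinP; apply: open_itv_continuous_measurable => v /andP[v0 vpi].
  by apply: continuous_inv_loginv => //; exact: ltW.
have m2 : measurable_fun `]0, pi[ (fun v => (pi - v) `^ (alpha - 1)).
  by apply: measurable_fun_powRl; exact: measurable_funB.
have B0 v : 0 < v < pi -> 0 <= B v.
  move=> /andP[v0 vpi]; rewrite mulr_ge0// addr_ge0 ?powR_ge0//.
  by rewrite mulr_ge0 ?powR_ge0// invr_ge0 ltW.
apply: le_lt_trans (@angles_integral_le R _ (EFin \o B) _ _ _ _) _.
- move=> y; rewrite /angles/= in_itv/= => /andP[_ ypi].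
  apply: integral_ge0 => x; rewrite /angles/= in_itv/= => /andP[_ xpi].
  by rewrite lee_fin divr_ge0 ?powR_ge0// E_ge0 ?hbeta_gt0.
- apply/measurable_EFinP; apply: measurable_funM => //.
  exact: measurable_funD.
- by move=> v vpi; rewrite /= lee_fin B0.
- move=> y y0 ypi; rewrite /= /B -[2 * D * _]mulrA; apply: energy_inner_le => //; lra.
have H : (\int[mu]_(x in `]0%R, pi[) (B x)%:E <= (2 * D *
    (kap `^ (1 - q) / (q - 1) + (pi - 0) `^ alpha / alpha))%:E)%E.
  apply: ge0_integral_lincomb_le => //.
  - move=> x; rewrite /= in_itv/= => /andP[x0 _].
    by rewrite mulr_ge0 ?powR_ge0// invr_ge0 ltW.
  - by move=> x _; exact: powR_ge0.
  - exact: integral_loginv_le.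
  - exact: integral_powRB_le.
apply: le_lt_trans (_ : (2%:E * _)%E < +oo)%E; first exact: lee_wpmul2l H.
by rewrite -EFinM ltry.
Qed.

End energy.

Section energy_lower_bound.
Context {R : realType} (alpha beta : R)
  (alpha_gt0 : 0 < alpha) (alpha_lt1 : alpha < 1) (beta_gt0 : 0 < beta).
Implicit Types (x y p u v t : R).
Local Notation mu := (@lebesgue_measure R).
Local Notation L := (loginv alpha beta).
Local Notation h := (hbeta alpha beta).
Local Notation k x y := (normc (cis x - cis y) `^ (2 - alpha)).
Let c0 := h pi / 2.

Context (E : R -> R -> R) (q W : R) (W_gt0 : 0 < W).
Context (E_ge0 : forall a b, 0 < a -> 0 < b -> 0 <= E a b).
Context (E_ge : forall t a, 0 < t -> t <= 1 -> h t <= a ->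
  W * (t `^ (- alpha) * L t `^ (- q)) <= E a c0).

(** It is enough to keep y = -u with 0 < u < 1 and x between u/2 and u: there the chord is at most
    2u and the numerator at least its size at scale u, so the inner integral is at least a multiple
    of u^(-1) L(u)^(-q). *)
Lemma energy_pinfty : q <= 1 ->
  (\int[mu]_(y in @angles R) \int[mu]_(x in @angles R)
     (E (h x) (h y) / k x y)%:E = +oo)%E.
Proof.
move=> q1; have a1 := alpha_lt1; have a0 := alpha_gt0; have W0 := W_gt0.
have pi2 := pi_ge2 R.
apply/eqP; rewrite -leye_eq.
have f0 x y : angles x -> angles y -> (0 <= (E (h x) (h y) / k x y)%:E)%E.
  rewrite /angles/= !in_itv/= => /andP[_ xpi] /andP[_ ypi].
  by rewrite lee_fin divr_ge0 ?powR_ge0// E_ge0 ?hbeta_gt0.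
pose g u := W / 8 * (u^-1 * L u `^ (- q)).
have mg : measurable_fun (`]0, 1[%classic : set R) (fun v : R => v^-1 * L v `^ (- q)).
  apply/measurable_EFinP; apply: open_itv_continuous_measurable => v /andP[v0 v1].
  by apply: continuous_inv_loginv => //; lra.
have g0 u : 0 < u < 1 -> 0 <= u^-1 * L u `^ (- q).
  by move=> /andP[u0 _]; rewrite mulr_ge0 ?powR_ge0// invr_ge0 ltW.
apply: (@le_trans _ _ (\int[mu]_(y in `](- 1)%R, (- 0)%R[) (g (- y))%:E)%E).
  rewrite (@ge0_integral_oppr_oo _ (EFin \o g)).
  - rewrite /g /=; under eq_integral do rewrite EFinM.
    rewrite ge0_integralZl//.
    + rewrite integral_loginv_pinfty//; last by lra.
      by rewrite gt0_muley// lte_fin divr_gt0.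
    + exact/measurable_EFinP.
    + by rewrite lee_fin divr_ge0 ?(ltW W0).
  - by apply/measurable_EFinP; apply: measurable_funM.
  - by move=> u /g0; rewrite lee_fin => u0; rewrite mulr_ge0// divr_ge0 ?(ltW W0).
have angles1 y : -1 < y < 1 -> angles y.
  by move=> /andP[y1 y2]; rewrite /angles/= in_itv/=; apply/andP; split; lra.
apply: (@le_trans _ _ (\int[mu]_(y in `](- 1)%R, (- 0)%R[)
    \int[mu]_(x in @angles R) (E (h x) (h y) / k x y)%:E)%E); last first.
  apply: ge0_subset_integral_nonmeas => y.
    by move=> ay; apply: integral_ge0 => x ax; exact: f0.
  by rewrite /= in_itv/= => /andP[y1 y0]; apply: angles1; lra.
apply: ge0_le_integral_nonmeas => y; rewrite /= in_itv/= oppr0 => /andP[y1 y0].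
  by rewrite lee_fin mulr_ge0 ?g0 ?divr_ge0 ?(ltW W0)//; lra.
pose u := - y; have u0 : 0 < u by rewrite oppr_gt0.
have u1 : u < 1 by rewrite /u; lra.
(* The constant 4 is the bound for 2^(2 - alpha); the width u/2 of the x-interval then turns W/4
   into the W/8 of [g]. *)
pose m := W / 4 * (u `^ (- 2) * L u `^ (- q)).
apply: (@le_trans _ _ (\int[mu]_(x in `](u / 2)%R, u[) m%:E)%E).
  rewrite integral_cst//= lebesgue_measure_itv/= lte_fin ifT; last by lra.
  rewrite -EFinB -EFinM lee_fin /g -/u /m [u `^ (- 2)]powRN (powR_mulrn 2) ?(ltW u0)//.
  by rewrite le_eqVlt; apply/orP; left; apply/eqP; field; rewrite gt_eqF.
apply: (@le_trans _ _ (\int[mu]_(x in `](u / 2)%R, u[) (E (h x) (h y) / k x y)%:E)%E);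
  last first.
  apply: ge0_subset_integral_nonmeas => x.
    by move=> ax; apply: f0 => //; apply: angles1; lra.
  by rewrite /= in_itv/= => /andP[x1 x0]; apply: angles1; lra.
apply: ge0_le_integral_nonmeas => x; rewrite /= in_itv/= => /andP[xu ux].
  by rewrite lee_fin !mulr_ge0 ?powR_ge0 ?(ltW W0).
rewrite lee_fin (hbeta_le0 _ _ (ltW y0)) -/c0.
have dE : x - y = x + u by rewrite /u; ring.
have kge : 0 < normc (cis x - cis y).
  have := @normc_cisB_ge R x y; rewrite dE ger0_norm; last by lra.
  by move=> /(_ ltac:(lra)); lra.
have kle : normc (cis x - cis y) <= 2 * u.
  by apply: (le_trans (normc_cisB_le _ _)); rewrite dE ger0_norm; lra.
rewrite ler_pdivlMr ?powR_gt0//.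
apply: le_trans (E_ge u0 (ltW u1) (_ : h u <= h x)); last first.
  by apply: hbeta_le => //; [lra|exact: ltW|lra].
have kk : k x y <= 4 * u `^ (2 - alpha).
  apply: le_trans (_ : (2 * u) `^ (2 - alpha) <= _).
    by apply: ge0_ler_powR; rewrite ?nnegrE ?(ltW kge)//; lra.
  rewrite powRM ?(ltW u0)// ler_wpM2r ?powR_ge0//.
  have -> : 4 = 2 `^ 2%:R :> R by rewrite powR_mulrn// expr2; ring.
  by apply: ler_powR; [rewrite ler1n|lra].
have m0 : 0 <= m by rewrite !mulr_ge0 ?powR_ge0 ?(ltW W0).
apply: le_trans (ler_wpM2l m0 kk) _.
have -> : u `^ (- alpha) = u `^ (- 2) * u `^ (2 - alpha).
  by rewrite -powRD; [congr (_ `^ _); ring|rewrite (gt_eqF u0) implybT].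
by rewrite /m le_eqVlt; apply/orP; left; apply/eqP; field.
Qed.

End energy_lower_bound.

Lemma powR_addr1 (R : realType) (x p : R) : 0 < x -> x `^ (p + 1) = x `^ p * x.
Proof.
by move=> x0; rewrite powRD ?powRr1 ?(ltW x0)// (gt_eqF x0) implybT.
Qed.

(** * The thresholds for N and C *)

Section energies.
Context {R : realType} (alpha beta : R)
  (alpha_gt0 : 0 < alpha) (alpha_lt1 : alpha < 1) (beta_gt0 : 0 < beta).
Implicit Types (a b p t : R).
Local Notation kap := (2 * beta / alpha).
Local Notation L := (loginv alpha beta).
Local Notation h := (hbeta alpha beta).
Let c0 := h pi / 2.

Let c0_gt0 : 0 < c0. Proof. by rewrite divr_gt0// hbeta_gt0. Qed.

Let kap_gt0 : 0 < kap. Proof. by rewrite divr_gt0// mulr_gt0. Qed.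

Let sub_le_ln a b : 0 < b -> b <= a -> a - b <= a * (ln a - ln b).
Proof.
move=> b0 ba; have a0 := lt_le_trans b0 ba.
have : ln (b / a) <= (b - a) / a.
  rewrite (_ : b / a = 1 + (b - a) / a); last by field; rewrite gt_eqF.
  apply: le_ln1Dx; rewrite ltr_pdivlMr//; lra.
rewrite ln_div ?posrE// ler_pdivlMr// => H; lra.
Qed.

(** The halved value on the negative arc keeps the jump proportional to h itself: a - c0 is at least
    a/2, so the numerators are bounded below by multiples of h(t)^2. *)
Let c0_le t a : 0 < t -> t <= 1 -> h t <= a -> 2 * c0 <= a.
Proof.
move=> t0 t1 hta; have := pi_ge2 R => pi2.
have := hbeta_le alpha_gt0 beta_gt0 t0 (_ : t <= pi) (lexx _).
by move=> /(_ ltac:(lra)); rewrite /c0; lra.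
Qed.

(** The numerator has size h^2 = t^(-alpha) L^(-2 beta), so the criteria apply with q = 2 beta. Near
    the diagonal a - b <= a (ln a - ln b) gives the quadratic bound. *)
Lemma Nalpha_hbeta : (Nalpha alpha h < +oo)%E <-> 2^-1 < beta.
Proof.
have D0 a b : 0 < a -> 0 < b -> 0 <= `|a - b| ^+ 2 by rewrite exprn_ge0.
split=> [|b2].
  move=> Nfin; rewrite ltNge; apply/negP => b2; move: Nfin.
  rewrite /Nalpha (@energy_pinfty _ _ _ alpha_gt0 alpha_lt1 beta_gt0
    (fun a b => `|a - b| ^+ 2) (2 * beta) 4^-1)//; last by lra.
  move=> t a t0 t1 hta; have pi2 := pi_ge2 R.
  have tpi : t <= pi by lra.
  rewrite -sqr_hbeta// -/c0 real_normK ?num_real//.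
  have := c0_le t0 t1 hta; have := hbeta_gt0 alpha_gt0 beta_gt0 tpi.
  by move: hta; move: (h t) c0 c0_gt0 => x c; nra.
apply: (@energy_lt_pinfty _ _ _ alpha_gt0 alpha_lt1 beta_gt0
    (fun a b => `|a - b| ^+ 2) (2 * beta) 1) => //.
- by move=> a b; rewrite distrC.
- by move=> a; rewrite subrr normr0 expr0n.
- move=> p a b p0 ppi cb ba ah; rewrite mul1r -sqr_hbeta// real_normK ?num_real//.
  have := c0_gt0; rewrite /c0; move: ah cb ba; move: (h p) (h pi / 2) => x c; nra.
- move=> p a b p0 ppi b0 ba ah; rewrite mul1r -sqr_hbeta// real_normK ?num_real//.
  rewrite -ah -exprMn; have := sub_le_ln b0 ba; have : 0 <= a - b by lra.
  by move=> H1 H2; rewrite lerXn2r ?nnegrE//; exact: le_trans H2.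
- lra.
Qed.

(** Across the jump the logarithm is comparable to L, so the numerator has size h^2 L = t^(-alpha)
    L^(1 - 2 beta), and the criteria apply with q = 2 beta - 1. *)
Lemma Calpha_hbeta : (Calpha alpha h < +oo)%E <-> 1 < beta.
Proof.
have D0 a b : 0 < a -> 0 < b -> 0 <= (a ^+ 2 - b ^+ 2) * ln (a / b).
  move=> a0 b0; rewrite ln_div ?posrE//.
  have [ab|/ltW ba] := leP a b.
    apply: mulr_le0; rewrite subr_le0; last by rewrite ler_ln ?posrE.
    by rewrite lerXn2r ?nnegrE// ltW.
  apply: mulr_ge0; rewrite subr_ge0; last by rewrite ler_ln ?posrE.
  by rewrite lerXn2r ?nnegrE// ltW.
split=> [|b1].
  move=> Cfin; rewrite ltNge; apply/negP => b1; move: Cfin.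
  have [c c_gt0 cL] := hgap_ge alpha_gt0 beta_gt0.
  rewrite /Calpha (@energy_pinfty _ _ _ alpha_gt0 alpha_lt1 beta_gt0
    (fun a b => (a ^+ 2 - b ^+ 2) * ln (a / b)) (2 * beta - 1) (c / 2))//; last by lra.
    by rewrite divr_gt0.
  move=> t a t0 t1 hta; have pi2 := pi_ge2 R.
  have tpi : t <= pi by lra.
  have Lt := loginv_gt0 alpha_gt0 beta_gt0 t0 tpi.
  have E : t `^ (- alpha) * L t `^ (- (2 * beta - 1)) = h t ^+ 2 * L t.
    by rewrite sqr_hbeta// -mulrA -powR_addr1// (_ : - (2 * beta - 1) = - (2 * beta) + 1)//; ring.
  rewrite E -/c0.
  have := c0_le t0 t1 hta; have ht0 := hbeta_gt0 alpha_gt0 beta_gt0 tpi.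
  have a0 : 0 < a by exact: lt_le_trans hta.
  have : c * L t <= ln (a / c0).
    apply: le_trans (cL t t0 tpi) _; rewrite /hgap -/c0 [ln (a / c0)]ln_div ?posrE// lerD2r.
    by rewrite ler_ln ?posrE.
  move=> H1 H2; rewrite (_ : c / 2 * (h t ^+ 2 * L t) = (h t ^+ 2 / 2) * (c * L t)); last by ring.
  apply: ler_pM => //; rewrite ?mulr_ge0 ?exprn_ge0 ?(ltW ht0) ?(ltW Lt) ?(ltW c_gt0)//.
  by move: hta H2 ht0 c0_gt0; move: (h t) c0 => x y; nra.
(* The first two terms bound the jump by a multiple of L ([hgap_le]). The last one absorbs the 2 in
   a^2 - b^2 <= 2 a^2 (ln a - ln b), because 2 <= (2/kap) L. *)
pose W := alpha / 2 + ln 2 / kap + 2 / kap.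
have l2 : 0 <= ln 2 :> R by rewrite ln_ge0// ler1n.
have hL p : 0 < p -> p <= pi ->
    p `^ (- alpha) * L p `^ (- (2 * beta - 1)) = h p ^+ 2 * L p.
  move=> p0 ppi; have Lp := loginv_gt0 alpha_gt0 beta_gt0 p0 ppi.
  by rewrite sqr_hbeta// -mulrA -powR_addr1// (_ : - (2 * beta - 1) = - (2 * beta) + 1)//; ring.
apply: (@energy_lt_pinfty _ _ _ alpha_gt0 alpha_lt1 beta_gt0
    (fun a b => (a ^+ 2 - b ^+ 2) * ln (a / b)) (2 * beta - 1) W) => //.
- by rewrite /W !addr_ge0 ?divr_ge0 ?mulr_ge0 ?(ltW alpha_gt0) ?(ltW beta_gt0).
(* Symmetry is required for all reals: when a / b is not positive, neither is b / a, and both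
   logarithms take the default value 0. *)
- move=> a b; have [ab|ab] := ltP 0 (a / b).
    by rewrite -[b / a]invf_div lnV ?posrE//; ring.
  by rewrite !ln0 ?mulr0// -[b / a]invf_div invr_le0.
- by move=> a; rewrite subrr mul0r.
- move=> p a b p0 ppi cb ba ah; rewrite hL//.
  have b0 : 0 < b by exact: lt_le_trans cb.
  have a0 : 0 < a by exact: lt_le_trans ba.
  have Lp := loginv_gt0 alpha_gt0 beta_gt0 p0 ppi.
  have hp0 := hbeta_gt0 alpha_gt0 beta_gt0 ppi.
  have H1 : ln (a / b) <= W * L p.
    apply: (@le_trans _ _ ((alpha / 2 + ln 2 / kap) * L p)); last first.
      by rewrite ler_wpM2r ?(ltW Lp)// /W lerDl divr_ge0// ltW.
    apply: le_trans (hgap_le alpha_gt0 beta_gt0 p0 ppi).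
    by rewrite /hgap -/c0 [ln (a / b)]ln_div ?posrE// lerB// ler_ln ?posrE.
  have H0 : 0 <= ln (a / b) by rewrite ln_ge0// ler_pdivlMr// mul1r.
  rewrite mulrCA; apply: ler_pM => //.
    by rewrite subr_ge0 lerXn2r ?nnegrE// ltW.
  apply: (@le_trans _ _ (a ^+ 2)); first by rewrite gerBl exprn_ge0// ltW.
  by rewrite lerXn2r ?nnegrE// ltW.
- move=> p a b p0 ppi b0 ba ah; rewrite hL// -ah.
  have a0 : 0 < a by exact: lt_le_trans ba.
  have Lp : kap <= L p by exact: loginv_ge.
  have H0 : 0 <= ln a - ln b by rewrite subr_ge0 ler_ln ?posrE.
  have H1 : a ^+ 2 - b ^+ 2 <= 2 * a ^+ 2 * (ln a - ln b).
    rewrite subr_sqr [leRHS](_ : _ = (a * (ln a - ln b)) * (2 * a)); last by ring.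
    by apply: ler_pM; rewrite ?sub_le_ln//; lra.
  have H2 : 2 <= W * L p.
    apply: (@le_trans _ _ (2 / kap * L p)).
      by rewrite mulrAC ler_pdivlMr// ler_pM2l.
    rewrite ler_wpM2r ?(le_trans (ltW kap_gt0))// /W lerDr.
    by apply: addr_ge0; apply: divr_ge0 => //; exact: ltW.
  rewrite ln_div ?posrE// [(ln a - ln b) ^+ 2]expr2 [leRHS]mulrA ler_wpM2r//.
  apply: (le_trans H1); rewrite ler_wpM2r// [leRHS]mulrCA [leRHS]mulrC ler_wpM2r//.
  by rewrite exprn_ge0// ltW.
- lra.
Qed.

End energies.

Local Open Scope complex_scope.

(** * Complex modulus, exponential and integrals of complex-valued functions *)

Section complex_modulus.
Context {R : realType}.
Implicit Types (z w : R[i]) (a b : R).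

Lemma normc_ge0 z : 0 <= normc z.
Proof. by case: z => a b; exact: sqrtr_ge0. Qed.

Lemma normc_gt0 z : z != 0 -> 0 < normc z.
Proof.
move=> z0; rewrite lt_neqAle normc_ge0 andbT eq_sym; apply: contra z0 => /eqP.
by move/eq0_normc => ->.
Qed.

Lemma sqr_normc_ReIm z : normc z ^+ 2 = complex.Re z ^+ 2 + complex.Im z ^+ 2.
Proof. by case: z => a b /=; rewrite sqr_sqrtr// addr_ge0 ?sqr_ge0. Qed.

Lemma normc_Re_le z : `|complex.Re z| <= normc z.
Proof.
rewrite -(@ler_pXn2r _ 2) ?nnegrE ?normc_ge0// sqr_normc_ReIm real_normK ?num_real//.
by rewrite lerDl sqr_ge0.
Qed.

Lemma normc_Im_le z : `|complex.Im z| <= normc z.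
Proof.
rewrite -(@ler_pXn2r _ 2) ?nnegrE ?normc_ge0// sqr_normc_ReIm real_normK ?num_real//.
by rewrite lerDr sqr_ge0.
Qed.

Lemma normc_le_ReIm z : normc z <= `|complex.Re z| + `|complex.Im z|.
Proof.
rewrite -(@ler_pXn2r _ 2) ?nnegrE ?normc_ge0 ?addr_ge0// sqr_normc_ReIm.
rewrite -(real_normK (num_real (complex.Re z))) -(real_normK (num_real (complex.Im z))).
have := mulr_ge0 (normr_ge0 (complex.Re z)) (normr_ge0 (complex.Im z)); nra.
Qed.

Lemma normc_triangle z w : normc (z + w) <= normc z + normc w.
Proof. exact: le_normcD. Qed.

Lemma normc_opp z : normc (- z) = normc z.
Proof. exact: normcN. Qed.

Lemma normc_sub_ge z w : normc z - normc w <= normc (z - w).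
Proof. by have := normc_triangle (z - w) w; rewrite subrK; lra. Qed.

Lemma normc_cis a : normc (cis a) = 1.
Proof. by rewrite /cis /= cos2Dsin2 sqrtr1. Qed.

Lemma normc_real a : normc a%:C = `|a|.
Proof. by rewrite /= expr0n addr0 sqrtr_sqr. Qed.

Lemma normc_expn z n : normc (z ^+ n) = normc z ^+ n.
Proof.
elim: n => [|n IH]; first by rewrite !expr0 normc1.
by rewrite !exprS normcM IH.
Qed.

Lemma cis_sub_neq0 a z : normc z < 1 -> cis a - z != 0.
Proof.
move=> z1; apply/negP => /eqP/subr0_eq E.
by move: z1; rewrite -E normc_cis ltxx.
Qed.

Lemma cis_sub_ge a z : 1 - normc z <= normc (cis a - z).
Proof. by have := normc_sub_ge (cis a) z; rewrite normc_cis. Qed.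

Lemma normc_cexp z : normc (cexp z) = expR (complex.Re z).
Proof. by rewrite /cexp normcM normc_real normc_cis mulr1 ger0_norm// expR_ge0. Qed.

Lemma cexpD z w : cexp (z + w) = cexp z * cexp w.
Proof.
case: z => a b; case: w => c d; rewrite /cexp /cis /= expRD cosD sinD.
by apply/eqP; rewrite eq_complex /=; apply/andP; split; apply/eqP; ring.
Qed.

End complex_modulus.

Section cexp_remainder.
Context {R : realType}.
Implicit Types (z w : R[i]) (x y : R).

Lemma expR_sub1_sub x : `|x| <= 2^-1 -> `|expR x - 1 - x| <= 2 * x ^+ 2.
Proof.
rewrite ler_norml => /andP[x1 x2].
have H1 := expR_ge1Dx x.
have H2 := expR_ge1Dx (- x).
rewrite expRN in H2.
have e0 := expR_gt0 x.
rewrite ger0_norm; last by lra.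
have x3 : 0 < 1 - x by lra.
have H3 : expR x <= (1 - x)^-1.
  by rewrite -[expR x]invrK lef_pV2 ?posrE ?invr_gt0.
apply: (@le_trans _ _ ((1 - x)^-1 - 1 - x)); first by rewrite !lerD2r.
have -> : (1 - x)^-1 - 1 - x = x ^+ 2 / (1 - x) by field; rewrite gt_eqF.
by rewrite ler_pdivrMr//; nra.
Qed.

Lemma cos_sub1 x : `|cos x - 1| <= x ^+ 2 / 2.
Proof.
have -> : cos x - 1 = - (2 * sin (x / 2) ^+ 2).
  rewrite -[X in cos X](_ : (x / 2) *+ 2 = x) ?cos_mulr2n; last by field.
  by have := cos2Dsin2 (x / 2); lra.
have H : sin (x / 2) ^+ 2 <= (x / 2) ^+ 2.
  rewrite -[leLHS]real_normK ?num_real// -[leRHS]real_normK ?num_real//.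
  by rewrite lerXn2r ?nnegrE// norm_sin_le.
rewrite normrN ger0_norm; last by rewrite mulr_ge0// sqr_ge0.
by rewrite expr_div_n in H; lra.
Qed.

Lemma sin_sub x : `|x| <= 1 -> `|sin x - x| <= x ^+ 2.
Proof.
wlog x0 : x / 0 <= x.
  move=> H; have [|x0] := leP 0 x; first exact: H.
  move=> x1; have := H (- x); rewrite normrN sinN -opprD normrN sqrrN.
  by apply => //; lra.
rewrite (ger0_norm x0) => x1.
have H := sin_le x0.
rewrite ler0_norm ?subr_le0// opprB.
have := half_le_sin (_ : 0 <= x / 2) (_ : x / 2 <= pi / 2).
have pi2 := pi_ge2 R.
have := @ge0_derive_le R (fun t => sin t - t + t ^+ 2) (fun t => cos t - 1 + 2 * t) 0 x x0 _ _.
rewrite sin0 subr0 expr0n addr0 /= => H1 _.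
have : 0 <= sin x - x + x ^+ 2.
  apply: H1.
    move=> t _; apply: is_derive_eq.
    by rewrite /GRing.scale/=; ring.
  move=> t /andP[t0 tx]; have := cos_sub1 t; rewrite ler_norml => /andP[c1 _]; nra.
lra.
Qed.

(** Differentiability of the exponential at 0 in quantitative form. Real and imaginary parts are
    estimated separately from second-order bounds for exp, cos and sin. *)
Lemma cexp_sub1_sub z : normc z <= 2^-1 -> normc (cexp z - 1 - z) <= 10 * normc z ^+ 2.
Proof.
move=> z1; have zR := normc_Re_le z; have zI := normc_Im_le z.
have E1 := expR_sub1_sub (le_trans zR z1).
have E2 := cos_sub1 (complex.Im z).
have E3 := sin_sub (_ : `|complex.Im z| <= 1).
have {}E3 : `|sin (complex.Im z) - complex.Im z| <= complex.Im z ^+ 2 by apply: E3; lra.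
rewrite sqr_normc_ReIm; apply: (le_trans (normc_le_ReIm _)).
move: zR zI E1 E2 E3; case: z z1 => a b /= z1 zR zI E1 E2 E3.
rewrite !mul0r !subr0 ?addr0.
set n := Num.sqrt _ in z1 zR zI.
have [ha hb] : `|a| <= 2^-1 /\ `|b| <= 2^-1 by split; exact: le_trans z1.
have ea : `|expR a - 1| <= 2 * `|a|.
  have -> : expR a - 1 = (expR a - 1 - a) + a by ring.
  apply: (le_trans (ler_normD _ _)); rewrite -(real_normK (num_real a)) in E1.
  by have := normr_ge0 a; nra.
have ea0 : 0 <= expR a <= 2.
  by rewrite expR_ge0/=; move: ea; rewrite ler_norml => /andP[_]; lra.
have HRe : `|expR a * cos b - 1 - a| <= 2 * a ^+ 2 + b ^+ 2.
  have -> : expR a * cos b - 1 - a = (expR a - 1 - a) + expR a * (cos b - 1) by ring.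
  apply: (le_trans (ler_normD _ _)); apply: lerD => //.
  rewrite normrM (ger0_norm (expR_ge0 a)).
  by have := normr_ge0 (cos b - 1); case/andP: ea0; nra.
have HIm : `|expR a * sin b - b| <= 2 * a ^+ 2 + 4 * b ^+ 2.
  have -> : expR a * sin b - b = expR a * (sin b - b) + (expR a - 1) * b by ring.
  apply: (le_trans (ler_normD _ _)).
  have -> : 2 * a ^+ 2 + 4 * b ^+ 2 = 2 * b ^+ 2 + (2 * a ^+ 2 + 2 * b ^+ 2) by ring.
  rewrite !normrM (ger0_norm (expR_ge0 a)); apply: lerD.
    by have := normr_ge0 (sin b - b); case/andP: ea0; nra.
  rewrite -(real_normK (num_real a)) -(real_normK (num_real b)).
  have := ler_wpM2r (normr_ge0 b) ea; have := sqr_ge0 (`|a| - `|b|).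
  by have := sqr_ge0 `|a|; have := sqr_ge0 `|b|; lra.
rewrite ?add0r ?addr0 ?mul0r ?subr0.
by have := sqr_ge0 a; have := sqr_ge0 b; lra.
Qed.

End cexp_remainder.

Section cmeasurable.
Context {R : realType}.
Implicit Types (f g : R -> R[i]) (z : R[i]).

Definition cmeasurable f :=
  measurable_fun [set: R] (fun t => complex.Re (f t)) /\
  measurable_fun [set: R] (fun t => complex.Im (f t)).

Lemma cmeasurable_cst z : cmeasurable (fun=> z).
Proof. by split; exact: measurable_cst. Qed.

Lemma cmeasurable_cis : cmeasurable (@cis R).
Proof.
by split; apply: continuous_measurable_fun; [exact: continuous_cos|exact: continuous_sin].
Qed.

Lemma cmeasurableD f g : cmeasurable f -> cmeasurable g ->
  cmeasurable (fun t => f t + g t).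
Proof.
move=> [f1 f2] [g1 g2]; split.
  rewrite (_ : (fun t => _) = (fun t => complex.Re (f t) + complex.Re (g t))).
    exact: measurable_funD.
  by apply/funext => t; case: (f t) => ? ?; case: (g t).
rewrite (_ : (fun t => _) = (fun t => complex.Im (f t) + complex.Im (g t))).
  exact: measurable_funD.
by apply/funext => t; case: (f t) => ? ?; case: (g t).
Qed.

Lemma cmeasurableN f : cmeasurable f -> cmeasurable (fun t => - f t).
Proof.
move=> [f1 f2]; split.
  rewrite (_ : (fun t => _) = (fun t => - complex.Re (f t))).
    exact: measurable_funN.
  by apply/funext => t; case: (f t).
rewrite (_ : (fun t => _) = (fun t => - complex.Im (f t))).
  exact: measurable_funN.
by apply/funext => t; case: (f t).
Qed.

Lemma cmeasurableM f g : cmeasurable f -> cmeasurable g ->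
  cmeasurable (fun t => f t * g t).
Proof.
move=> [f1 f2] [g1 g2]; split.
  rewrite (_ : (fun t => _) = (fun t => complex.Re (f t) * complex.Re (g t) -
      complex.Im (f t) * complex.Im (g t))).
    by apply: measurable_funB; exact: measurable_funM.
  by apply/funext => t; case: (f t) => ? ?; case: (g t).
rewrite (_ : (fun t => _) = (fun t => complex.Re (f t) * complex.Im (g t) +
    complex.Im (f t) * complex.Re (g t))).
  by apply: measurable_funD; exact: measurable_funM.
by apply/funext => t; case: (f t) => ? ?; case: (g t).
Qed.

Lemma cmeasurableV f : cmeasurable f -> cmeasurable (fun t => (f t)^-1).
Proof.
move=> [f1 f2].
have mN : measurable_fun [set: R] (fun t =>
    (complex.Re (f t) ^+ 2 + complex.Im (f t) ^+ 2) `^ (-1)).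
  by apply: measurable_fun_powRl; apply: measurable_funD; exact: measurable_funX.
have NE t : (complex.Re (f t) ^+ 2 + complex.Im (f t) ^+ 2) `^ (-1) =
    (complex.Re (f t) ^+ 2 + complex.Im (f t) ^+ 2)^-1.
  by rewrite powR_inv1// addr_ge0// sqr_ge0.
split.
  rewrite (_ : (fun t => _) = (fun t => complex.Re (f t) *
      (complex.Re (f t) ^+ 2 + complex.Im (f t) ^+ 2) `^ (-1))).
    exact: measurable_funM.
  by apply/funext => t; rewrite NE; case: (f t).
rewrite (_ : (fun t => _) = (fun t => - (complex.Im (f t) *
    (complex.Re (f t) ^+ 2 + complex.Im (f t) ^+ 2) `^ (-1)))).
  by apply: measurable_funN; exact: measurable_funM.
by apply/funext => t; rewrite NE; case: (f t) => a b.
Qed.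

End cmeasurable.

Section cintegral.
Context {R : realType}.
Local Notation mu := (@lebesgue_measure R).
Implicit Types (f g k : R -> R[i]) (l : R -> R) (D : set R) (z : R[i]) (C : R).

Definition cintegrable D f :=
  mu.-integrable D (EFin \o (fun t => complex.Re (f t))) /\
  mu.-integrable D (EFin \o (fun t => complex.Im (f t))).

Lemma cintegrable_kernel D k l C : measurable (D : set (measurableTypeR R)) -> cmeasurable k ->
  (forall t, D t -> normc (k t) <= C) -> mu.-integrable D (EFin \o l) ->
  cintegrable D (fun t => k t * (l t)%:C).
Proof.
move=> mD [k1 k2] kC il.
have ml : measurable_fun D l by apply/measurable_EFinP; exact: (measurable_int mu).
have iC : mu.-integrable D (EFin \o (fun t => C * l t)).
  by apply: (eq_integrable mD _ _ _ (integrableZl mD C il)).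
have ReE t : complex.Re (k t * (l t)%:C) = complex.Re (k t) * l t.
  by case: (k t) => a b /=; rewrite mulr0 subr0.
have ImE t : complex.Im (k t * (l t)%:C) = complex.Im (k t) * l t.
  by case: (k t) => a b /=; rewrite mulr0 add0r.
split; apply: (le_integrable mD _ _ iC).
- apply/measurable_EFinP; rewrite (_ : (fun t => _) = (fun t => complex.Re (k t) * l t)).
    by apply: measurable_funM => //; exact: measurable_funTS.
  by apply/funext => t; rewrite ReE.
- move=> t Dt; rewrite /= lee_fin ReE !normrM ler_wpM2r//.
  by rewrite (le_trans (normc_Re_le _))// (le_trans (kC _ Dt))// ler_norm.
- apply/measurable_EFinP; rewrite (_ : (fun t => _) = (fun t => complex.Im (k t) * l t)).
    by apply: measurable_funM => //; exact: measurable_funTS.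
  by apply/funext => t; rewrite ImE.
- move=> t Dt; rewrite /= lee_fin ImE !normrM ler_wpM2r//.
  by rewrite (le_trans (normc_Im_le _))// (le_trans (kC _ Dt))// ler_norm.
Qed.

Lemma cintegralB D f g : measurable (D : set (measurableTypeR R)) -> cintegrable D f -> cintegrable D g ->
  cintegral D (fun t => f t - g t) = cintegral D f - cintegral D g.
Proof.
move=> mD [f1 f2] [g1 g2]; rewrite /cintegral.
apply/eqP; rewrite eq_complex /=; apply/andP; split; apply/eqP.
  rewrite -RintegralB//; apply: eq_Rintegral => t _.
  by case: (f t) => ? ?; case: (g t).
rewrite -RintegralB//; apply: eq_Rintegral => t _.
by case: (f t) => ? ?; case: (g t).
Qed.

Lemma cintegralZ D f z : measurable (D : set (measurableTypeR R)) -> cintegrable D f ->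
  cintegral D (fun t => z * f t) = z * cintegral D f.
Proof.
move=> mD [f1 f2]; rewrite /cintegral; case: z => a b.
have iZ c h : mu.-integrable D (EFin \o h) -> mu.-integrable D (EFin \o (fun t => c * h t)).
  by move=> ih; apply: (eq_integrable mD _ _ _ (integrableZl mD c ih)).
apply/eqP; rewrite eq_complex /=; apply/andP; split; apply/eqP.
  rewrite -!RintegralZl// -RintegralB//; [|exact: iZ|exact: iZ].
  by apply: eq_Rintegral => t _; case: (f t).
rewrite -!RintegralZl// -RintegralD//; [|exact: iZ|exact: iZ].
by apply: eq_Rintegral => t _; case: (f t).
Qed.

Lemma cintegrableB D f g : measurable (D : set (measurableTypeR R)) -> cintegrable D f -> cintegrable D g ->
  cintegrable D (fun t => f t - g t).
Proof.
move=> mD [f1 f2] [g1 g2]; split.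
  apply: (eq_integrable mD _ _ _ (integrableB mD f1 g1)) => t _ /=.
  by case: (f t) => ? ?; case: (g t).
apply: (eq_integrable mD _ _ _ (integrableB mD f2 g2)) => t _ /=.
by case: (f t) => ? ?; case: (g t).
Qed.

Lemma cintegrableZ D f z : measurable (D : set (measurableTypeR R)) -> cintegrable D f ->
  cintegrable D (fun t => z * f t).
Proof.
move=> mD [f1 f2]; case: z => a b; split.
  apply: (eq_integrable mD _ _ _ (integrableB mD (integrableZl mD a f1) (integrableZl mD b f2))) => t _ /=.
  by case: (f t).
apply: (eq_integrable mD _ _ _ (integrableD mD (integrableZl mD a f2) (integrableZl mD b f1))) => t _ /=.
by case: (f t).
Qed.

(** The factor 2 comes from bounding the two components separately; it is harmless where only a
    quadratic remainder is wanted. *)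
Lemma normc_cintegral_le D f (g : R -> R) : measurable (D : set (measurableTypeR R)) -> cintegrable D f ->
  mu.-integrable D (EFin \o g) -> (forall t, D t -> normc (f t) <= g t) ->
  normc (cintegral D f) <= 2 * \int[mu]_(t in D) g t.
Proof.
move=> mD [f1 f2] ig fg; apply: (le_trans (normc_le_ReIm _)).
rewrite mulr_natl mulr2n; apply: lerD.
  apply: le_trans (le_normr_Rintegral mD f1) _.
  apply: le_Rintegral => //.
    exact: (integrable_norm f1).
  by move=> t Dt; rewrite (le_trans (normc_Re_le _))// fg.
apply: le_trans (le_normr_Rintegral mD f2) _.
apply: le_Rintegral => //.
  exact: (integrable_norm f2).
by move=> t Dt; rewrite (le_trans (normc_Im_le _))// fg.
Qed.

End cintegral.

(** * Analyticity and complex derivative of outer functions *)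

Section complex_derivative.
Context {R : realType}.
Implicit Types (z w a : R[i]) (f : R[i] -> R[i]) (C d : R).

Lemma quadratic_is_derive f z a C d : 0 < d ->
  (forall w, normc w < d -> normc (f (z + w) - f z - w * a) <= C * normc w ^+ 2) ->
  is_derive (z : R[i]^o) (1 : R[i]^o) (f : R[i]^o -> R[i]^o) a.
Proof.
move=> d0 H.
have cv : h^-1 *: (((f : R[i]^o -> R[i]^o) \o shift (z : R[i]^o)) (h *: (1 : R[i]^o))
    - (f z : R[i]^o)) @[h --> (0 : R[i]^o)^'] --> (a : R[i]^o).
  apply/cvgrPdist_le => e e0.
  have eR : e = (complex.Re e)%:C.
    by move: e0; rewrite ltcE /= => /andP[/eqP e2 _]; case: e e2 => x y /= ->.
  have r0 : 0 < complex.Re e by rewrite -ltcR -eR.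
  pose r := Num.min d (complex.Re e / (`|C| + 1)).
  have C1 : 0 < `|C| + 1 by rewrite ltr_wpDl.
  have r_gt0 : 0 < r by rewrite lt_min d0 divr_gt0.
  have rC0 : (0 : R[i]) < r%:C by rewrite ltcR.
  near=> w.
  have w0 : w != 0 by near: w; exact: (@nbhs_dnbhs_neq R[i]^o 0).
  have wr : normc w < r.
    by rewrite -ltcR; near: w; exact: (@dnbhs0_lt _ R[i]^o _ rC0).
  have wd : normc w < d by apply: (lt_le_trans wr); rewrite ge_min lexx.
  have wn0 : 0 < normc w by exact: normc_gt0.
  rewrite [leRHS]eR /= [leLHS](_ : _ =
      (normc (a - w^-1 * (f (w * 1 + z) - f z)))%:C)//.
  rewrite lecR.
  have -> : a - w^-1 * (f (w * 1 + z) - f z) = - (w^-1 * (f (z + w) - f z - w * a)).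
    by rewrite mulr1 [w + z]addrC; field.
  rewrite normc_opp normcM normcV ler_pdivrMl//.
  apply: le_trans (H w wd) _.
  rewrite expr2 mulrA [normc w * _]mulrC ler_wpM2r ?normc_ge0//.
  apply: (@le_trans _ _ ((`|C| + 1) * normc w)).
    by rewrite ler_wpM2r ?normc_ge0//; have := ler_norm C; lra.
  rewrite mulrC -ler_pdivlMr//; apply/ltW/(lt_le_trans wr).
  by rewrite ge_min lexx orbT.
split; first by apply/cvg_ex; exists a.
exact: cvg_lim cv.
Unshelve. all: by end_near. Qed.

End complex_derivative.

Section outer_derivative.
Context {R : realType} (h : R -> R).
Local Notation mu := (@lebesgue_measure R).
Local Notation l := (fun t => ln (h t)).
Implicit Types (z w : R[i]) (t : R).

Context (il : mu.-integrable (@angles R) (EFin \o l)).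

Let mD : measurable (@angles R : set (measurableTypeR R)).
Proof. exact: measurable_itv. Qed.

Definition herglotz z : R[i] :=
  cintegral (@angles R) (fun t => (cis t + z) / (cis t - z) * (l t)%:C).

(** Half of the derivative of [herglotz]: the derivative of (c + z)/(c - z) in z is 2c/(c - z)^2.
    With the prefactor 1/(2 pi) this makes O'/O equal to [herglotz_deriv] divided by pi. *)
Definition herglotz_deriv z : R[i] :=
  cintegral (@angles R) (fun t => cis t / (cis t - z) ^+ 2 * (l t)%:C).

Let cm_den z : cmeasurable (fun t => (cis t - z)^-1).
Proof.
apply: cmeasurableV; apply: cmeasurableD; first exact: cmeasurable_cis.
exact: cmeasurable_cst.
Qed.

Let cm_num z : cmeasurable (fun t => cis t + z).
Proof. by apply: cmeasurableD; [exact: cmeasurable_cis|exact: cmeasurable_cst]. Qed.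

Lemma normc_inv_cis_sub_le z t : normc z < 1 ->
  normc (cis t - z)^-1 <= (1 - normc z)^-1.
Proof.
move=> z1; rewrite normcV lef_pV2 ?posrE ?subr_gt0//; first exact: cis_sub_ge.
exact/normc_gt0/cis_sub_neq0.
Qed.

Lemma cintegrable_herglotz z : normc z < 1 -> cintegrable (@angles R)
  (fun t => (cis t + z) / (cis t - z) * (l t)%:C).
Proof.
move=> z1; apply: (@cintegrable_kernel _ _ _ _ (2 / (1 - normc z))) => //.
  exact: cmeasurableM.
move=> t _; rewrite normcM; apply: ler_pM; rewrite ?normc_ge0//; last exact: normc_inv_cis_sub_le.
by apply: (le_trans (normc_triangle _ _)); rewrite normc_cis; lra.
Qed.

Lemma cintegrable_herglotz_deriv z : normc z < 1 -> cintegrable (@angles R)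
  (fun t => cis t / (cis t - z) ^+ 2 * (l t)%:C).
Proof.
move=> z1; apply: (@cintegrable_kernel _ _ _ _ ((1 - normc z)^-1 ^+ 2)) => //.
  apply: cmeasurableM; first exact: cmeasurable_cis.
  rewrite (_ : (fun t => _) = (fun t => (cis t - z)^-1 * (cis t - z)^-1)).
    exact: cmeasurableM.
  by apply/funext => t; rewrite expr2 invfM.
move=> t _; rewrite normcM normc_cis mul1r -exprVn normc_expn.
by rewrite lerXn2r ?nnegrE ?normc_ge0 ?invr_ge0 ?subr_ge0 ?(ltW z1)// normc_inv_cis_sub_le.
Qed.

(** Differentiation under the integral is replaced by an identity: with c on the circle, the
    increment of (c + z)/(c - z) minus its linear part is 2 c w^2 / ((c - z - w)(c - z)^2). For |w|
    at most half the distance from z to the circle this is at most 4 |w|^2 over the cube of that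
    distance. *)
Lemma herglotz_remainder z w : normc z < 1 -> normc w <= (1 - normc z) / 2 ->
  normc (herglotz (z + w) - herglotz z - w * (2%:R * herglotz_deriv z)) <=
  8 / (1 - normc z) ^+ 3 * (\int[mu]_(t in @angles R) `|l t|) * normc w ^+ 2.
Proof.
move=> z1 wz; set d := 1 - normc z; have d0 : 0 < d by rewrite subr_gt0.
have zw1 : normc (z + w) <= 1 - d / 2.
  by apply: (le_trans (normc_triangle _ _)); rewrite /d in wz *; lra.
have zw2 : normc (z + w) < 1 by lra.
have i1 := cintegrable_herglotz zw2.
have i2 := cintegrable_herglotz z1.
have i3 := cintegrable_herglotz_deriv z1.
rewrite /herglotz /herglotz_deriv -cintegralB// mulrA -cintegralZ// -cintegralB//; last 2 first.
- exact: cintegrableB.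
- exact: cintegrableZ.
have -> : 8 / d ^+ 3 * (\int[mu]_(t in @angles R) `|l t|) * normc w ^+ 2 =
    2 * ((4 / d ^+ 3 * normc w ^+ 2) * \int[mu]_(t in @angles R) `|l t|) by ring.
rewrite -RintegralZl//; last exact: (integrable_norm il).
apply: normc_cintegral_le => //.
- by apply: cintegrableB => //; [exact: cintegrableB|exact: cintegrableZ].
- apply: (eq_integrable mD _ _ _ (integrableZl mD (4 / d ^+ 3 * normc w ^+ 2) (integrable_norm il))).
  by move=> t _.
- move=> t _.
  have c1 := @cis_sub_neq0 R t _ zw2.
  have c2 := @cis_sub_neq0 R t _ z1.
  have -> : (cis t + (z + w)) / (cis t - (z + w)) * (l t)%:C -
      (cis t + z) / (cis t - z) * (l t)%:C -
      w * 2%:R * (cis t / (cis t - z) ^+ 2 * (l t)%:C) =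
      2%:R * cis t * w ^+ 2 * ((cis t - (z + w))^-1 * ((cis t - z)^-1 * (cis t - z)^-1)) * (l t)%:C.
    by field; rewrite c1 c2.
  rewrite normcM normc_real ler_wpM2r// 3!normcM normc_cis normc_expn.
  have -> : normc (2%:R : R[i]) = 2.
    by rewrite -(rmorph_nat (real_complex R)) normc_real ger0_norm.
  have -> : 4 / d ^+ 3 * normc w ^+ 2 = 2 * 1 * normc w ^+ 2 * ((d / 2)^-1 * (d^-1 * d^-1)).
    by field; rewrite gt_eqF.
  rewrite ler_wpM2l ?mulr_ge0 ?exprn_ge0 ?normc_ge0//.
  rewrite !normcM; apply: ler_pM; rewrite ?mulr_ge0 ?normc_ge0//.
    apply: (le_trans (normc_inv_cis_sub_le t zw2)).
    by rewrite lef_pV2 ?posrE ?subr_gt0//; lra.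
  by apply: ler_pM; rewrite ?normc_ge0// normc_inv_cis_sub_le.
Qed.

(** O(z + w) = O(z) exp(v), where v is the increment of the exponent; the quadratic remainders of
    exp and of the Herglotz integral add up. *)
Lemma outer_is_derive z : normc z < 1 ->
  is_derive (z : R[i]^o) (1 : R[i]^o) (outer h : R[i]^o -> R[i]^o)
    (outer h z * ((pi^-1)%:C * herglotz_deriv z)).
Proof.
move=> z1.
pose c := (2 * pi)^-1 : R.
pose G := 2%:R * herglotz_deriv z.
pose K := 8 / (1 - normc z) ^+ 3 * (\int[mu]_(t in @angles R) `|l t|).
have pi0 := pi_gt0 R.
have c0 : 0 < c by rewrite invr_gt0 mulr_gt0.
have c1 : c <= 1.
  by rewrite invf_le1 ?mulr_gt0//; have := pi_ge2 R; lra.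
have K0 : 0 <= K.
  rewrite mulr_ge0 ?Rintegral_ge0// divr_ge0// exprn_ge0// subr_ge0 ltW//.
have G0 := normc_ge0 G.
pose B := normc G + K.
have B0 : 0 <= B by rewrite addr_ge0.
(* The three bounds serve, in order, the Herglotz remainder, the step |w|^2 <= |w|, and |v| <= 1/2
   as needed for the remainder of exp. *)
pose d := Num.min ((1 - normc z) / 2) (Num.min 1 (2^-1 / (B + 1))).
have d0 : 0 < d.
  rewrite !lt_min ltr01 !divr_gt0 ?subr_gt0//; lra.
apply: (@quadratic_is_derive _ _ _ _ (normc (outer h z) * (10 * B ^+ 2 + K)) d d0) => w wd.
have [wd1 [wd2 wd3]] : normc w <= (1 - normc z) / 2 /\ normc w <= 1 /\ normc w <= 2^-1 / (B + 1).
  move: (ltW wd); rewrite !le_min => /andP[-> /andP[-> ->]] //.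
have w0 := normc_ge0 w.
have HR := herglotz_remainder z1 wd1; rewrite -/K -/G in HR.
pose v := c%:C * (herglotz (z + w) - herglotz z).
have ncC : normc c%:C = c by rewrite normc_real ger0_norm// ltW.
have vE : normc (v - w * (c%:C * G)) <= K * normc w ^+ 2.
  have -> : v - w * (c%:C * G) = c%:C * (herglotz (z + w) - herglotz z - w * G).
    by rewrite /v; ring.
  rewrite normcM ncC; apply: le_trans HR; exact: ler_piMl (normc_ge0 _) c1.
have vB : normc v <= B * normc w.
  have -> : v = (v - w * (c%:C * G)) + w * (c%:C * G) by rewrite subrK.
  apply: (le_trans (normc_triangle _ _)); rewrite 2!normcM ncC /B mulrDl.
  have H1 : normc w * (c * normc G) <= normc G * normc w.
    by rewrite mulrC ler_wpM2r// ler_piMl.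
  have H2 : K * normc w ^+ 2 <= K * normc w.
    by rewrite ler_wpM2l// expr2 ler_piMr.
  lra.
have v2 : normc v <= 2^-1.
  apply: (le_trans vB); move: wd3; rewrite ler_pdivlMr; last by lra.
  by move: w0; nra.
have -> : outer h (z + w) = outer h z * cexp v.
  by rewrite /outer -/(herglotz _) -/(herglotz z) -cexpD /v /c; congr cexp; ring.
have -> : outer h z * cexp v - outer h z - w * (outer h z * ((pi^-1)%:C * herglotz_deriv z)) =
    outer h z * ((cexp v - 1 - v) + (v - w * (c%:C * G))).
  have -> : (pi^-1)%:C * herglotz_deriv z = c%:C * G.
    rewrite /G /c mulrA; congr (_ * _).
    rewrite -(rmorph_nat (real_complex R)) -rmorphM.
    by congr (_%:C); rewrite [RHS]mulrC invfM mulrA divff ?mul1r// pnatr_eq0.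
  by rewrite [w * _]mulrCA mulrDr !mulrBr mulr1 addrA subrK.
rewrite normcM -mulrA ler_wpM2l ?normc_ge0// mulrDl.
apply: (le_trans (normc_triangle _ _)); apply: lerD => //.
apply: le_trans (cexp_sub1_sub v2) _; rewrite -mulrA ler_wpM2l// -exprMn.
by rewrite lerXn2r ?nnegrE ?mulr_ge0 ?normc_ge0.
Qed.

Lemma outer_complex_deriv z : normc z < 1 ->
  complex_deriv (outer h) z = outer h z * ((pi^-1)%:C * herglotz_deriv z).
Proof. by move=> z1; rewrite /complex_deriv derive1E; have [_ ->] := outer_is_derive z1. Qed.

Lemma outer_analytic : analytic_on_disk (outer h).
Proof. by move=> z z1; have [] := outer_is_derive z1. Qed.

Lemma normc_outer z : normc (outer h z) =
  expR ((2 * pi)^-1 * \int[mu]_(t in @angles R) complex.Re ((cis t + z) / (cis t - z) * (l t)%:C)).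
Proof. by rewrite /outer normc_cexp /= mul0r subr0. Qed.

End outer_derivative.

(** * Integrals over half-open intervals, and integrability of log h *)

Section interval_integrals.
Context {R : realType}.
Local Notation mu := (@lebesgue_measure R).
Implicit Types (f F : R -> R) (a b c : R).

Lemma continuous_integrable_oc f a b :
  (forall t, {for t, continuous f}) -> mu.-integrable `]a, b] (EFin \o f).
Proof.
move=> cf.
have : mu.-integrable `[a, b] (EFin \o f).
  apply: continuous_compact_integrable; first exact: segment_compact.
  by apply: continuous_subspaceT => t; exact: cf.
by apply: integrableS => // t /=; rewrite !in_itv/= => /andP[/ltW -> ->].
Qed.

Lemma FTC2_oc f F a b : a < b -> (forall t : R, is_derive t 1 F (f t)) ->
  (forall t, {for t, continuous f}) ->
  \int[mu]_(t in `]a, b]) f t = F b - F a.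
Proof.
move=> ab dF cf; rewrite /Rintegral integral_itv_obnd_cbnd; last first.
  apply/measurable_EFinP; apply: measurable_funTS.
  by apply: continuous_measurable_fun => t; exact: cf.
by rewrite (FTC2_closed ab (fun t _ => dF t) (fun t _ => cf t)).
Qed.

Lemma Rintegral_oc_split f a b c : a <= b -> b <= c ->
  mu.-integrable `]a, c] (EFin \o f) ->
  \int[mu]_(t in `]a, c]) f t = \int[mu]_(t in `]a, b]) f t + \int[mu]_(t in `]b, c]) f t.
Proof.
move=> ab bc ifc; rewrite -(@Rintegral_itvB _ _ (BRight a) (BRight c) b)//.
by rewrite addrC subrK.
Qed.

Lemma integrable_oc_sub f a b c d : a <= b -> d <= c ->
  mu.-integrable `]a, c] (EFin \o f) -> mu.-integrable `]b, d] (EFin \o f).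
Proof.
move=> ab dc; apply: integrableS => //= t /=; rewrite !in_itv/= => /andP[bt td].
by rewrite (le_lt_trans ab)//= (le_trans td).
Qed.

Lemma integrable_oc_glue f a b c : a <= b -> b <= c ->
  mu.-integrable `]a, b] (EFin \o f) -> mu.-integrable `]b, c] (EFin \o f) ->
  mu.-integrable `]a, c] (EFin \o f).
Proof.
move=> ab bc /integrableP[m1 i1] /integrableP[m2 i2].
have E : (`]a, c] = `]a, b] `|` `]b, c])%classic.
  apply/seteqP; split => t /=; rewrite !in_itv/=.
    by move=> /andP[at_ tc]; have [tb|bt] := leP t b; [left|right]; rewrite ?at_ ?tc.
  move=> [|] /andP[t1 t2]; first by rewrite t1 (le_trans t2).
  by rewrite (le_lt_trans ab)//=.
apply/integrableP; rewrite E; split; first by apply/measurable_funU.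
apply: le_lt_trans (@ge0_integral_setU_le _ (measurableTypeR R) R mu _ _ _ _ _ _) _ => //.
by rewrite lte_add_pinfty.
Qed.

Lemma integral_ln_div_le r : 0 < r ->
  (\int[mu]_(t in `]0%R, r[) (ln r - ln t)%:E <= r%:E)%E.
Proof.
move=> r0.
have dl (t : R) : 0 < t -> is_derive t 1 (fun t => ln r - ln t) (- t^-1).
  move=> t0; rewrite -[X in is_derive _ _ _ X]add0r.
  apply: (is_derive1D (f := cst (ln r)) (g := fun t => - ln t)).
  by apply: is_derive1N; exact: is_derive1_ln.
apply: (@ge0_integral_oo_le _ _ (fun t => t * (ln r - ln t) + t)) => //.
- by move=> t /andP[t0 tr]; rewrite subr_ge0 ler_ln ?posrE// ltW.
- by move=> t /andP[t0 tr]; apply: is_derive_continuous; exact: dl.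
- move=> t /andP[t0 tr]; apply: is_derive_eq.
    apply: (is_derive1D (g := id)).
    by apply: (is_derive1M (f := id)); exact: dl.
  by rewrite /=; field; rewrite gt_eqF.
- move=> u v u0 uv vr; have v0 := lt_trans u0 uv; have ur := lt_trans uv vr.
  have H1 : 0 <= u * (ln r - ln u) by rewrite mulr_ge0 ?(ltW u0)// subr_ge0 ler_ln ?posrE// ltW.
  have H2 : v * (ln r - ln v) <= r - v.
    have : ln (1 + (r - v) / v) <= (r - v) / v.
      by apply: le_ln1Dx; rewrite ltr_pdivlMr//; lra.
    rewrite (_ : 1 + (r - v) / v = r / v); last by field; rewrite gt_eqF.
    by rewrite ln_div ?posrE// ler_pdivlMr// mulrC.
  lra.
Qed.

End interval_integrals.

Lemma measurable_invr (R : realType) : measurable_fun [set: R] (fun t : R => t^-1).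
Proof.
rewrite (_ : (fun t : R => t^-1) = (fun t => t * (t ^+ 2) `^ (-1))).
  apply: measurable_funM => //; apply: measurable_fun_powRl.
  exact: measurable_funX.
apply/funext => t; rewrite powR_inv1 ?sqr_ge0//.
have [->|t0] := eqVneq t 0; first by rewrite invr0 mul0r.
by field.
Qed.

Section log_integrable.
Context {R : realType}.
Local Notation mu := (@lebesgue_measure R).
Implicit Types (r t : R).

Let measurable_ln_sub r : measurable_fun [set: R] (fun t => ln r - ln t).
Proof. by apply: measurable_funB => //; exact: measurable_ln. Qed.

Let integral_ln_sub_oc r : 0 < r ->
  (\int[mu]_(t in `]0%R, r]) (ln r - ln t)%:E <= r%:E)%E.
Proof.
move=> r0; rewrite -integral_itv_bndo_bndc; first exact: integral_ln_div_le.
by apply/measurable_EFinP; apply: measurable_funTS; exact: measurable_ln_sub.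
Qed.

Lemma integrable_ln_sub r : 0 < r ->
  mu.-integrable `]0, r] (EFin \o (fun t => ln r - ln t)).
Proof.
move=> r0; apply/integrableP; split.
  by apply/measurable_EFinP; apply: measurable_funTS; exact: measurable_ln_sub.
apply: le_lt_trans (ltry r); apply: le_trans (integral_ln_sub_oc r0).
apply: ge0_le_integral_nonmeas => t; first by rewrite abse_ge0.
rewrite /= in_itv/= => /andP[t0 tr]; rewrite lee_fin ger0_norm//.
by rewrite subr_ge0 ler_ln ?posrE.
Qed.

Lemma Rintegral_ln_sub_le r : 0 < r -> \int[mu]_(t in `]0, r]) (ln r - ln t) <= r.
Proof.
move=> r0; rewrite -lee_fin /Rintegral fineK ?integral_ln_sub_oc//.
by apply: integrable_fin_num => //; exact: integrable_ln_sub.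
Qed.

Context (alpha beta : R)
  (alpha_gt0 : 0 < alpha) (alpha_lt1 : alpha < 1) (beta_gt0 : 0 < beta).
Local Notation h := (hbeta alpha beta).
Local Notation kap := (2 * beta / alpha).

Lemma measurable_ln_hbeta : measurable_fun [set: R] (fun t => ln (h t)).
Proof.
apply: measurable_fun_ln; rewrite /hbeta /hbeta_pos /gamma_const.
apply: measurable_fun_ifT => //; first exact: measurable_fun_ltr.
have -> : (fun t : R => (t `^ (alpha / 2) * ln (pi * expR kap / t) `^ beta)^-1) =
    (fun t => (t `^ (alpha / 2) * ln (pi * expR kap / t) `^ beta) `^ (-1)).
  by apply/funext => t; rewrite powR_inv1// mulr_ge0 ?powR_ge0.
apply: measurable_fun_powRl; apply: measurable_funM.
  exact: measurable_fun_powRl.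
apply: measurable_fun_powRl; apply: measurable_fun_ln; apply: measurable_funM => //.
exact: measurable_invr.
Qed.

Lemma integrable_ln_hbeta : mu.-integrable (@angles R) (EFin \o (fun t => ln (h t))).
Proof.
have pi0 := pi_gt0 R.
have ml D : measurable_fun D (fun t => ln (h t)).
  by apply: measurable_funTS; exact: measurable_ln_hbeta.
apply: (@integrable_oc_glue _ _ _ 0); [lra|lra| |].
  apply: (eq_integrable _ (EFin \o cst (ln (h pi / 2)))) => //.
    by move=> t; rewrite inE/= in_itv/= => /andP[_ t0]; rewrite /= (hbeta_le0 _ _ t0).
  by apply: continuous_integrable_oc => t; exact: cst_continuous.
have i1 := integrable_ln_sub pi0.
have i2 : mu.-integrable `]0, pi] (EFin \o cst `|ln (h pi)|).
  by apply: continuous_integrable_oc => t; exact: cst_continuous.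
have mI : measurable (`]0, pi] : set (measurableTypeR R)) by exact: measurable_itv.
apply: (le_integrable mI _ _ (integrableD mI i2 (integrableZl mI (alpha / 2) i1))).
  by apply/measurable_EFinP; exact: ml.
move=> t; rewrite /= in_itv/= => /andP[t0 tpi].
have H1 := ln_hbeta_le alpha_gt0 beta_gt0 t0 tpi (lexx _).
have H2 := ln_hbeta_sub_le alpha_gt0 beta_gt0 t0 tpi (lexx _).
have lt : 0 <= ln pi - ln t by rewrite subr_ge0 ler_ln ?posrE.
have H3 : 0 <= alpha / 2 * (ln pi - ln t) by rewrite mulr_ge0// divr_ge0// ltW.
rewrite lee_fin [leRHS]ger0_norm ?addr_ge0//.
have := ler_norm (ln (h pi)); have := ler_norm (- ln (h pi)); rewrite normrN => n1 n2.
by rewrite ler_norml; apply/andP; split; lra.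
Qed.

End log_integrable.

(** * The Poisson kernel and the derivative kernel at z = x + iy *)

Section kernels.
Context {R : realType} (x y : R) (xy1 : x ^+ 2 + y ^+ 2 < 1).
Local Notation mu := (@lebesgue_measure R).
Implicit Types (t : R).

Definition den t := (cos t - x) ^+ 2 + (sin t - y) ^+ 2.

(** [kerRe] and [kerIm] are the real and imaginary parts of e^(it)/(e^(it) - z)^2, and [den] is
    |e^(it) - z|^2. *)
Definition kerRe t := (cos t * ((cos t - x) ^+ 2 - (sin t - y) ^+ 2) +
  2 * sin t * (cos t - x) * (sin t - y)) / den t ^+ 2.

Definition kerIm t := (sin t * ((cos t - x) ^+ 2 - (sin t - y) ^+ 2) -
  2 * cos t * (cos t - x) * (sin t - y)) / den t ^+ 2.

(** [primRe] and [primIm] are the real and imaginary parts of i/(e^(it) - z), the primitive in t of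
    the derivative kernel. *)
Definition primRe t := (sin t - y) / den t.

Definition primIm t := (cos t - x) / den t.

Definition poisson_ker t := (1 - (x ^+ 2 + y ^+ 2)) / den t.

Lemma den_ge t : (1 - Num.sqrt (x ^+ 2 + y ^+ 2)) ^+ 2 <= den t.
Proof.
have H := @cis_sub_ge R t (x +i* y)%C.
have r1 : Num.sqrt (x ^+ 2 + y ^+ 2) < 1.
  by rewrite -sqrtr1 ltr_sqrt.
have -> : den t = normc (cis t - (x +i* y)) ^+ 2.
  by rewrite sqr_normc_ReIm.
by rewrite lerXn2r ?nnegrE ?normc_ge0// subr_ge0 ltW.
Qed.

Lemma den_gt0 t : 0 < den t.
Proof.
apply: lt_le_trans (den_ge t); rewrite exprn_gt0// subr_gt0.
by rewrite -sqrtr1 ltr_sqrt.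
Qed.

Lemma is_derive_den t :
  is_derive t 1 den (2 * (x * sin t - y * cos t)).
Proof.
rewrite /den; apply: is_derive_eq.
by rewrite /GRing.scale/=; ring.
Qed.

Let den_neq0 t : den t != 0. Proof. by rewrite gt_eqF// den_gt0. Qed.

Let is_derive_sinB (t : R) : is_derive t 1 (fun u => sin u - y) (cos t).
Proof. by apply: is_derive_eq; rewrite subr0. Qed.

Let is_derive_cosB (t : R) : is_derive t 1 (fun u => cos u - x) (- sin t).
Proof. by apply: is_derive_eq; rewrite subr0. Qed.

Lemma is_derive_primRe t : is_derive t 1 primRe (kerRe t).
Proof.
apply: (is_derive_eq (is_derive1M (is_derive_sinB t) (is_derive1V (den_neq0 t) (is_derive_den t)))).
have D0 := den_neq0 t.
rewrite /kerRe; have E : den t = (cos t - x) ^+ 2 + (sin t - y) ^+ 2 by [].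
apply/eqP; rewrite -subr_eq0; apply/eqP.
transitivity ((den t - ((cos t - x) ^+ 2 + (sin t - y) ^+ 2)) * cos t / den t ^+ 2).
  by field.
by rewrite E subrr !mul0r.
Qed.

Lemma is_derive_primIm t : is_derive t 1 primIm (kerIm t).
Proof.
apply: (is_derive_eq (is_derive1M (is_derive_cosB t) (is_derive1V (den_neq0 t) (is_derive_den t)))).
have D0 := den_neq0 t.
rewrite /kerIm; have E : den t = (cos t - x) ^+ 2 + (sin t - y) ^+ 2 by [].
apply/eqP; rewrite -subr_eq0; apply/eqP.
transitivity (- (den t - ((cos t - x) ^+ 2 + (sin t - y) ^+ 2)) * sin t / den t ^+ 2).
  by field.
by rewrite E subrr oppr0 !mul0r.
Qed.

Let continuous_quot (num dn : R -> R) (t ln ld : R) :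
  is_derive t 1 num ln -> is_derive t 1 dn ld -> dn t != 0 ->
  {for t, continuous (fun u => num u / dn u)}.
Proof.
move=> dN dD n0.
exact: (is_derive_continuous (is_derive1M dN (is_derive1V n0 dD))).
Qed.

Let is_derive_den2 (t : R) :
  is_derive t 1 (fun u => den u ^+ 2) (2 * (x * sin t - y * cos t) * den t + den t * (2 * (x * sin t - y * cos t))).
Proof. exact: (is_derive1M (is_derive_den t) (is_derive_den t)). Qed.

Lemma continuous_kerRe t : {for t, continuous kerRe}.
Proof.
by apply: continuous_quot (is_derive_den2 t) _; rewrite expf_neq0.
Qed.

Lemma continuous_kerIm t : {for t, continuous kerIm}.
Proof.
by apply: continuous_quot (is_derive_den2 t) _; rewrite expf_neq0.
Qed.

Lemma continuous_poisson t : {for t, continuous poisson_ker}.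
Proof. exact: continuous_quot (is_derive_cst _ t 1) (is_derive_den t) (den_neq0 t). Qed.

Lemma continuous_primRe t : {for t, continuous primRe}.
Proof. exact: continuous_quot (is_derive_sinB t) (is_derive_den t) (den_neq0 t). Qed.

Lemma continuous_primIm t : {for t, continuous primIm}.
Proof. exact: continuous_quot (is_derive_cosB t) (is_derive_den t) (den_neq0 t). Qed.

Lemma poisson_ge0 t : 0 <= poisson_ker t.
Proof. by rewrite divr_ge0 ?(ltW (den_gt0 t))// subr_ge0 ltW. Qed.

(** The kernel has the primitive t + 2 arg(1 - z e^(-it)). Since |z| < 1, the real part a of 1 - z
    e^(-it) is positive, so the argument is atan(b/a) on the whole circle; being periodic it
    contributes nothing. *)
Lemma Rintegral_poisson : \int[mu]_(t in @angles R) poisson_ker t = 2 * pi.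
Proof.
pose a t := 1 - (x * cos t + y * sin t).
pose b t := x * sin t - y * cos t.
have a0 t : 0 < a t.
  have E : (x * cos t + y * sin t) ^+ 2 + (x * sin t - y * cos t) ^+ 2 = x ^+ 2 + y ^+ 2.
    transitivity ((cos t ^+ 2 + sin t ^+ 2) * (x ^+ 2 + y ^+ 2)); first by ring.
    by rewrite cos2Dsin2 mul1r.
  have := sqr_ge0 (x * sin t - y * cos t); have := xy1.
  rewrite /a; move: E; move: (x * cos t + y * sin t) => u E H1 H2.
  have : u ^+ 2 < 1 by lra.
  by move=> H; have := sqr_ge0 (u - 1); nra.
have da (t : R) : is_derive t 1 a (b t).
  by rewrite /a; apply: is_derive_eq; rewrite /GRing.scale/= /b; ring.
have db (t : R) : is_derive t 1 b (x * cos t + y * sin t).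
  by rewrite /b; apply: is_derive_eq; rewrite /GRing.scale/=; ring.
have an0 t : a t != 0 by rewrite gt_eqF.
have dT (t : R) : is_derive t 1 (fun u => u + 2 * atan (b u / a u)) (poisson_ker t).
  have d1 := is_derive1M (db t) (is_derive1V (an0 t) (da t)).
  have d2 := is_derive1Z 2 (is_derive1_comp' (g := fun u => b u / a u)
    (is_derive1_atan (b t / a t)) d1).
  apply: (is_derive_eq (is_derive1D (is_derive_id t 1) d2)).
  have ab : a t ^+ 2 + b t ^+ 2 = den t.
    have := cos2Dsin2 t; rewrite /a /b /den; move: (cos t) (sin t) => c s E.
    have E1 : s ^+ 2 = 1 - c ^+ 2 by lra.
    apply/eqP; rewrite -subr_eq0; apply/eqP.
    transitivity ((1 - (c ^+ 2 + s ^+ 2)) * (1 - x ^+ 2 - y ^+ 2)); first by ring.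
    by rewrite E subrr mul0r.
  have Dn0 := den_neq0 t.
  have ab0 : a t ^+ 2 + b t ^+ 2 != 0 by rewrite ab.
  have xyE : x * cos t + y * sin t = 1 - a t by rewrite /a; ring.
  have nE : 1 - (x ^+ 2 + y ^+ 2) = 2 * a t - (a t ^+ 2 + b t ^+ 2).
    rewrite ab /a /den; have := cos2Dsin2 t; move: (cos t) (sin t) => c s E.
    by lra.
  rewrite /poisson_ker xyE nE -ab /=.
  have ba0 : 1 + (b t / a t) ^+ 2 != 0.
    by rewrite gt_eqF// ltr_pwDl// sqr_ge0.
  move: (an0 t) ab0 ba0; move: (a t) (b t) => A B A0 AB0 BA0.
  field.
  by rewrite A0 AB0.
rewrite /angles (FTC2_oc _ dT continuous_poisson); last by have := pi_gt0 R; lra.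
rewrite /a /b sinN cosN sinpi oppr0 cospi; ring.
Qed.

Lemma integrable_poisson : mu.-integrable (@angles R) (EFin \o poisson_ker).
Proof. by apply: continuous_integrable_oc; exact: continuous_poisson. Qed.

Lemma ker_bounds t : `|kerRe t| <= (den t)^-1 /\ `|kerIm t| <= (den t)^-1.
Proof.
have D0 := den_gt0 t; have Dn0 := den_neq0 t.
have E : kerRe t ^+ 2 + kerIm t ^+ 2 = (den t)^-1 ^+ 2.
  have D4 : den t ^+ 2 = ((cos t - x) ^+ 2 + (sin t - y) ^+ 2) ^+ 2 by [].
  have cs := cos2Dsin2 t.
  transitivity ((cos t ^+ 2 + sin t ^+ 2) * ((cos t - x) ^+ 2 + (sin t - y) ^+ 2) ^+ 2 / den t ^+ 4).
    by rewrite /kerRe /kerIm; field.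
  by rewrite cs -D4; field.
have H u v : u ^+ 2 + v ^+ 2 = (den t)^-1 ^+ 2 -> `|u| <= (den t)^-1.
  move=> uv; rewrite -(@ler_pXn2r _ 2) ?nnegrE ?invr_ge0 ?(ltW D0)//.
  by rewrite real_normK ?num_real// -uv lerDl sqr_ge0.
by split; [exact: H E|apply: (H _ (kerRe t)); rewrite addrC].
Qed.

Lemma prim_bounds t : `|primRe t| <= (Num.sqrt (den t))^-1 /\
  `|primIm t| <= (Num.sqrt (den t))^-1.
Proof.
have D0 := den_gt0 t; have Dn0 := den_neq0 t.
have E : primRe t ^+ 2 + primIm t ^+ 2 = (den t)^-1.
  transitivity (((cos t - x) ^+ 2 + (sin t - y) ^+ 2) / den t ^+ 2).
    by rewrite /primRe /primIm; field.
  by rewrite -/(den t); field.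
have H u v : u ^+ 2 + v ^+ 2 = (den t)^-1 -> `|u| <= (Num.sqrt (den t))^-1.
  move=> uv; rewrite -(@ler_pXn2r _ 2) ?nnegrE ?invr_ge0 ?sqrtr_ge0//.
  rewrite real_normK ?num_real// exprVn sqr_sqrtr ?(ltW D0)// -uv lerDl sqr_ge0//.
by split; [exact: H E|apply: (H _ (primRe t)); rewrite addrC].
Qed.

Lemma Re_herglotz_kernel t :
  complex.Re ((cis t + (x +i* y)) / (cis t - (x +i* y))) = poisson_ker t.
Proof.
rewrite /poisson_ker /cis /= -/(den t); have Dn0 := den_neq0 t.
have cs := cos2Dsin2 t.
transitivity (((cos t ^+ 2 + sin t ^+ 2) - (x ^+ 2 + y ^+ 2)) / den t); last by rewrite cs.
by field.
Qed.

Lemma Re_deriv_kernel t :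
  complex.Re (cis t / (cis t - (x +i* y)) ^+ 2) = kerRe t.
Proof.
rewrite -exprVn expr2 /kerRe /cis /= -/(den t); have Dn0 := den_neq0 t.
by field.
Qed.

Lemma Im_deriv_kernel t :
  complex.Im (cis t / (cis t - (x +i* y)) ^+ 2) = kerIm t.
Proof.
rewrite -exprVn expr2 /kerIm /cis /= -/(den t); have Dn0 := den_neq0 t.
by field.
Qed.

End kernels.

Section bounded_products.
Context {R : realType}.
Local Notation mu := (@lebesgue_measure R).
Implicit Types (f k : R -> R) (D : set R) (a b c C : R).

Lemma integrable_bounded_mul D f k C : measurable (D : set (measurableTypeR R)) ->
  measurable_fun [set: R] k -> (forall t, D t -> `|k t| <= C) ->
  mu.-integrable D (EFin \o f) -> mu.-integrable D (EFin \o (fun t => k t * f t)).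
Proof.
move=> mD mk kC intf.
have mf : measurable_fun D f by apply/measurable_EFinP; exact: (measurable_int mu).
apply: (le_integrable mD _ _ (integrableZl mD C intf)).
  by apply/measurable_EFinP; apply: measurable_funM => //; exact: measurable_funTS.
move=> t Dt; rewrite /= lee_fin !normrM ler_wpM2r//.
by rewrite (le_trans (kC _ Dt))// ler_norm.
Qed.

Lemma Rintegral_oc_cst a b c : a <= b -> \int[mu]_(t in `]a, b]) c = c * (b - a).
Proof.
move=> ab; rewrite Rintegral_cst//; congr (_ * _).
rewrite /= lebesgue_measure_itv/= lte_fin.
by case: ltP => //= ba; apply/esym/eqP; rewrite subr_eq0 eq_le ba ab.
Qed.

Lemma Rintegral_oc_le f a b c : a <= b -> mu.-integrable `]a, b] (EFin \o f) ->
  (forall t, a < t -> t <= b -> f t <= c) ->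
  \int[mu]_(t in `]a, b]) f t <= c * (b - a).
Proof.
move=> ab intf fc; rewrite -Rintegral_oc_cst//; apply: le_Rintegral => //.
  by apply: continuous_integrable_oc => t; exact: cst_continuous.
by move=> t; rewrite /= in_itv/= => /andP[]; exact: fc.
Qed.

Lemma Rintegral_oc_ge f a b c : a <= b -> mu.-integrable `]a, b] (EFin \o f) ->
  (forall t, a < t -> t <= b -> c <= f t) ->
  c * (b - a) <= \int[mu]_(t in `]a, b]) f t.
Proof.
move=> ab intf fc; rewrite -Rintegral_oc_cst//; apply: le_Rintegral => //.
  by apply: continuous_integrable_oc => t; exact: cst_continuous.
by move=> t; rewrite /= in_itv/= => /andP[]; exact: fc.
Qed.

End bounded_products.

(** * Distances to the jump point and to the circle *)

Section disk_point.
Context {R : realType} (x y : R) (xy1 : x ^+ 2 + y ^+ 2 < 1).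
Implicit Types (t : R).
Local Notation den := (den x y).
Local Notation poisson_ker := (poisson_ker x y).

(** [rad] is |1 - z|, the distance to the point where h jumps, and [gap] is 1 - |z|, the distance to
    the circle. All estimates of the outer function are in these two quantities. *)
Definition rad : R := Num.sqrt ((1 - x) ^+ 2 + y ^+ 2).
Definition gap : R := 1 - Num.sqrt (x ^+ 2 + y ^+ 2).

Let z := x +i* y.

Let normz : normc z = Num.sqrt (x ^+ 2 + y ^+ 2). Proof. by []. Qed.

Lemma gap_gt0 : 0 < gap.
Proof. by rewrite subr_gt0 -sqrtr1 ltr_sqrt. Qed.

Lemma gap_le1 : gap <= 1. Proof. by rewrite gerBl sqrtr_ge0. Qed.

Let radE : rad = normc (1 - z).
Proof. by rewrite /rad /=; congr (Num.sqrt (_ + _)); rewrite sub0r sqrrN. Qed.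

Lemma gap_le_rad : gap <= rad.
Proof. by rewrite radE; have := normc_sub_ge 1 z; rewrite normc1. Qed.

Lemma rad_gt0 : 0 < rad. Proof. exact: lt_le_trans gap_gt0 gap_le_rad. Qed.

Lemma rad_lt2 : rad < 2.
Proof.
have := normc_triangle 1 (- z); rewrite normc_opp normc1 -radE.
by have := gap_gt0; rewrite /gap -normz; lra.
Qed.

Lemma gap_sqr : gap <= 1 - (x ^+ 2 + y ^+ 2) <= 2 * gap.
Proof.
have -> : x ^+ 2 + y ^+ 2 = (1 - gap) ^+ 2.
  by rewrite /gap subKr sqr_sqrtr// addr_ge0 ?sqr_ge0.
have := gap_gt0; have := gap_le1; move: gap => d H1 H2; apply/andP; split; nra.
Qed.

Let sqrt_den t : Num.sqrt (den t) = normc (cis t - z).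
Proof. by []. Qed.

Let cis0 : cis 0 = 1 :> R[i].
Proof. by rewrite /cis cos0 sin0. Qed.

Lemma sqrt_den_ge_gap t : gap <= Num.sqrt (den t).
Proof. by rewrite sqrt_den; exact: (cis_sub_ge t z). Qed.

Lemma sqrt_den_ge t : rad - `|t| <= Num.sqrt (den t).
Proof.
rewrite sqrt_den radE; have := normc_sub_ge (1 - z) (1 - cis t).
have := normc_cisB_le 0 t; rewrite cis0 sub0r normrN => H.
have -> : 1 - z - (1 - cis t) = cis t - z by ring.
by lra.
Qed.

Lemma sqrt_den_le t : Num.sqrt (den t) <= rad + `|t|.
Proof.
rewrite sqrt_den radE; have := normc_triangle (1 - z) (cis t - 1).
have := normc_cisB_le t 0; rewrite cis0 subr0 => H.
have -> : 1 - z + (cis t - 1) = cis t - z by ring.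
by lra.
Qed.

Lemma poisson_le_sqr t a : 0 < a -> a <= Num.sqrt (den t) ->
  poisson_ker t <= 2 * gap / a ^+ 2.
Proof.
move=> a0 ad; have D0 := den_gt0 xy1 t; rewrite /poisson_ker.
apply: ler_pM.
- by case/andP: gap_sqr => H _; apply: le_trans H; exact/ltW/gap_gt0.
- by rewrite invr_ge0 ltW.
- by case/andP: gap_sqr.
- rewrite lef_pV2 ?posrE ?exprn_gt0//.
  rewrite -[leRHS]sqr_sqrtr ?(ltW D0)// lerXn2r ?nnegrE ?sqrtr_ge0// ltW//.
Qed.

Lemma poisson_ge_sqr t a : Num.sqrt (den t) <= a ->
  gap / a ^+ 2 <= poisson_ker t.
Proof.
move=> ad; have D0 := den_gt0 xy1 t; rewrite /poisson_ker.
have s0 : 0 < Num.sqrt (den t) by rewrite sqrtr_gt0.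
have a0 : 0 < a by exact: lt_le_trans ad.
apply: ler_pM; rewrite ?(ltW gap_gt0) ?invr_ge0 ?exprn_ge0 ?(ltW a0)//.
- by case/andP: gap_sqr.
- rewrite lef_pV2 ?posrE ?exprn_gt0//.
  by rewrite -[leLHS]sqr_sqrtr ?(ltW D0)// lerXn2r ?nnegrE ?sqrtr_ge0// ltW.
Qed.

Lemma sqrt_den_ge_half t : `|t| <= rad / 2 -> rad / 2 <= Num.sqrt (den t).
Proof. by move=> H; apply: le_trans (sqrt_den_ge t); lra. Qed.

Lemma poisson_le_max t : poisson_ker t <= 2 * gap / gap ^+ 2.
Proof. by apply: poisson_le_sqr; [exact: gap_gt0|exact: sqrt_den_ge_gap]. Qed.

Lemma measurable_poisson : measurable_fun [set: R] poisson_ker.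
Proof. by apply: continuous_measurable_fun => t; exact: continuous_poisson. Qed.

End disk_point.

(** * Upper bound for the modulus of the outer function *)

Section log_modulus_upper.
Context {R : realType} (alpha beta x y : R)
  (alpha_gt0 : 0 < alpha) (alpha_lt1 : alpha < 1) (beta_gt0 : 0 < beta)
  (xy1 : x ^+ 2 + y ^+ 2 < 1).
Local Notation mu := (@lebesgue_measure R).
Local Notation h := (hbeta alpha beta).
Local Notation l := (fun t => ln (h t)).
Local Notation den := (den x y).
Local Notation poisson_ker := (poisson_ker x y).
Local Notation r := (rad x y).
Local Notation d := (gap x y).
Local Notation g := (hgap alpha beta).
Implicit Types (t c : R).

Lemma integrable_poisson_mul c :
  mu.-integrable (@angles R) (EFin \o (fun t => poisson_ker t * (ln (h t) - c))).
Proof.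
apply: (@integrable_bounded_mul _ _ _ _ (2 * d / d ^+ 2)) => //.
- exact: measurable_itv.
- exact: measurable_poisson.
- by move=> t _; rewrite ger0_norm ?poisson_ge0// poisson_le_max.
- have i1 := @integrable_ln_hbeta R alpha beta alpha_gt0 beta_gt0.
  have i2 : mu.-integrable (@angles R) (EFin \o cst c).
    by apply: continuous_integrable_oc => t; exact: cst_continuous.
  by apply: (integrableB _ i1 i2); exact: measurable_itv.
Qed.

Lemma Rintegral_poisson_sub c :
  \int[mu]_(t in @angles R) (poisson_ker t * (ln (h t) - c)) =
  \int[mu]_(t in @angles R) (poisson_ker t * ln (h t)) - 2 * pi * c.
Proof.
have mA : measurable (@angles R : set (measurableTypeR R)) by exact: measurable_itv.
have i0 : mu.-integrable (@angles R) (EFin \o (fun t => poisson_ker t * ln (h t))).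
  by apply: (eq_integrable mA _ _ _ (integrable_poisson_mul 0)) => t _; rewrite /= subr0.
have ip := integrable_poisson xy1.
rewrite -(Rintegral_poisson xy1) mulrC -RintegralZl//= -RintegralB//.
  by apply: eq_Rintegral => t _; ring.
by apply: (eq_integrable mA _ _ _ (integrableZl mA c ip)).
Qed.

(** With p = r/2, subtract the constant ln h(p), which the Poisson kernel integrates to 2 pi ln
    h(p). Angles beyond p on either side contribute at most 0. On the arc from -p to 0 the integrand
    is -g(p) times a kernel at least d/(4 r^2), which gives -g(p) d/(8 r). On the arc from 0 to p
    the kernel is at most 8/r and ln h - ln h(p) at most (alpha/2)(ln p - ln t), which gives 2
    alpha. *)
Lemma poisson_log_upper :
  \int[mu]_(t in @angles R) (poisson_ker t * ln (h t)) <=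
  2 * pi * ln (h (r / 2)) + 2 * alpha - g (r / 2) * (d / r) / 8.
Proof.
set p := r / 2.
have r0 := rad_gt0 xy1; have r2 := rad_lt2 xy1; have d0 := gap_gt0 xy1.
have dr := gap_le_rad x y.
have pi2 := pi_ge2 R.
have p0 : 0 < p by rewrite /p; lra.
have ppi : p <= pi by rewrite /p; lra.
have a0 := alpha_gt0.
have g0 : 0 <= g p.
  by apply: le_trans (hgap_ge_ln2 alpha_gt0 beta_gt0 p0 ppi); rewrite ln_ge0// ler1n.
have rp : r = 2 * p by rewrite /p; field.
have int := integrable_poisson_mul (ln (h p)); rewrite /angles in int.
suff : \int[mu]_(t in @angles R) (poisson_ker t * (ln (h t) - ln (h p))) <=
    2 * alpha - g p * (d / r) / 8.
  by rewrite Rintegral_poisson_sub; lra.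
have neg t : t <= 0 -> ln (h t) - ln (h p) = - g p.
  by move=> t0; rewrite (hbeta_le0 _ _ t0) /hgap opprB.
have p_ge0 := poisson_ge0 xy1.
rewrite /angles (@Rintegral_oc_split _ _ (- pi) (- p) pi)//; [|lra|lra].
rewrite (@Rintegral_oc_split _ _ (- p) 0 pi); [|lra|lra|by apply: integrable_oc_sub int; lra].
rewrite (@Rintegral_oc_split _ _ 0 p pi)//; [|lra|by apply: integrable_oc_sub int; lra].
have I1 : \int[mu]_(t in `](- pi), (- p)]) (poisson_ker t * (ln (h t) - ln (h p))) <= 0 * (- p - - pi).
  apply: Rintegral_oc_le; [lra|by apply: integrable_oc_sub int; lra|].
  by move=> t t1 t2; rewrite neg; [rewrite mulrN oppr_le0 mulr_ge0|lra].
have I2 : \int[mu]_(t in `](- p), 0]) (poisson_ker t * (ln (h t) - ln (h p))) <=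
    - (g p * (d / (4 * r ^+ 2))) * (0 - - p).
  apply: Rintegral_oc_le; [lra|by apply: integrable_oc_sub int; lra|].
  move=> t t1 t2; rewrite neg// mulrN lerN2 mulrC ler_wpM2r//.
  have -> : 4 * r ^+ 2 = (2 * r) ^+ 2 by ring.
  apply: poisson_ge_sqr => //; apply: (le_trans (sqrt_den_le _ _ _)).
  by rewrite ler0_norm// rp; lra.
have I4 : \int[mu]_(t in `]p, pi]) (poisson_ker t * (ln (h t) - ln (h p))) <= 0 * (pi - p).
  apply: Rintegral_oc_le; [lra|by apply: integrable_oc_sub int; lra|].
  move=> t t1 t2; rewrite mulr_ge0_le0// subr_le0; apply: ln_hbeta_le => //; lra.
have I3 : \int[mu]_(t in `]0, p]) (poisson_ker t * (ln (h t) - ln (h p))) <= 2 * alpha.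
  apply: (@le_trans _ _ (\int[mu]_(t in `]0, p]) (4 * alpha / r * (ln p - ln t)))).
    apply: le_Rintegral => //.
    - by apply: integrable_oc_sub int; lra.
    - have mI : measurable (`]0, p] : set (measurableTypeR R)) by exact: measurable_itv.
      by apply: (eq_integrable mI _ _ _ (integrableZl mI (4 * alpha / r) (integrable_ln_sub p0))).
    - move=> t; rewrite /= in_itv/= => /andP[t0 tp].
      have ltp : 0 <= ln p - ln t by rewrite subr_ge0 ler_ln ?posrE.
      have H1 := ln_hbeta_sub_le alpha_gt0 beta_gt0 t0 tp ppi.
      have H2 : poisson_ker t <= 8 / r.
        apply: (@le_trans _ _ (2 * d / (r / 2) ^+ 2)).
          apply: poisson_le_sqr => //; apply: sqrt_den_ge_half.
          by rewrite gtr0_norm.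
        rewrite -/p ler_pdivrMr ?exprn_gt0// [leRHS](_ : _ = 2 * r); last first.
          by rewrite rp; field; rewrite gt_eqF.
        by rewrite ler_pM2l.
      have -> : 4 * alpha / r * (ln p - ln t) = 8 / r * (alpha / 2 * (ln p - ln t)) by field; rewrite gt_eqF.
      by apply: ler_pM => //; rewrite subr_ge0 ln_hbeta_le.
  rewrite RintegralZl//; last exact: integrable_ln_sub.
  apply: le_trans (ler_wpM2l _ (Rintegral_ln_sub_le p0)) _.
    by rewrite divr_ge0 ?(ltW r0)// mulr_ge0// ltW.
  by rewrite le_eqVlt rp; apply/orP; left; apply/eqP; field; rewrite gt_eqF.
have E2 : - (g p * (d / (4 * r ^+ 2))) * (0 - - p) = - (g p * (d / r) / 8).
  by rewrite rp; field; rewrite gt_eqF.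
rewrite E2 in I2; lra.
Qed.

(** Dividing by 2 pi turns 2 alpha into at most 1. The bound holds on both sides of the real axis,
    although h is large only on the upper arc. *)
Lemma normc_outer_upper :
  normc (outer h (x +i* y)) <= expR (ln (h (r / 2)) + 1 - g (r / 2) * (d / r) / (16 * pi)).
Proof.
rewrite normc_outer ler_expR.
have pi0 := pi_gt0 R.
rewrite mulrC ler_pdivrMr ?mulr_gt0//.
have -> : \int[mu]_(t in @angles R) complex.Re ((cis t + (x +i* y)) / (cis t - (x +i* y)) *
    (ln (h t))%:C) = \int[mu]_(t in @angles R) (poisson_ker t * ln (h t)).
  apply: eq_Rintegral => t _; rewrite -(Re_herglotz_kernel xy1).
  by case: (_ / _) => a b /=; rewrite mulr0 subr0.
apply: (le_trans poisson_log_upper).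
have -> : (ln (h (r / 2)) + 1 - g (r / 2) * (d / r) / (16 * pi)) * (2 * pi) =
    2 * pi * ln (h (r / 2)) + 2 * pi - g (r / 2) * (d / r) / 8.
  by move: (d / r) => s; move: (gt_eqF pi0); move: (pi : R) => P P0; field; rewrite P0.
by have := pi_ge2 R; have := alpha_lt1; lra.
Qed.

End log_modulus_upper.

(** * The logarithmic derivative of the outer function by integration by parts *)

Section local_ftc.
Context {R : realType}.
Local Notation mu := (@lebesgue_measure R).
Implicit Types (f F : R -> R) (a b : R).

Lemma continuous_on_integrable_oc f a b :
  (forall t, a <= t <= b -> {for t, continuous f}) -> mu.-integrable `]a, b] (EFin \o f).
Proof.
move=> cf.
have : mu.-integrable `[a, b] (EFin \o f).
  apply: continuous_compact_integrable; first exact: segment_compact.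
  apply: continuous_in_subspaceT => t; rewrite inE/= in_itv/=; exact: cf.
by apply: integrableS => // t /=; rewrite !in_itv/= => /andP[/ltW -> ->].
Qed.

Lemma FTC2_on_oc f F a b : a < b -> (forall t : R, a <= t <= b -> is_derive t 1 F (f t)) ->
  (forall t, a <= t <= b -> {for t, continuous f}) ->
  \int[mu]_(t in `]a, b]) f t = F b - F a.
Proof.
move=> ab dF cf; rewrite /Rintegral integral_itv_obnd_cbnd; last first.
  exact: (measurable_int mu (continuous_on_integrable_oc cf)).
by rewrite (FTC2_closed ab dF cf).
Qed.

End local_ftc.

Section deriv_formula.
Context {R : realType} (alpha beta x y : R)
  (alpha_gt0 : 0 < alpha) (alpha_lt1 : alpha < 1) (beta_gt0 : 0 < beta)
  (xy1 : x ^+ 2 + y ^+ 2 < 1).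
Local Notation mu := (@lebesgue_measure R).
Local Notation h := (hbeta alpha beta).
Local Notation L := (loginv alpha beta).
Local Notation den := (den x y).
Local Notation poisson_ker := (poisson_ker x y).
Local Notation r := (rad x y).
Local Notation d := (gap x y).
Local Notation g := (hgap alpha beta).
Local Notation kap := (2 * beta / alpha).
Implicit Types (t c : R).
Let p := r / 2.
(** The size of the error, a geometric mean of 1/r and 1/d, characterised by (r M)(d M) = 1. *)
Let M := (Num.sqrt (r * d))^-1.

Context (F K : R -> R).
Context (dF : forall t : R, is_derive t 1 F (K t)).
Context (cK : forall t, {for t, continuous K}).
Context (cF : forall t, {for t, continuous F}).
Context (KB : forall t, `|K t| <= (den t)^-1).
Context (FB : forall t, `|F t| <= (Num.sqrt (den t))^-1).
Context (Fper : F pi = F (- pi)).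

Let r0 : 0 < r. Proof. exact: rad_gt0. Qed.
Let d0 : 0 < d. Proof. exact: gap_gt0. Qed.
Let p0 : 0 < p. Proof. by rewrite divr_gt0. Qed.
Let rp : r = 2 * p. Proof. by rewrite /p; field. Qed.
Let pi2 : 2 <= pi :> R. Proof. exact: pi_ge2. Qed.
Let ppi : p < pi. Proof. by have := rad_lt2 xy1; have := pi2; rewrite /p; lra. Qed.
Let M0 : 0 < M. Proof. by rewrite invr_gt0 sqrtr_gt0 mulr_gt0. Qed.
Let M2 : r * M * (d * M) = 1.
Proof.
have -> : r * M * (d * M) = r * d * M ^+ 2 by ring.
by rewrite /M exprVn sqr_sqrtr ?mulr_ge0 ?ltW// divff// gt_eqF// mulr_gt0.
Qed.
Let rM : r^-1 <= M.
Proof.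
have S0 : 0 < Num.sqrt (r * d) by rewrite sqrtr_gt0 mulr_gt0.
rewrite /M lef_pV2 ?posrE//.
rewrite -[X in _ <= X](gtr0_norm r0) -sqrtr_sqr ler_sqrt ?exprn_ge0 ?(ltW r0)//.
by rewrite expr2 ler_pM2l// gap_le_rad.
Qed.

Let lf t := - (alpha / 2) * ln t - beta * ln (L t).
Let lf' t := - (alpha / 2) * t^-1 - beta * ((L t)^-1 * - t^-1).

Let is_derive_lf t : 0 < t -> t <= pi -> is_derive t 1 lf (lf' t).
Proof.
move=> t0 tpi; have Lt := loginv_gt0 alpha_gt0 beta_gt0 t0 tpi.
have d1 := is_derive1Z (- (alpha / 2)) (is_derive1_ln t0).
have d2 := is_derive1Z beta (is_derive1_comp' (g := L) (is_derive1_ln Lt) (is_derive_loginv alpha beta t0)).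
exact: (is_derive1D d1 (is_derive1N d2)).
Qed.

Let continuous_lf' t : 0 < t -> t <= pi -> {for t, continuous lf'}.
Proof.
move=> t0 tpi; have Lt := loginv_gt0 alpha_gt0 beta_gt0 t0 tpi.
have dV := is_derive1V (f := id) (lt0r_neq0 t0) (is_derive_id t 1).
have dLV := is_derive1V (lt0r_neq0 Lt) (is_derive_loginv alpha beta t0).
have d1 := is_derive1Z (- (alpha / 2)) dV.
have d2 := is_derive1Z beta (is_derive1M dLV (is_derive1N dV)).
exact: (is_derive_continuous (is_derive1D d1 (is_derive1N d2))).
Qed.

(** The derivative is -(alpha/2 - beta/L)/t, and L >= kap makes beta/L at most alpha/2, so the
    parenthesis lies between 0 and alpha/2. *)
Let lf'_bound t : 0 < t -> t <= pi -> `|lf' t| <= alpha / 2 * t^-1.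
Proof.
move=> t0 tpi; have Lt := loginv_ge alpha beta t0 tpi.
have Lt0 := loginv_gt0 alpha_gt0 beta_gt0 t0 tpi.
have a0 := alpha_gt0; have b0 := beta_gt0.
have H : beta * (L t)^-1 <= alpha / 2.
  rewrite ler_pdivrMr//; apply: le_trans (ler_wpM2l (_ : 0 <= alpha / 2) Lt); last by lra.
  by rewrite le_eqVlt; apply/orP; left; apply/eqP; field; rewrite gt_eqF.
have H0 : 0 <= beta * (L t)^-1 by rewrite mulr_ge0 ?invr_ge0 ?ltW.
have -> : lf' t = - ((alpha / 2 - beta * (L t)^-1) * t^-1) by rewrite /lf'; ring.
have ti : 0 <= t^-1 by rewrite invr_ge0 ltW.
rewrite normrN normrM (ger0_norm ti) ler_wpM2r// ger0_norm; lra.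
Qed.

Let lfE t : 0 < t -> t <= pi -> ln (h t) = lf t.
Proof. exact: ln_hbeta. Qed.

Lemma integrable_kernel_mul c :
  mu.-integrable (@angles R) (EFin \o (fun t => K t * (ln (h t) - c))).
Proof.
apply: (@integrable_bounded_mul _ _ _ _ ((d ^+ 2)^-1)) => //.
- exact: measurable_itv.
- by apply: continuous_measurable_fun => t; exact: cK.
- move=> t _; apply: (le_trans (KB t)); rewrite lef_pV2 ?posrE ?exprn_gt0 ?den_gt0//.
  rewrite -[leRHS]sqr_sqrtr ?(ltW (den_gt0 xy1 t))// lerXn2r ?nnegrE ?sqrtr_ge0 ?(ltW d0)//.
  exact: sqrt_den_ge_gap.
- have i1 := @integrable_ln_hbeta R alpha beta alpha_gt0 beta_gt0.
  have i2 : mu.-integrable (@angles R) (EFin \o cst c).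
    by apply: continuous_integrable_oc => t; exact: cst_continuous.
  by apply: (integrableB _ i1 i2); exact: measurable_itv.
Qed.

(** K has a periodic primitive, hence mean zero, and constants may be subtracted from ln h
    freely. *)
Let kernel_mean c : \int[mu]_(t in @angles R) (K t * (ln (h t) - c)) =
  \int[mu]_(t in @angles R) (K t * ln (h t)).
Proof.
have mA : measurable (@angles R : set (measurableTypeR R)) by exact: measurable_itv.
have i0 : mu.-integrable (@angles R) (EFin \o (fun t => K t * ln (h t))).
  by apply: (eq_integrable mA _ _ _ (integrable_kernel_mul 0)) => t _; rewrite /= subr0.
have iK : mu.-integrable (@angles R) (EFin \o K) by apply: continuous_integrable_oc.
have K0 : \int[mu]_(t in @angles R) K t = 0.
  rewrite /angles (FTC2_oc _ dF cK) ?Fper ?subrr//.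
  by have := pi2; lra.
rewrite -[RHS]subr0 -(mulr0 c) -[in RHS]K0 -RintegralZl//= -RintegralB//.
  by apply: eq_Rintegral => t _; ring.
by apply: (eq_integrable mA _ _ _ (integrableZl mA c iK)).
Qed.

Let by_parts c : \int[mu]_(t in `]p, pi]) (K t * (ln (h t) - c)) =
  F pi * (ln (h pi) - c) - F p * (ln (h p) - c) - \int[mu]_(t in `]p, pi]) (F t * lf' t).
Proof.
have pos t : p <= t <= pi -> 0 < t /\ t <= pi.
  by move=> /andP[pt tpi]; split => //; exact: lt_le_trans pt.
have dG t : p <= t <= pi -> is_derive t 1 (fun u => F u * (lf u - c))
    (K t * (lf t - c) + F t * lf' t).
  move=> /pos[t0 tpi].
  have d1 : is_derive t 1 (fun u => lf u - c) (lf' t).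
    rewrite -[X in is_derive _ _ _ X]addr0.
    exact: (is_derive1D (is_derive_lf t0 tpi) (is_derive_cst (- c) t 1)).
  exact: (is_derive1M (dF t) d1).
have c1 t : p <= t <= pi -> {for t, continuous (fun u => K u * (lf u - c))}.
  move=> /pos[t0 tpi]; apply: continuousM; first exact: cK.
  apply: continuousB; last exact: cst_continuous.
  exact: is_derive_continuous (is_derive_lf t0 tpi).
have c2 t : p <= t <= pi -> {for t, continuous (fun u => F u * lf' u)}.
  move=> /pos[t0 tpi]; apply: continuousM; first exact: cF.
  exact: continuous_lf'.
have c3 t : p <= t <= pi -> {for t, continuous (fun u => K u * (lf u - c) + F u * lf' u)}.
  by move=> tp; apply: continuousD; [exact: c1|exact: c2].
have H := FTC2_on_oc ppi dG c3.
rewrite RintegralD// in H; [|exact: continuous_on_integrable_oc|exact: continuous_on_integrable_oc].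
rewrite -!lfE// in H; [|exact: ltW|by have := pi2; lra].
have -> : \int[mu]_(t in `]p, pi]) (K t * (ln (h t) - c)) =
    \int[mu]_(t in `]p, pi]) (K t * (lf t - c)).
  apply: eq_Rintegral => t; rewrite inE/= in_itv/= => /andP[pt tpi].
  by rewrite lfE// (lt_trans p0).
by rewrite -H addrK.
Qed.

(** The integrand is at most (alpha/2) t^(-1) |e^(it) - z|^(-1). A weighted arithmetic-geometric
    inequality separates it into t^(-2), whose integral from p is at most 2/r, and d/|e^(it) - z|^2,
    which is at most the Poisson kernel. *)
Let tail_bound : `|\int[mu]_(t in `]p, pi]) (F t * lf' t)| <= alpha / 2 * ((1 + pi) * M).
Proof.
have pos t : p <= t <= pi -> 0 < t /\ t <= pi.
  by move=> /andP[pt tpi]; split => //; exact: lt_le_trans pt.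
have iF : mu.-integrable `]p, pi] (EFin \o (fun t => F t * lf' t)).
  apply: continuous_on_integrable_oc => t /pos[t0 tpi].
  by apply: continuousM; [exact: cF|exact: continuous_lf'].
pose q1 t := (t ^+ 2)^-1.
have dq t : p <= t <= pi -> is_derive t 1 (fun u : R => - u^-1) (q1 t).
  move=> /pos[t0 tpi].
  have dV := is_derive1N (is_derive1V (f := id) (lt0r_neq0 t0) (is_derive_id t 1)).
  by apply: (is_derive_eq dV); rewrite /q1 mulN1r opprK.
have cq t : p <= t <= pi -> {for t, continuous q1}.
  move=> /pos[t0 tpi].
  have dX := is_derive1M (is_derive_id t 1) (is_derive_id t 1).
  have n0 : t * t != 0 by rewrite mulf_neq0// gt_eqF.
  have -> : q1 = (fun u => (u * u)^-1) by apply/funext => u; rewrite /q1 expr2.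
  exact: (is_derive_continuous (is_derive1V (f := fun u => u * u) n0 dX)).
have iq := continuous_on_integrable_oc cq.
have ip : mu.-integrable `]p, pi] (EFin \o poisson_ker).
  by apply: continuous_integrable_oc; exact: continuous_poisson.
have mI : measurable (`]p, pi] : set (measurableTypeR R)) by exact: measurable_itv.
have i1 : mu.-integrable `]p, pi] (EFin \o (fun t => alpha / 4 * (r * M) * q1 t)).
  by apply: (eq_integrable mI _ _ _ (integrableZl mI (alpha / 4 * (r * M)) iq)).
have i2 : mu.-integrable `]p, pi] (EFin \o (fun t => alpha / 4 * M * poisson_ker t)).
  by apply: (eq_integrable mI _ _ _ (integrableZl mI (alpha / 4 * M) ip)).
have a0 := alpha_gt0; have M0' := M0.
apply: (le_trans (le_normr_Rintegral mI iF)).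
apply: (@le_trans _ _ (\int[mu]_(t in `]p, pi]) (alpha / 4 * (r * M) * q1 t + alpha / 4 * M * poisson_ker t))).
  apply: le_Rintegral => //.
  - exact: (integrable_norm iF).
  - exact: (integrableD mI i1 i2).
  - move=> t; rewrite /= in_itv/= => /andP[pt tpi]; have t0 : 0 < t by exact: lt_trans pt.
    have D0 := den_gt0 xy1 t.
    rewrite normrM; apply: (le_trans (ler_pM _ _ (FB t) (lf'_bound t0 tpi))) => //.
    set n := (Num.sqrt (den t))^-1.
    have n2 : n ^+ 2 = (den t)^-1 by rewrite /n exprVn sqr_sqrtr// ltW.
    have pois : d * n ^+ 2 <= poisson_ker t.
      rewrite n2 /poisson_ker ler_wpM2r ?invr_ge0 ?(ltW D0)//.
      by case/andP: (gap_sqr xy1).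
    have q1E : q1 t = t^-1 ^+ 2 by rewrite exprVn.
    rewrite q1E; move: (t^-1) => w.
    (* Multiplied by d M and simplified with (r M)(d M) = 1, this is 2 w n <= r M w^2 + d M n^2, the
       weights for which both integrals are of order M. *)
    have H := sqr_ge0 (r * M * w - n).
    have H3 : 2 * (w * n) <= r * M * w ^+ 2 + d * M * n ^+ 2.
      have K1 : 0 <= d * M by rewrite mulr_ge0 ?ltW.
      have := mulr_ge0 K1 H; rewrite sqrrB mulrDr mulrBr => {}H.
      have E1 : d * M * (r * M * w) ^+ 2 = r * M * w ^+ 2 * (r * M * (d * M)) by ring.
      have E2 : d * M * (r * M * w * n *+ 2) = 2 * (w * n) * (r * M * (d * M)) by rewrite -mulr_natl; ring.
      by rewrite E1 E2 M2 !mulr1 in H; lra.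
    have H4 : M * (d * n ^+ 2) <= M * poisson_ker t by rewrite ler_wpM2l// ltW.
    have a4 : 0 <= alpha / 4 by lra.
    have := ler_wpM2l a4 H3; have := ler_wpM2l a4 H4; lra.
rewrite RintegralD// (RintegralZl _ mI iq) (RintegralZl _ mI ip).
have Q1 : \int[mu]_(t in `]p, pi]) q1 t <= 2 / r.
  rewrite (FTC2_on_oc ppi dq cq) opprK rp.
  have -> : 2 / (2 * p) = p^-1 by field; rewrite gt_eqF.
  by rewrite gerDr oppr_le0 invr_ge0; have := pi2; lra.
have Q2 : \int[mu]_(t in `]p, pi]) poisson_ker t <= 2 * pi.
  rewrite -(Rintegral_poisson xy1) /angles (@Rintegral_oc_split _ _ (- pi) p pi).
  - rewrite lerDr; apply: Rintegral_ge0 => t _; exact: poisson_ge0.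
  - by have := p0; have := pi2; lra.
  - exact: ltW.
  - exact: integrable_poisson.
have T1 : r * M * \int[mu]_(t in `]p, pi]) q1 t <= 2 * M.
  have := ler_wpM2l (_ : 0 <= r * M) Q1; rewrite mulr_ge0 ?(ltW r0) ?(ltW M0)// => /(_ isT).
  by have -> : r * M * (2 / r) = 2 * M by field; rewrite gt_eqF.
have T2 : M * \int[mu]_(t in `]p, pi]) poisson_ker t <= 2 * pi * M.
  by rewrite mulrC ler_wpM2r// ltW.
have a4 : 0 <= alpha / 4 by lra.
apply: le_trans (_ : _ <= alpha / 4 * (2 * M) + alpha / 4 * (2 * pi * M)) _.
  apply: lerD; first by have := ler_wpM2l a4 T1; rewrite !mulrA.
  by apply: le_trans (ler_wpM2l a4 T2); rewrite mulrA.
by rewrite le_eqVlt; apply/orP; left; apply/eqP; move: (pi : R) => P; field.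
Qed.

(** Subtract ln h(p), p = r/2. On the negative arc the integrand is -g(p) K, integrated exactly by
    F. From 0 to p the kernel is at most 4/r^2, which costs at most 1/r <= M. From p on, integrate
    by parts: the boundary term at p vanishes and the one at pi combines with the negative arc into
    ln 2, the jump of ln h at -1. Each jump thus contributes its height times F at the jump
    point. *)
Lemma kernel_log_formula :
  `|\int[mu]_(t in @angles R) (K t * ln (h t)) + g p * F 0 - ln 2 * F pi| <= (2 + pi) * M.
Proof.
have int := integrable_kernel_mul (ln (h p)); rewrite /angles in int.
rewrite -(kernel_mean (ln (h p))) /angles.
have pp0 := p0; have pi2' := pi2; have ppi' := ppi; have a0 := alpha_gt0; have a1 := alpha_lt1.
rewrite (@Rintegral_oc_split _ _ (- pi) 0 pi)//; [|lra|lra].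
rewrite (@Rintegral_oc_split _ _ 0 p pi)//; [|lra|lra|by apply: integrable_oc_sub int; lra].
rewrite by_parts subrr mulr0 subr0.
have I1 : \int[mu]_(t in `](- pi), 0]) (K t * (ln (h t) - ln (h p))) = - g p * (F 0 - F pi).
  rewrite Fper -(FTC2_oc _ dF cK); last by lra.
  rewrite -RintegralZl//; last by apply: continuous_integrable_oc.
  apply: eq_Rintegral => t; rewrite inE/= in_itv/= => /andP[_ t0].
  by rewrite (hbeta_le0 _ _ t0) /hgap opprB mulrC.
have I2 : `|\int[mu]_(t in `]0, p]) (K t * (ln (h t) - ln (h p)))| <= M.
  have int2 : mu.-integrable `]0, p] (EFin \o (fun t => K t * (ln (h t) - ln (h p)))).
    by apply: integrable_oc_sub int; lra.
  have mI : measurable (`]0, p] : set (measurableTypeR R)) by exact: measurable_itv.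
  apply: (le_trans (le_normr_Rintegral mI int2)).
  apply: (@le_trans _ _ (\int[mu]_(t in `]0, p]) (2 * alpha / r ^+ 2 * (ln p - ln t)))).
    apply: le_Rintegral => //.
    - exact: (integrable_norm int2).
    - by apply: (eq_integrable mI _ _ _ (integrableZl mI (2 * alpha / r ^+ 2) (integrable_ln_sub p0))).
    - move=> t; rewrite /= in_itv/= => /andP[t0 tp].
      have H1 := ln_hbeta_sub_le alpha_gt0 beta_gt0 t0 tp (ltW ppi).
      have H0 := ln_hbeta_le alpha_gt0 beta_gt0 t0 tp (ltW ppi).
      have D0 := den_gt0 xy1 t.
      have H2 : `|K t| <= 4 / r ^+ 2.
        apply: (le_trans (KB t)).
        have -> : 4 / r ^+ 2 = (p ^+ 2)^-1 by rewrite rp; field; rewrite gt_eqF.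
        rewrite lef_pV2 ?posrE ?exprn_gt0//.
        rewrite -[leRHS]sqr_sqrtr ?(ltW D0)// lerXn2r ?nnegrE ?sqrtr_ge0 ?(ltW p0)//.
        by apply: sqrt_den_ge_half; rewrite gtr0_norm.
      rewrite normrM [X in _ * X]ger0_norm ?subr_ge0//.
      have -> : 2 * alpha / r ^+ 2 * (ln p - ln t) = 4 / r ^+ 2 * (alpha / 2 * (ln p - ln t)).
        by field; rewrite gt_eqF.
      by apply: ler_pM => //; rewrite subr_ge0.
  rewrite RintegralZl//; last exact: integrable_ln_sub.
  apply: le_trans (ler_wpM2l _ (Rintegral_ln_sub_le p0)) _.
    by rewrite divr_ge0 ?exprn_ge0 ?(ltW r0)// mulr_ge0// ltW.
  apply: le_trans rM.
  have -> : 2 * alpha / r ^+ 2 * p = alpha * r^-1 by rewrite rp; field; rewrite gt_eqF.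
  by rewrite ler_piMl ?invr_ge0 ?ltW.
rewrite I1.
have gE : g p + (ln (h pi) - ln (h p)) = ln 2.
  rewrite /hgap ln_hbeta_pi2//; ring.
have -> : - g p * (F 0 - F pi) + (\int[mu]_(t in `]0, p]) (K t * (ln (h t) - ln (h p))) +
    (F pi * (ln (h pi) - ln (h p)) - \int[mu]_(t in `]p, pi]) (F t * lf' t))) + g p * F 0 - ln 2 * F pi =
    \int[mu]_(t in `]0, p]) (K t * (ln (h t) - ln (h p))) - \int[mu]_(t in `]p, pi]) (F t * lf' t).
  by rewrite -gE; ring.
apply: (le_trans (ler_normB _ _)).
apply: (le_trans (lerD I2 tail_bound)).
have -> : (2 + pi) * M = M + (1 + pi) * M by move: (pi : R) => P; ring.
rewrite lerD2l ler_piMl//; last by rewrite ler_pdivrMr// mul1r ltW// (lt_trans a1)// ltr1n.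
by rewrite mulr_ge0 ?(ltW M0)// addr_ge0// pi_ge0.
Qed.

End deriv_formula.

Section herglotz_deriv_bounds.
Context {R : realType} (alpha beta x y : R)
  (alpha_gt0 : 0 < alpha) (alpha_lt1 : alpha < 1) (beta_gt0 : 0 < beta)
  (xy1 : x ^+ 2 + y ^+ 2 < 1).
Local Notation mu := (@lebesgue_measure R).
Local Notation h := (hbeta alpha beta).
Local Notation den := (den x y).
Local Notation r := (rad x y).
Local Notation d := (gap x y).
Local Notation g := (hgap alpha beta).
Implicit Types (t c : R).
Let z := x +i* y.
(** [den pi] is |1 + z|^2: the first summand is the jump of height ln 2 at -1, the second the error
    of [kernel_log_formula]. *)
Let e := ln 2 / Num.sqrt (den pi) + (2 + pi) / Num.sqrt (r * d).

Let den0 : Num.sqrt (den 0) = r.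
Proof. by rewrite /den /rad cos0 sin0 sub0r sqrrN. Qed.

Let r0 : 0 < r. Proof. exact: rad_gt0. Qed.

Let ReJ : complex.Re (herglotz_deriv h z) = \int[mu]_(t in @angles R) (kerRe x y t * ln (h t)).
Proof.
apply: eq_Rintegral => t _; rewrite -(Re_deriv_kernel xy1).
by case: (_ / _) => a b /=; rewrite mulr0 subr0.
Qed.

Let ImJ : complex.Im (herglotz_deriv h z) = \int[mu]_(t in @angles R) (kerIm x y t * ln (h t)).
Proof.
apply: eq_Rintegral => t _; rewrite -(Im_deriv_kernel xy1).
by case: (_ / _) => a b /=; rewrite mulr0 add0r.
Qed.

Let err_of (F K : R -> R) (J : R) : `|F pi| <= (Num.sqrt (den pi))^-1 ->
  `|J + g (r / 2) * F 0 - ln 2 * F pi| <= (2 + pi) / Num.sqrt (r * d) ->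
  `|J + g (r / 2) * F 0| <= e.
Proof.
move=> FB H.
have -> : J + g (r / 2) * F 0 = (J + g (r / 2) * F 0 - ln 2 * F pi) + ln 2 * F pi by ring.
apply: (le_trans (ler_normD _ _)); rewrite addrC /e; apply: lerD => //.
have l2 : 0 <= ln 2 :> R by rewrite ln_ge0// ler1n.
by rewrite normrM (ger0_norm l2) ler_wpM2l.
Qed.

Let errRe : `|complex.Re (herglotz_deriv h z) + g (r / 2) * primRe x y 0| <= e.
Proof.
rewrite ReJ; apply: err_of => //; first by case: (prim_bounds xy1 pi).
apply: kernel_log_formula => //.
- exact: is_derive_primRe.
- exact: continuous_kerRe.
- exact: continuous_primRe.
- by move=> t; case: (ker_bounds xy1 t).
- by move=> t; case: (prim_bounds xy1 t).
- by rewrite /primRe /den sinN cosN sinpi oppr0.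
Qed.

Let errIm : `|complex.Im (herglotz_deriv h z) + g (r / 2) * primIm x y 0| <= e.
Proof.
rewrite ImJ; apply: err_of => //; first by case: (prim_bounds xy1 pi).
apply: kernel_log_formula => //.
- exact: is_derive_primIm.
- exact: continuous_kerIm.
- exact: continuous_primIm.
- by move=> t; case: (ker_bounds xy1 t).
- by move=> t; case: (prim_bounds xy1 t).
- by rewrite /primIm /den sinN cosN sinpi oppr0.
Qed.

Let g0 : 0 <= g (r / 2).
Proof.
have H := rad_lt2 xy1; have pi2 := pi_ge2 R; have := r0 => ?.
apply: le_trans (hgap_ge_ln2 alpha_gt0 beta_gt0 (_ : 0 < r / 2) (_ : r / 2 <= pi)); [|lra|lra].
by rewrite ln_ge0// ler1n.
Qed.

Lemma normc_herglotz_deriv_le :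
  normc (herglotz_deriv h z) <= 2 * (g (r / 2) / r + e).
Proof.
apply: (le_trans (normc_le_ReIm _)).
have H (J F : R) : `|F| <= r^-1 -> `|J + g (r / 2) * F| <= e -> `|J| <= g (r / 2) / r + e.
  move=> Fr Je; have -> : J = (J + g (r / 2) * F) - g (r / 2) * F by ring.
  apply: (le_trans (ler_normB _ _)); rewrite addrC; apply: lerD => //.
  by rewrite normrM (ger0_norm g0) ler_wpM2l.
have [b1 b2] := prim_bounds xy1 0; rewrite den0 in b1 b2.
rewrite mulr_natl mulr2n; apply: lerD; [exact: H errRe|exact: H errIm].
Qed.

Lemma normc_herglotz_deriv_ge :
  g (r / 2) / r - 2 * e <= normc (herglotz_deriv h z).
Proof.
(* This is i/(1 - z), so its modulus is 1/r. *)
pose v := (primRe x y 0 +i* primIm x y 0)%C.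
have vr : normc v = r^-1.
  have D0 := den_gt0 xy1 0.
  have : normc v ^+ 2 = r^-1 ^+ 2.
    rewrite sqr_normc_ReIm /= -den0 exprVn sqr_sqrtr ?(ltW D0)//.
    transitivity (((cos 0 - x) ^+ 2 + (sin 0 - y) ^+ 2) / den 0 ^+ 2).
      by rewrite /primRe /primIm; field; rewrite gt_eqF.
    by rewrite -/(den 0); field; rewrite gt_eqF.
  by move/eqP; rewrite eqrXn2 ?normc_ge0 ?invr_ge0 ?(ltW r0)// => /eqP.
have H : normc (herglotz_deriv h z + (g (r / 2))%:C * v) <= 2 * e.
  apply: (le_trans (normc_le_ReIm _)); rewrite mulr_natl mulr2n; apply: lerD.
    move: errRe; rewrite /v; case: (herglotz_deriv h z) => a b /=.
    by rewrite mul0r subr0.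
  move: errIm; rewrite /v; case: (herglotz_deriv h z) => a b /=.
  by rewrite mul0r addr0.
have -> : g (r / 2) / r = normc ((g (r / 2))%:C * v).
  by rewrite normcM normc_real (ger0_norm g0) vr.
have := normc_triangle (herglotz_deriv h z + (g (r / 2))%:C * v) (- herglotz_deriv h z).
rewrite normc_opp addrAC subrr add0r; lra.
Qed.

End herglotz_deriv_bounds.

(** * Lower bound for the modulus on the side of the positive arc *)

Section log_modulus_lower.
Context {R : realType} (alpha beta x y : R)
  (alpha_gt0 : 0 < alpha) (alpha_lt1 : alpha < 1) (beta_gt0 : 0 < beta)
  (xy1 : x ^+ 2 + y ^+ 2 < 1).
Local Notation mu := (@lebesgue_measure R).
Local Notation h := (hbeta alpha beta).
Local Notation den := (den x y).
Local Notation poisson_ker := (poisson_ker x y).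
Local Notation r := (rad x y).
Local Notation d := (gap x y).
Local Notation g := (hgap alpha beta).
Implicit Types (t c : R).

Context (y0 : 0 < y) (ry : r <= 2 * y) (r4 : 4 * r < pi).

Let cis0 : cis 0 = 1 :> R[i].
Proof. by rewrite /cis cos0 sin0. Qed.

Let r0 : 0 < r. Proof. exact: rad_gt0. Qed.
Let d0 : 0 < d. Proof. exact: gap_gt0. Qed.

Let far t : 4 * r <= `|t| -> `|t| <= pi -> `|t| / 4 <= Num.sqrt (den t).
Proof.
move=> tr tpi.
have H := @normc_cisB_ge R t 0; rewrite subr0 cis0 in H.
have := normc_sub_ge (cis t - 1) ((x +i* y) - 1).
have -> : cis t - 1 - (x +i* y - 1) = cis t - (x +i* y) by ring.
have -> : normc (x +i* y - 1) = r.
  by rewrite -normc_opp opprB /rad /=; congr (Num.sqrt (_ + _)); rewrite sub0r sqrrN.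
have := H tpi; rewrite -[normc (cis t - (x +i* y))]/(Num.sqrt (den t)); lra.
Qed.

Let far_poisson t : 4 * r <= `|t| -> `|t| <= pi -> poisson_ker t <= 32 * d * (t ^+ 2)^-1.
Proof.
move=> tr tpi; have t0 : 0 < `|t| by have := r0; lra.
apply: (le_trans (poisson_le_sqr xy1 (_ : 0 < `|t| / 4) (far tr tpi))); first by lra.
rewrite expr_div_n real_normK ?num_real//.
by rewrite le_eqVlt; apply/orP; left; apply/eqP; field; rewrite -normr_gt0.
Qed.

(** This is where r <= 2y enters: for such t the point e^(it) is on or below the real axis while z
    is at height at least r/2 above it. *)
Let near_poisson t : - (4 * r) <= t -> t <= 0 -> poisson_ker t <= 8 * d / r ^+ 2.
Proof.
move=> tr t0; have rr := r0; have r4' := r4; have ry' := ry.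
have st : sin t <= 0.
  by rewrite -oppr_ge0 -sinN sin_ge0_pi// oppr_ge0 t0/=; lra.
have H : r / 2 <= Num.sqrt (den t).
  have y2 : 0 <= y by exact: ltW.
  apply: (@le_trans _ _ (y - sin t)); first by lra.
  rewrite -[leLHS]ger0_norm; last by lra.
  rewrite -sqrtr_sqr ler_sqrt ?addr_ge0 ?sqr_ge0//.
  by rewrite -[(y - sin t) ^+ 2]sqrrN opprB /den lerDr sqr_ge0.
apply: (le_trans (poisson_le_sqr xy1 _ H)); first by lra.
by rewrite le_eqVlt; apply/orP; left; apply/eqP; field; rewrite gt_eqF.
Qed.

Let integral_inv_sqr a b : a < b -> (0 < a \/ b < 0) ->
  mu.-integrable `]a, b] (EFin \o (fun t => (t ^+ 2)^-1)) /\
  \int[mu]_(t in `]a, b]) (t ^+ 2)^-1 = a^-1 - b^-1.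
Proof.
move=> ab ab0.
have n0 t : a <= t <= b -> t != 0.
  move=> /andP[at_ tb]; case: ab0 => H; first by rewrite gt_eqF// (lt_le_trans H).
  by rewrite lt_eqF// (le_lt_trans tb).
have dq t : a <= t <= b -> is_derive t 1 (fun u : R => - u^-1) ((t ^+ 2)^-1).
  move=> tab.
  have dV := is_derive1N (is_derive1V (f := id) (n0 t tab) (is_derive_id t 1)).
  by apply: (is_derive_eq dV); rewrite mulN1r opprK.
have cq t : a <= t <= b -> {for t, continuous (fun u : R => (u ^+ 2)^-1)}.
  move=> tab.
  have dX := is_derive1M (is_derive_id t 1) (is_derive_id t 1).
  have nn0 : t * t != 0 by rewrite mulf_neq0// n0.
  have -> : (fun u : R => (u ^+ 2)^-1) = (fun u => (u * u)^-1) by apply/funext => u; rewrite expr2.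
  exact: (is_derive_continuous (is_derive1V (f := fun u => u * u) nn0 dX)).
split; first exact: continuous_on_integrable_oc.
by rewrite (FTC2_on_oc ab dq cq); ring.
Qed.

(** With p = 4r, compare ln h with ln h(p). On the arc from 0 to p the difference is non-negative;
    elsewhere it is at least -g(p). The kernel is at most 32 d/t^2 for |t| >= p, which costs 8 g d/r
    on each side, and at most 8 d/r^2 on the arc from -p to 0, which costs 32 g d/r. The sum is
    48. *)
Lemma poisson_log_lower :
  2 * pi * ln (h (4 * r)) - 48 * (g (4 * r) * (d / r)) <=
  \int[mu]_(t in @angles R) (poisson_ker t * ln (h t)).
Proof.
set p := 4 * r.
have p0 : 0 < p by rewrite mulr_gt0.
have rr := r0; have r4' : p < pi := r4; have pi2 := pi_ge2 R.
have ppi : p <= pi by exact: ltW.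
have g0 : 0 <= g p.
  by apply: le_trans (hgap_ge_ln2 alpha_gt0 beta_gt0 p0 ppi); rewrite ln_ge0// ler1n.
have int := integrable_poisson_mul alpha_gt0 beta_gt0 xy1 (ln (h p)); rewrite /angles in int.
suff : - (48 * (g p * (d / r))) <= \int[mu]_(t in @angles R) (poisson_ker t * (ln (h t) - ln (h p))).
  by rewrite Rintegral_poisson_sub//; lra.
have p_ge0 := poisson_ge0 xy1.
(* This says that h never falls below [h pi / 2], its constant value on the negative arc. *)
have low t : t <= pi -> - g p <= ln (h t) - ln (h p).
  move=> tpi; rewrite /hgap opprB lerD2r; have [t0|t0] := leP t 0.
    by rewrite (hbeta_le0 _ _ t0).
  have := ln_hbeta_le alpha_gt0 beta_gt0 t0 tpi (lexx _).
  by rewrite ln_hbeta_pi2//; have : 0 <= ln 2 :> R by [rewrite ln_ge0// ler1n]; lra.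
rewrite /angles (@Rintegral_oc_split _ _ (- pi) (- p) pi)//; [|lra|lra].
rewrite (@Rintegral_oc_split _ _ (- p) 0 pi); [|lra|lra|by apply: integrable_oc_sub int; lra].
rewrite (@Rintegral_oc_split _ _ 0 p pi)//; [|lra|by apply: integrable_oc_sub int; lra].
have tail a b : a < b -> (0 < a \/ b < 0) -> a^-1 - b^-1 <= p^-1 -> - pi <= a -> b <= pi ->
    (forall t, a < t -> t <= b -> p <= `|t| /\ `|t| <= pi) ->
    - (32 * g p * d) * p^-1 <= \int[mu]_(t in `]a, b]) (poisson_ker t * (ln (h t) - ln (h p))).
  move=> ab ab0 abp api bpi tb.
  have [i1 i2] := integral_inv_sqr ab ab0.
  have c0 : - (32 * g p * d) <= 0 by rewrite oppr_le0 !mulr_ge0 ?(ltW d0).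
  have mI : measurable (`]a, b] : set (measurableTypeR R)) by exact: measurable_itv.
  apply: (@le_trans _ _ (\int[mu]_(t in `]a, b]) (- (32 * g p * d) * (t ^+ 2)^-1))).
    by rewrite RintegralZl// i2 ler_wnM2l.
  apply: le_Rintegral => //.
  - by apply: (eq_integrable mI _ _ _ (integrableZl mI (- (32 * g p * d)) i1)).
  - by apply: integrable_oc_sub int.
  - move=> t; rewrite /= in_itv/= => /andP[at_ tb']; have [t1 t2] := tb t at_ tb'.
    have H1 := far_poisson t1 t2.
    have H2 := low t (le_trans (ler_norm _) t2).
    have H3 : poisson_ker t * - g p <= poisson_ker t * (ln (h t) - ln (h p)) by rewrite ler_wpM2l.
    apply: le_trans H3; rewrite mulrN mulNr lerN2.
    rewrite (_ : 32 * g p * d * (t ^+ 2)^-1 = (32 * d * (t ^+ 2)^-1) * g p); last by ring.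
    by rewrite ler_wpM2r.
have I1 : - (32 * g p * d) * p^-1 <= \int[mu]_(t in `](- pi), (- p)]) (poisson_ker t * (ln (h t) - ln (h p))).
  apply: tail; [lra|by right; lra| |lra|lra|].
    by rewrite !invrN opprK gerDr oppr_le0 invr_ge0; lra.
  by move=> t t1 t2; rewrite ler0_norm; lra.
have I4 : - (32 * g p * d) * p^-1 <= \int[mu]_(t in `]p, pi]) (poisson_ker t * (ln (h t) - ln (h p))).
  apply: tail; [lra|by left| |lra|lra|].
    by rewrite gerDl oppr_le0 invr_ge0; lra.
  by move=> t t1 t2; rewrite gtr0_norm; lra.
have I2 : - (g p * (8 * d / r ^+ 2)) * (0 - - p) <=
    \int[mu]_(t in `](- p), 0]) (poisson_ker t * (ln (h t) - ln (h p))).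
  apply: Rintegral_oc_ge; [lra|by apply: integrable_oc_sub int; lra|].
  move=> t t1 t2; have H1 := near_poisson (ltW t1) t2.
  have H3 : poisson_ker t * - g p <= poisson_ker t * (ln (h t) - ln (h p)).
    by rewrite ler_wpM2l// low//; lra.
  by apply: le_trans H3; rewrite mulrN lerN2 mulrC ler_wpM2l.
have I3 : 0 * (p - 0) <= \int[mu]_(t in `]0, p]) (poisson_ker t * (ln (h t) - ln (h p))).
  apply: Rintegral_oc_ge; [lra|by apply: integrable_oc_sub int; lra|].
  by move=> t t1 t2; rewrite mulr_ge0// subr_ge0; apply: ln_hbeta_le.
have E1 : - (32 * g p * d) * p^-1 = - (8 * (g p * (d / r))).
  by rewrite /p; field; rewrite gt_eqF.
have E2 : - (g p * (8 * d / r ^+ 2)) * (0 - - p) = - (32 * (g p * (d / r))).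
  by rewrite /p; field; rewrite gt_eqF.
rewrite E1 in I1 I4; rewrite E2 in I2; rewrite mul0r in I3.
have -> : - (48 * (g p * (d / r))) = - (8 * (g p * (d / r))) + (- (32 * (g p * (d / r))) +
  (0 + - (8 * (g p * (d / r))))) by ring.
by rewrite lerD// lerD// lerD.
Qed.

Lemma normc_outer_lower :
  expR (ln (h (4 * r)) - 12 * (g (4 * r) * (d / r))) <= normc (outer h (x +i* y)).
Proof.
rewrite normc_outer ler_expR.
have pi0 := pi_gt0 R; have pi2 := pi_ge2 R.
rewrite [leRHS]mulrC ler_pdivlMr ?mulr_gt0//.
have -> : \int[mu]_(t in @angles R) complex.Re ((cis t + (x +i* y)) / (cis t - (x +i* y)) *
    (ln (h t))%:C) = \int[mu]_(t in @angles R) (poisson_ker t * ln (h t)).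
  apply: eq_Rintegral => t _; rewrite -(Re_herglotz_kernel xy1).
  by case: (_ / _) => a b /=; rewrite mulr0 subr0.
apply: le_trans poisson_log_lower.
have g0 : 0 <= g (4 * r).
  apply: le_trans (hgap_ge_ln2 alpha_gt0 beta_gt0 _ (ltW r4)); last by rewrite mulr_gt0.
  by rewrite ln_ge0// ler1n.
have : 0 <= g (4 * r) * (d / r) by rewrite mulr_ge0// divr_ge0 ?(ltW r0) ?(ltW d0).
move: (g (4 * r) * (d / r)) (ln (h (4 * r))) => A B A0.
rewrite mulrBl [B * _]mulrC lerD2l lerN2.
have := ler_wpM2l A0 pi2; lra.
Qed.

End log_modulus_lower.

(** * Lower bound for the Dirichlet density in a thin strip *)

Section dirichlet_lower.
Context {R : realType} (alpha beta : R)
  (alpha_gt0 : 0 < alpha) (alpha_lt1 : alpha < 1) (beta_gt0 : 0 < beta).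
Local Notation h := (hbeta alpha beta).
Local Notation L := (loginv alpha beta).
Local Notation g := (hgap alpha beta).
Local Notation kap := (2 * beta / alpha).
Implicit Types (x y t : R).

Definition dirichlet_density (p : R * R) : R :=
  normc (complex_deriv (outer h) (of_plane p)) ^+ 2 * (1 - normc (of_plane p)) `^ alpha.

Lemma dirichlet_densityE x y : x ^+ 2 + y ^+ 2 < 1 ->
  dirichlet_density (x, y) = normc (outer h (x +i* y)) ^+ 2 *
    (normc (herglotz_deriv h (x +i* y)) ^+ 2 / pi ^+ 2) * gap x y `^ alpha.
Proof.
move=> xy1; rewrite /dirichlet_density -[of_plane (x, y)]/(x +i* y).
rewrite outer_complex_deriv; last first.
- by rewrite /= -sqrtr1 ltr_sqrt.
- exact: integrable_ln_hbeta.
rewrite -[1 - normc (x +i* y)]/(gap x y).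
move: (outer h _) (herglotz_deriv h _) => o J.
rewrite 2!normcM normc_real ger0_norm ?invr_ge0 ?pi_ge0//; congr (_ * _).
by rewrite exprMn; congr (_ * _); rewrite exprMn mulrC; congr (_ * _); rewrite exprVn.
Qed.

Lemma near0_loginv_ge (K : R) : exists2 y0 : R, 0 < y0 & forall y, 0 < y -> y < y0 -> K <= L y.
Proof.
exists (pi * expR (kap - K)) => [|y y0 yK]; first by rewrite mulr_gt0 ?pi_gt0 ?expR_gt0.
rewrite loginvE//; move: yK; rewrite -ltr_ln ?posrE ?mulr_gt0 ?pi_gt0 ?expR_gt0//.
by rewrite lnM ?posrE ?pi_gt0 ?expR_gt0// expRK; lra.
Qed.

(** The strip lies at horizontal distance between b/2 and b from the circle, with b = y/L(y). Since
    1 - |z|^2 = (X - x)(X + x) with X = sqrt(1 - y^2), the distance to the circle is comparable to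
    b, and |1 - z| is comparable to y. *)
Let strip_geometry x y : 0 < y -> y < 1 / 100 -> 4 <= L y ->
  y / L y / 2 < Num.sqrt (1 - y ^+ 2) - x -> Num.sqrt (1 - y ^+ 2) - x < y / L y ->
  [/\ x ^+ 2 + y ^+ 2 < 1, y <= rad x y, rad x y <= 2 * y,
      y / L y / 4 <= gap x y & gap x y <= 2 * (y / L y)] /\ 0 < x.
Proof.
move=> y0 y1 L4; set X := Num.sqrt _; set b := y / L y => bx xb.
have L0 : 0 < L y by lra.
have b0 : 0 < b by rewrite divr_gt0.
have b4 : b <= y / 4 by rewrite ler_wpM2l ?(ltW y0)// lef_pV2 ?posrE.
have y2 : y ^+ 2 <= y / 100 by nra.
have X2 : X ^+ 2 = 1 - y ^+ 2 by rewrite sqr_sqrtr//; nra.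
have X0 : 0 <= X by exact: sqrtr_ge0.
have X1 : X <= 1 by nra.
have Xy : 1 - y ^+ 2 <= X by nra.
have x0 : 0 < x by nra.
have xX : x < X by lra.
have xy : x ^+ 2 + y ^+ 2 < 1 by nra.
have x1 : 1 - x <= y by nra.
have x1' : 0 <= 1 - x by lra.
have yr : y <= rad x y.
  rewrite -[leLHS]ger0_norm ?(ltW y0)// -sqrtr_sqr ler_sqrt ?lerDr ?sqr_ge0//.
  by rewrite addr_ge0 ?sqr_ge0.
have ry : rad x y <= 2 * y.
  rewrite -[leRHS]ger0_norm; last by lra.
  by rewrite -sqrtr_sqr ler_sqrt ?sqr_ge0//; nra.
have /andP[g1 g2] := gap_sqr xy.
have E : 1 - (x ^+ 2 + y ^+ 2) = (X - x) * (X + x) by rewrite -subr_sqr X2; ring.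
rewrite E in g1 g2.
by split=> //; split => //; nra.
Qed.

Let ln_hbeta_octuple y t : 8 * y <= pi -> 0 < t -> t <= 8 * y ->
  ln (h y) - alpha / 2 * ln 8 <= ln (h t).
Proof.
move=> y8 t0 ty.
have y0 : 0 < y by lra.
have yy : y <= 8 * y by lra.
apply: le_trans (ln_hbeta_le alpha_gt0 beta_gt0 t0 ty y8).
have := ln_hbeta_sub_le alpha_gt0 beta_gt0 y0 yy y8.
have -> : ln (8 * y) = ln 8 + ln y by rewrite lnM ?posrE.
rewrite addrK; lra.
Qed.

(** In the strip g is of order L and d/r of order 1/L, so the exponential loss is bounded and |O| is
    at least a multiple of h(y). The main term of the logarithmic derivative, of order L/y, beats
    the errors, of order 1 and sqrt(L)/y. With d of order y/L the powers combine to y^(-2) L^(2 -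
    alpha - 2 beta). *)
Lemma dirichlet_density_lower : exists2 c, 0 < c & exists2 y0 : R, 0 < y0 < 1 / 100 &
  forall x y, 0 < y -> y < y0 ->
    y / L y / 2 < Num.sqrt (1 - y ^+ 2) - x -> Num.sqrt (1 - y ^+ 2) - x < y / L y ->
    x ^+ 2 + y ^+ 2 < 1 /\
    c * (y `^ (- 2) * L y `^ (2 - alpha - 2 * beta)) <= dirichlet_density (x, y).
Proof.
have [cg cg0 cgL] := hgap_ge alpha_gt0 beta_gt0.
pose Cg := alpha / 2 + ln 2 / kap.
have kap0 : 0 < kap by rewrite divr_gt0// mulr_gt0.
have l2 : 0 <= ln 2 :> R by rewrite ln_ge0// ler1n.
have Cg0 : 0 < Cg by rewrite ltr_pwDl ?divr_gt0// divr_ge0// ltW.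
have pi2 := pi_ge2 R; have pi0 := pi_gt0 R.
pose q := 32 * (2 + pi) / cg.
have q0 : 0 < q by rewrite divr_gt0// mulr_gt0//; lra.
(* The 4 is for the geometry of the strip. The term 16/cg makes cg L/(16 y) at least 1, hence at
   least the contribution of the jump at -1. The term q^2 gives sqrt(L) >= q, which brings the error
   of order (r d)^(-1/2) below cg L/(16 y) too. *)
have [yL yL0 HL] := near0_loginv_ge (4 + 16 / cg + q ^+ 2).
(* 24 Cg is the factor 12 of [normc_outer_lower] times the bound 2 Cg for g d/r; ln 8 is the price
   of replacing h(4r) by h(y), as 4r <= 8y. *)
pose c1 := expR (- (24 * Cg) - (alpha / 2) * ln 8).
pose c := c1 ^+ 2 * ((cg / 4) ^+ 2 / pi ^+ 2) * 4 `^ (- alpha).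
exists c; first by rewrite !mulr_gt0 ?invr_gt0 ?exprn_gt0 ?powR_gt0 ?expR_gt0 ?divr_gt0.
exists (Num.min yL (1 / 101)).
  by apply/andP; split; [rewrite lt_min yL0; lra|rewrite gt_min; apply/orP; right; lra].
move=> x y y0; rewrite lt_min => /andP[yyL y101] bx xb.
have y100 : y < 1 / 100 by lra.
have LK := HL y y0 yyL.
have i16 : 0 < 16 / cg by rewrite divr_gt0.
have L4 : 4 <= L y by have := sqr_ge0 q; lra.
have [[xy yr ry d1 d2] x0] := strip_geometry y0 y100 L4 bx xb.
split => //; rewrite dirichlet_densityE//.
have L0 : 0 < L y by lra.
have r0 := rad_gt0 xy; have d0 := gap_gt0 xy.
set r := rad x y in yr ry r0 *; set d := gap x y in d0 d1 d2 *.
have ypi : y <= pi by lra.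
have O_ge : c1 * h y <= normc (outer h (x +i* y)).
  have r4 : 4 * r < pi by lra.
  apply: le_trans (normc_outer_lower alpha_gt0 beta_gt0 xy y0 ry r4).
  rewrite (hbeta_expR alpha_gt0 beta_gt0 ypi) /c1 -expRD ler_expR -/r -/d.
  have H1 : g (4 * r) * (d / r) <= 2 * Cg.
    have g1 : g (4 * r) <= Cg * L y.
      apply: le_trans (hgap_le alpha_gt0 beta_gt0 _ (ltW r4)) _; first by lra.
      by rewrite ler_wpM2l ?(ltW Cg0)//; apply: loginv_le => //; lra.
    have s1 : d / r <= 2 / L y.
      rewrite ler_pdivrMr//; apply: (le_trans d2).
      have -> : 2 * (y / L y) = 2 / L y * y by ring.
      by rewrite ler_wpM2l// divr_ge0// ltW.
    have g0 : 0 <= g (4 * r).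
      by apply: le_trans (hgap_ge_ln2 alpha_gt0 beta_gt0 _ (ltW r4)) => //; lra.
    apply: (le_trans (ler_pM g0 _ g1 s1)); first by apply: divr_ge0; exact: ltW.
    by rewrite le_eqVlt; apply/orP; left; apply/eqP; field; rewrite gt_eqF.
  have r40 : 0 < 4 * r by rewrite mulr_gt0.
  have r48 : 4 * r <= 8 * y by lra.
  have ypi' : 8 * y <= pi by lra.
  have H2 : ln (h y) - alpha / 2 * ln 8 <= ln (h (4 * r)).
    exact: ln_hbeta_octuple ypi' r40 r48.
  lra.
have J_ge : cg / 4 * (L y / y) <= normc (herglotz_deriv h (x +i* y)).
  apply: le_trans (normc_herglotz_deriv_ge alpha_gt0 alpha_lt1 beta_gt0 xy).
  rewrite -/r -/d.
  have y0' : 0 <= y^-1 by rewrite invr_ge0 ltW.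
  have A1 : cg * L y / (2 * y) <= g (r / 2) / r.
    have B1 : cg * L y <= g (r / 2).
      apply: le_trans (cgL (r / 2) _ _); [|lra|lra].
      by rewrite ler_wpM2l ?(ltW cg0)//; apply: loginv_le; lra.
    apply: ler_pM => //; first by rewrite mulr_ge0 ?ltW.
      by rewrite invr_ge0 mulr_ge0// ltW.
    by rewrite lef_pV2 ?posrE// mulr_gt0.
  have A2 : ln 2 / Num.sqrt (den x y pi) <= 1.
    have d1' : 1 <= Num.sqrt (den x y pi).
      rewrite -[leLHS]sqrtr1 ler_sqrt; last by apply: addr_ge0; exact: sqr_ge0.
      by rewrite /den cospi sinpi; have := sqr_ge0 (0 - y); nra.
    rewrite ler_pdivrMr; last by lra.
    have := @le_ln1Dx R 1 ltac:(lra); rewrite (_ : 1 + 1 = 2)//; lra.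
  pose sL := Num.sqrt (L y).
  have sL2 : sL ^+ 2 = L y by rewrite sqr_sqrtr// ltW.
  have sL0 : 0 < sL by rewrite sqrtr_gt0.
  have sLq : q <= sL.
    rewrite -[leLHS]ger0_norm ?(ltW q0)// -sqrtr_sqr ler_sqrt ?(ltW L0)//; lra.
  have A3 : (2 + pi) / Num.sqrt (r * d) <= (2 + pi) * (2 * sL / y).
    rewrite ler_wpM2l//; first by lra.
    have -> : 2 * sL / y = (y / (2 * sL))^-1 by rewrite invf_div.
    have S0 : 0 < y / (2 * sL) by rewrite divr_gt0// mulr_gt0.
    rewrite lef_pV2 ?posrE ?sqrtr_gt0 ?(mulr_gt0 r0 d0)//.
    rewrite -[leLHS]ger0_norm ?(ltW S0)// -sqrtr_sqr ler_sqrt; last by rewrite mulr_ge0 ?ltW.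
    have -> : (y / (2 * sL)) ^+ 2 = y * (y / L y / 4).
      by rewrite -sL2; field; rewrite gt_eqF.
    by apply: ler_pM => //; [exact: ltW|rewrite !divr_ge0// ltW].
  have A4 : (2 + pi) * (2 * sL / y) <= cg * L y / (16 * y).
    have qE : 2 + pi = q * cg / 32 by rewrite /q; field; rewrite gt_eqF.
    rewrite qE -sL2.
    have -> : cg * sL ^+ 2 / (16 * y) = sL * (sL * (cg / (16 * y))) by field; rewrite gt_eqF.
    have -> : q * cg / 32 * (2 * sL / y) = q * (sL * (cg / (16 * y))) by field; rewrite gt_eqF.
    by rewrite ler_wpM2r// mulr_ge0 ?(ltW sL0)// divr_ge0 ?(ltW cg0)// mulr_ge0// ltW.
  have A5 : 1 <= cg * L y / (16 * y).
    have L16 : 16 <= cg * L y.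
      rewrite mulrC -ler_pdivrMr//; have := sqr_ge0 q; lra.
    rewrite ler_pdivlMr ?mulr_gt0//; lra.
  have -> : cg / 4 * (L y / y) = cg * L y / (2 * y) - 2 * (cg * L y / (16 * y) + cg * L y / (16 * y)).
    by field; rewrite gt_eqF.
  apply: lerB => //; rewrite ler_pM2l//; apply: lerD; first exact: le_trans A5.
  exact: le_trans A4.
have hy0 := hbeta_gt0 alpha_gt0 beta_gt0 ypi.
have c10 : 0 < c1 by exact: expR_gt0.
have d_ge : 4 `^ (- alpha) * (y `^ alpha * L y `^ (- alpha)) <= d `^ alpha.
  apply: (@le_trans _ _ ((y / L y / 4) `^ alpha)).
    rewrite powRM ?invr_ge0 ?divr_ge0 ?(ltW y0) ?(ltW L0)//.
    rewrite powRM ?invr_ge0 ?(ltW y0) ?(ltW L0)//.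
    rewrite -!powR_inv1 ?(ltW L0)// -!powRrM !mulN1r.
    by rewrite mulrC.
  by apply: ge0_ler_powR; rewrite ?nnegrE ?(ltW alpha_gt0) ?(ltW d0) ?divr_ge0 ?(ltW y0) ?(ltW L0).
have E : y `^ (- 2) * L y `^ (2 - alpha - 2 * beta) =
    h y ^+ 2 * (L y / y) ^+ 2 * (y `^ alpha * L y `^ (- alpha)).
  rewrite sqr_hbeta// expr_div_n.
  have -> : 2 - alpha - 2 * beta = - (2 * beta) + 2 + - alpha by ring.
  rewrite powRD; last by rewrite (gt_eqF L0) implybT.
  rewrite powRD; last by rewrite (gt_eqF L0) implybT.
  have ya : y `^ (- alpha) * y `^ alpha = 1 by rewrite powRN mulVf// gt_eqF// powR_gt0.
  rewrite powRN !powR_mulrn ?(ltW y0) ?(ltW L0)//.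
  rewrite (powRN y 2) powR_mulrn ?(ltW y0)// -[LHS]mulr1 -ya; ring.
rewrite E /c.
have -> : c1 ^+ 2 * ((cg / 4) ^+ 2 / pi ^+ 2) * 4 `^ (- alpha) *
    (h y ^+ 2 * (L y / y) ^+ 2 * (y `^ alpha * L y `^ (- alpha))) =
    (c1 * h y) ^+ 2 * ((cg / 4 * (L y / y)) ^+ 2 / pi ^+ 2) *
    (4 `^ (- alpha) * (y `^ alpha * L y `^ (- alpha))) by ring.
have cL0 : 0 <= cg / 4 * (L y / y) by rewrite mulr_ge0 ?divr_ge0 ?(ltW cg0) ?(ltW L0) ?(ltW y0).
apply: ler_pM => //.
- by rewrite mulr_ge0 ?divr_ge0 ?exprn_ge0 ?pi_ge0// mulr_ge0 ?(ltW c10) ?(ltW hy0).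
- by rewrite !mulr_ge0 ?powR_ge0.
- apply: ler_pM.
  + by rewrite exprn_ge0// mulr_ge0 ?(ltW c10) ?(ltW hy0).
  + by rewrite divr_ge0 ?exprn_ge0 ?pi_ge0.
  + by rewrite lerXn2r ?nnegrE ?normc_ge0// mulr_ge0 ?(ltW c10) ?(ltW hy0).
  + by rewrite ler_wpM2r ?invr_ge0 ?exprn_ge0 ?pi_ge0// lerXn2r ?nnegrE ?normc_ge0.
Qed.

End dirichlet_lower.

(** * Planar integrals by horizontal slices *)

Section plane_integrals.
Context {R : realType}.
Local Notation mu := (@lebesgue_measure R).
Local Notation disk := ((@of_plane R) @^-1` (@unit_disk R)).
Implicit Types (x y : R) (D : set (R * R)).

Lemma diskE x y : disk (x, y) = (x ^+ 2 + y ^+ 2 < 1).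
Proof.
rewrite /unit_disk /of_plane /=; apply/propext; split => [|xy].
  by rewrite -[X in _ < X -> _]sqrtr1 ltr_sqrt.
by rewrite -sqrtr1 ltr_sqrt.
Qed.

Lemma measurable_fun_sqrt d (T : measurableType d) (D : set T) (f : T -> R) :
  measurable_fun D f -> measurable_fun D (fun t => Num.sqrt (f t)).
Proof.
move=> mf; apply: (@measurableT_comp _ _ _ _ _ _ (@Num.sqrt R)) => //.
by apply: continuous_measurable_fun; exact: sqrt_continuous.
Qed.

Lemma measurable_lt d (T : measurableType d) (f g : T -> R) :
  measurable_fun setT f -> measurable_fun setT g -> measurable [set t | f t < g t].
Proof.
move=> mf mg; have := measurable_fun_ltr mf mg measurableT (_ : measurable [set true]).
by rewrite setTI => /(_ ltac:(by [])).
Qed.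

Lemma ge0_plane_integralE (g : R * R -> R) (E : set (R * R)) :
  measurable E -> measurable_fun setT g -> (forall p, 0 <= g p) ->
  (\int[mu \x mu]_(p in E) (g p)%:E =
   \int[mu]_y \int[mu]_(x in [set x | E (x, y)]) (g (x, y))%:E)%E.
Proof.
move=> mE mg g0.
have -> : (\int[mu \x mu]_(p in E) (g p)%:E =
    \int[mu]_y fubini_G mu ((fun p => (g p)%:E) \_ E) y)%E.
  rewrite integral_mkcond; apply: fubini_tonelli2.
    by apply/(measurable_restrictT _ mE); apply: measurable_funTS; apply/measurable_EFinP.
  by move=> p; rewrite patchE; case: ifP => // _; rewrite lee_fin.
apply: (@eq_integral _ (measurableTypeR R) R mu) => y _.
rewrite /fubini_G [RHS]integral_mkcond; apply: (@eq_integral _ (measurableTypeR R) R mu) => x _.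
rewrite /patch; congr (if _ then _ else _).
Qed.

Lemma ge0_plane_integral_ge D (f g : R * R -> R) (E : set (R * R)) :
  measurable E -> measurable_fun setT g -> (forall p, 0 <= g p) ->
  (forall p, D p -> 0 <= f p) -> E `<=` D -> (forall p, E p -> g p <= f p) ->
  (\int[mu]_y \int[mu]_(x in [set x | E (x, y)]) (g (x, y))%:E <=
   \int[mu \x mu]_(p in D) (f p)%:E)%E.
Proof.
move=> mE mg g0 f0 ED gf.
apply: le_trans (_ : (\int[mu \x mu]_(p in E) (f p)%:E <= _)%E); last first.
  by apply: ge0_subset_integral_nonmeas => // p Dp; rewrite lee_fin f0.
rewrite -ge0_plane_integralE//.
by apply: ge0_le_integral_nonmeas => p Ep; rewrite lee_fin ?g0 ?gf.
Qed.

(** The coordinate axes form a null set, and reflection in each of them costs a factor 2, which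
    reduces the disk to its first quadrant. Measurability is asked of the majorant only. *)
Lemma ge0_disk_integral_le (f : R * R -> R) (Phi : R * R -> R) (W : R -> R) :
  measurable_fun setT Phi -> (forall p, 0 <= Phi p) ->
  (forall p, 0 <= f p) ->
  (forall x y, x != 0 -> y != 0 -> x ^+ 2 + y ^+ 2 < 1 -> f (x, y) <= Phi (`|x|, `|y|)) ->
  (forall y, 0 < y -> y < 1 -> 
    (\int[mu]_(x in `]0%R, Num.sqrt (1 - y ^+ 2)[) (Phi (x, y))%:E <= (W y)%:E)%E) ->
  measurable_fun [set: R] W ->
  (\int[mu \x mu]_(p in disk) (f p)%:E <= 4%:E * \int[mu]_(y in `]0%R, 1%R[) (W y)%:E)%E.
Proof.
move=> mPhi Phi0 f0 fPhi W_le mW.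
pose N := ([set 0 : R] `*` [set: R]) `|` ([set: R] `*` [set 0 : R]).
pose A := [set p : R * R | [/\ p.1 != 0, p.2 != 0 & p.1 ^+ 2 + p.2 ^+ 2 < 1]].
have mN0 : measurable ([set 0 : R] `*` [set: R]) by exact: measurableX.
have mN1 : measurable ([set: R] `*` [set 0 : R]) by exact: measurableX.
have mN : measurable N by exact: measurableU.
have N0 : (mu \x mu)%E N = 0%E.
  have Z1 : (mu \x mu)%E ([set 0 : R] `*` [set: R]) = 0%E.
    apply: etrans (product_measure1E _ _ _ _) _ => //.
    by rewrite [X in (X * _)%E](lebesgue_measure_set1 0) mul0e.
  have Z2 : (mu \x mu)%E ([set: R] `*` [set 0 : R]) = 0%E.
    apply: etrans (product_measure1E _ _ _ _) _ => //.
    by rewrite [X in (_ * X)%E](lebesgue_measure_set1 0) mule0.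
  by have := @measureU0 _ _ _ (mu \x mu)%E _ _ mN0 mN1 Z2 => ->; exact: Z1.
have neq0 (u : R * R -> R) : measurable_fun setT u -> measurable [set p | u p != 0].
  move=> mu; rewrite (_ : mkset _ = u @^-1` (~` [set 0])).
    by rewrite -[_ @^-1` _]setTI; apply: mu => //; exact: measurableC.
  by apply/seteqP; split => p /= /eqP.
have mA : measurable A.
  rewrite (_ : A = ([set p | p.1 != 0] `&` [set p | p.2 != 0]) `&`
      [set p | p.1 ^+ 2 + p.2 ^+ 2 < 1]); last first.
    by apply/seteqP; split => p /=; [case|case=> [[]]].
  apply: measurableI; first by apply: measurableI; apply: neq0.
  apply: measurable_lt => //; apply: measurable_funD; apply: measurable_funX => //.
have mPhi' : measurable_fun setT (fun p : R * R => Phi (`|p.1|, `|p.2|)).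
  apply: measurableT_comp => //; apply: measurable_fun_pair; exact: measurableT_comp.
apply: le_trans (_ : (\int[mu \x mu]_(p in A) (Phi (`|p.1|, `|p.2|))%:E <= _)%E).
  apply: le_trans (_ : (\int[mu \x mu]_(p in A) (f p)%:E <= _)%E).
    apply: (@ge0_integral_nullU_le _ _ R (mu \x mu)%E A N (fun p => (f p)%:E) disk mA mN N0) => [p _|[x y]]; first by rewrite lee_fin.
    rewrite diskE => xy; have [x0|x0] := eqVneq x 0; first by right; left.
    by have [y0|y0] := eqVneq y 0; [right; right|left].
  apply: ge0_le_integral_nonmeas => [p _|[x y] [/= x0 y0 xy]]; rewrite lee_fin//.
  exact: fPhi.
rewrite ge0_plane_integralE//.
pose V (y : R) := (2%:E * (W y)%:E)%E.
have W0 y : 0 < y -> y < 1 -> (0 <= (W y)%:E)%E.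
  by move=> y0 y1; apply: le_trans (W_le y y0 y1); apply: integral_ge0 => x _; rewrite lee_fin.
apply: le_trans (_ : (\int[mu]_(y in `](- 1)%R, 1%R[ `\ 0%R) V `|y|%R <= _)%E).
  rewrite [leRHS]integral_mkcond.
  apply: (@ge0_le_integral_nonmeas _ (measurableTypeR R) R mu) => y _.
    by apply: integral_ge0 => x _; rewrite lee_fin.
  rewrite patchE; case: ifPn => [/set_mem [/= y1 /eqP y0]|/negP yn].
    have {}y1 : 0 < `|y| < 1 by rewrite normr_gt0 y0/= ltr_norml.
    have /andP[y1' y1''] := y1; have := W_le _ y1' y1''; rewrite real_normK ?num_real//.
    set X := Num.sqrt _ => WX.
    apply: le_trans (_ : (\int[mu]_(x in `](- X)%R, X[ `\ 0%R) (Phi (`|x|, `|y|))%:E <= _)%E).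
      apply: (@ge0_subset_integral_nonmeas _ (measurableTypeR R) R mu).
        by move=> x _; rewrite lee_fin.
      move=> x [/= x0 _ xy]; split; last exact/eqP.
      rewrite /= in_itv/= -ltr_norml -sqrtr_sqr /X ltr_sqrt; first by lra.
      have := sqr_ge0 x; lra.
    apply: le_trans (ge0_integral_norm_le (f := fun x : R => (Phi (x, `|y|))%:E) _ _) _.
    - apply/measurable_EFinP; apply: measurable_funTS.
      by apply: measurableT_comp mPhi _; apply: measurable_fun_pair.
    - by move=> x _; rewrite lee_fin.
    - by rewrite lee_pmul2l.
  rewrite (_ : [set x | _] = set0) ?integral_set0//.
  apply/seteqP; split => // x [/= x0 y0 xy]; apply: yn; apply/mem_set; split; last exact/eqP.
  rewrite /= in_itv/= -ltr_norml -sqrtr_sqr -[ltRHS]sqrtr1 ltr_sqrt//.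
  have := sqr_ge0 x; lra.
apply: le_trans (ge0_integral_norm_le _ _) _.
- by apply: emeasurable_funM => //; apply/measurable_EFinP; apply: measurable_funTS.
- by move=> y /andP[y0 y1]; rewrite mule_ge0// W0.
rewrite /V ge0_integralZl//.
- by rewrite muleA -EFinM -natrM.
- by apply/measurable_EFinP; apply: measurable_funTS.
- by move=> y; rewrite /= in_itv/= => /andP[y0 y1]; exact: W0.
Qed.

End plane_integrals.

(** * Divergence of the Dirichlet integral below the threshold *)

Section dirichlet_necessary.
Context {R : realType} (alpha beta : R)
  (alpha_gt0 : 0 < alpha) (alpha_lt1 : alpha < 1) (beta_gt0 : 0 < beta).
Local Notation mu := (@lebesgue_measure R).
Local Notation L := (loginv alpha beta).
Local Notation disk := ((@of_plane R) @^-1` (@unit_disk R)).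

Lemma dirichlet_density_ge0 p : 0 <= dirichlet_density alpha beta p.
Proof. by rewrite mulr_ge0 ?powR_ge0// sqr_ge0. Qed.

Lemma measurable_loginv d (T : measurableType d) (D : set T) (f : T -> R) :
  measurable_fun D f -> measurable_fun D (fun t => L (f t)).
Proof.
move=> mf; apply: measurable_fun_ln; apply: measurable_funM => //.
by apply: (@measurableT_comp _ _ _ _ _ _ (fun t : R => t^-1)) => //; exact: measurable_invr.
Qed.

Lemma measurable_fun_divr d (T : measurableType d) (D : set T) (f g : T -> R) :
  measurable_fun D f -> measurable_fun D g -> measurable_fun D (fun t => f t / g t).
Proof.
move=> mf mg; apply: measurable_funM => //.
by apply: (@measurableT_comp _ _ _ _ _ _ (fun t : R => t^-1)) => //; exact: measurable_invr.
Qed.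

(** By contraposition. The slice of the strip at height y has length y/(2 L(y)), so integrating the
    lower bound in x leaves a multiple of y^(-1) L^(-q) with q = 2 beta + alpha - 1, which is at
    most 1 when the inequality fails. *)
Lemma dirichlet_density_lt_pinfty :
  (\int[mu \x mu]_(p in disk) (dirichlet_density alpha beta p)%:E < +oo)%E ->
  1 - 2^-1 * alpha < beta.
Proof.
apply: contraTT; rewrite -leNgt -leNgt => ba.
have [c c0 [y0 /andP[y00 y01] lower]] := dirichlet_density_lower alpha_gt0 alpha_lt1 beta_gt0.
have pi2 := pi_ge2 R.
pose q := 2 * beta + alpha - 1.
have q1 : q <= 1 by rewrite /q; lra.
pose X (p : R * R) := Num.sqrt (1 - p.2 ^+ 2) - p.1.
pose b (p : R * R) := p.2 / L p.2.
pose G (y : R) := c * (y `^ (- 2) * L y `^ (2 - alpha - 2 * beta)).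
have G0 y : 0 <= G y by rewrite mulr_ge0 ?(ltW c0)// mulr_ge0 ?powR_ge0.
pose E := [set p : R * R | 0 < p.2] `&` [set p | p.2 < y0] `&`
  [set p | b p / 2 < X p] `&` [set p | X p < b p].
have mX : measurable_fun setT X.
  apply: measurable_funB => //; apply: measurable_fun_sqrt.
  by apply: measurable_funB => //; exact: measurable_funX.
have mb : measurable_fun setT b.
  by apply: measurable_fun_divr => //; exact: measurable_loginv.
have mG : measurable_fun setT (fun p : R * R => G p.2).
  apply: measurable_funM => //; apply: measurable_funM; apply: measurable_fun_powRl => //.
  exact: measurable_loginv.
have mE : measurable E.
  apply: measurableI; last exact: measurable_lt.
  apply: measurableI; last by apply: measurable_lt => //; exact: measurable_funM.
  by apply: measurableI; apply: measurable_lt.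
have EP x y : E (x, y) -> x ^+ 2 + y ^+ 2 < 1 /\ G y <= dirichlet_density alpha beta (x, y).
  by move=> [[[/= y1 y2] xy1] xy2]; exact: lower.
have I := @ge0_plane_integral_ge R disk (dirichlet_density alpha beta) (fun p => G p.2) E mE mG.
apply: le_trans (I _ _ _ _); last first.
- by move=> [x y] /EP[].
- by move=> [x y] /EP[? _]; rewrite diskE.
- by move=> p _; exact: dirichlet_density_ge0.
- by move=> p; exact: G0.
apply: le_trans (_ : \int[mu]_(y in `]0%R, y0[) (c / 2 * (y^-1 * L y `^ (- q)))%:E <= _)%E.
  have -> : (fun y : R => (c / 2 * (y^-1 * L y `^ (- q)))%:E) =
      (fun y => (c / 2)%:E * (y^-1 * L y `^ (- q))%:E)%E by [].
  rewrite ge0_integralZl_EFin//.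
  - rewrite integral_loginv_pinfty//; last by lra.
    by rewrite gt0_muley// lte_fin divr_gt0.
  - move=> y; rewrite /= in_itv/= => /andP[yp _].
    by rewrite lee_fin mulr_ge0 ?powR_ge0// invr_ge0 ltW.
  - apply/measurable_EFinP; apply: measurable_funM.
      by apply: measurable_funTS; exact: measurable_invr.
    by apply: measurable_fun_powRl; exact: measurable_loginv.
  - by rewrite divr_ge0// ltW.
apply: le_trans (_ : (\int[mu]_(y in `]0%R, y0[) \int[mu]_(x in [set x | E (x, y)]) (G y)%:E <= _)%E).
  apply: (@ge0_le_integral_nonmeas _ (measurableTypeR R) R mu) => y; rewrite /= in_itv/= => /andP[yp yy0].
    by rewrite lee_fin mulr_ge0 ?divr_ge0 ?(ltW c0)// mulr_ge0 ?powR_ge0// invr_ge0 ltW.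
  have ypi : y <= pi by lra.
  have Ly := loginv_gt0 alpha_gt0 beta_gt0 yp ypi.
  set Y := Num.sqrt (1 - y ^+ 2); pose bb := y / L y.
  have bb0 : 0 < bb by rewrite divr_gt0.
  apply: le_trans (_ : (\int[mu]_(x in `](Y - bb)%R, (Y - bb / 2)%R[) (G y)%:E <= _)%E); last first.
    apply: (@ge0_subset_integral_nonmeas _ (measurableTypeR R) R mu) => [x _|x].
      by rewrite lee_fin.
    rewrite /= in_itv/= => /andP[x1 x2]; rewrite /E /X /b /=; do ![split] => //=; rewrite -/Y -/bb; lra.
  rewrite integral_cst//= lebesgue_measure_itv/= lte_fin.
  rewrite ifT; last by lra.
  rewrite -EFinB -EFinM lee_fin.
  have -> : Y - bb / 2 - (Y - bb) = bb / 2 by field.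
  rewrite le_eqVlt; apply/orP; left; apply/eqP.
  rewrite /G /bb.
  have -> : - q = (2 - alpha - 2 * beta) + (-1) by rewrite /q; ring.
  rewrite powRD; last by rewrite (gt_eqF Ly) implybT.
  rewrite powR_inv1 ?(ltW Ly)// (powRN y 2) powR_mulrn ?(ltW yp)//.
  by field; rewrite !gt_eqF.
apply: (@ge0_subset_integral_nonmeas _ (measurableTypeR R) R mu) => // y _.
by apply: integral_ge0 => x _; rewrite lee_fin.
Qed.

End dirichlet_necessary.

(** * Pointwise upper bound for the Dirichlet density *)

Section dirichlet_upper.
Context {R : realType} (alpha beta : R)
  (alpha_gt0 : 0 < alpha) (alpha_lt1 : alpha < 1) (beta_gt0 : 0 < beta).
Local Notation h := (hbeta alpha beta).
Local Notation L := (loginv alpha beta).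
Local Notation g := (hgap alpha beta).
Local Notation kap := (2 * beta / alpha).
Implicit Types (x y t : R).

Let sqrD3_le (a b c : R) : (a + b + c) ^+ 2 <= 3 * (a ^+ 2 + b ^+ 2 + c ^+ 2).
Proof.
have := sqr_ge0 (a - b); have := sqr_ge0 (b - c); have := sqr_ge0 (a - c).
rewrite !sqrrB !sqrrD; lra.
Qed.

Let kap_gt0 : 0 < kap. Proof. by rewrite divr_gt0// mulr_gt0. Qed.

Let rad2_pi x y : x ^+ 2 + y ^+ 2 < 1 -> 0 < rad x y / 2 <= pi.
Proof.
move=> xy; have := rad_gt0 xy; have := rad_lt2 xy; have := pi_ge2 R.
move=> p r2 r0; apply/andP; split; lra.
Qed.

Let loginv_rad_gt0 x y : x ^+ 2 + y ^+ 2 < 1 -> 0 < L (rad x y / 2).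
Proof. by move=> /rad2_pi/andP[r0 rp]; exact: loginv_gt0. Qed.

Let sqr_outer_le : exists2 c : R, 0 < c <= alpha & forall x y, x ^+ 2 + y ^+ 2 < 1 ->
  normc (outer h (x +i* y)) ^+ 2 <=
  2 * expR 2 * (rad x y `^ (- alpha) * L (rad x y / 2) `^ (- (2 * beta)) *
  expR (- (c * (L (rad x y / 2) * (gap x y / rad x y))))).
Proof.
have [cg cg0 cgL] := hgap_ge alpha_gt0 beta_gt0.
have pi0 := pi_gt0 R.
(* The cap at alpha is for later: c/16 will serve as the exponent eta, which must not exceed
   alpha. *)
exists (Num.min (cg / (8 * pi)) alpha).
  by rewrite lt_min alpha_gt0 divr_gt0 ?mulr_gt0//= ge_min lexx orbT.
move=> x y xy; set c := Num.min _ _.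
have cc : c <= cg / (8 * pi) by rewrite ge_min lexx.
have /andP[r0 rp] := rad2_pi xy; have L0 := loginv_rad_gt0 xy.
have rr := rad_gt0 xy; have d0 := gap_gt0 xy.
set r := rad x y in r0 rp L0 rr *; set s := gap x y / r.
have s0 : 0 < s by rewrite divr_gt0.
have h0 := hbeta_gt0 alpha_gt0 beta_gt0 rp.
have O := normc_outer_upper alpha_gt0 alpha_lt1 beta_gt0 xy.
apply: le_trans (_ : h (r / 2) ^+ 2 * expR 2 * expR (- (c * (L (r / 2) * s))) <= _).
  have -> : h (r / 2) ^+ 2 * expR 2 * expR (- (c * (L (r / 2) * s))) =
      expR (ln (h (r / 2)) + 1 - c * (L (r / 2) * s) / 2) ^+ 2.
    rewrite -[in LHS](lnK h0) -!expRM_natl -!expRD; congr expR; by field.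
  rewrite lerXn2r ?nnegrE ?normc_ge0 ?expR_ge0//.
  apply: (le_trans O); rewrite ler_expR lerD2l lerN2.
  have -> : g (r / 2) * (gap x y / rad x y) / (16 * pi) = g (r / 2) / (8 * pi) * s / 2.
    rewrite -/r -/s; move: (g _) (s) (pi : R) pi0 => G S P P0; field; by rewrite gt_eqF.
  rewrite ler_pM2r ?invr_gt0// mulrA ler_pM2r//.
  apply: le_trans (_ : cg / (8 * pi) * L (r / 2) <= _); first by rewrite ler_pM2r.
  by rewrite mulrAC ler_pM2r ?invr_gt0 ?mulr_gt0//; exact: cgL.
rewrite sqr_hbeta//.
have -> : 2 * expR 2 * (r `^ (- alpha) * L (r / 2) `^ (- (2 * beta)) * expR (- (c * (L (r / 2) * s)))) =
  (2 * r `^ (- alpha)) * L (r / 2) `^ (- (2 * beta)) * expR 2 * expR (- (c * (L (r / 2) * s))) by ring.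
do 3!(apply: ler_pM => //; rewrite ?mulr_ge0 ?powR_ge0 ?expR_ge0//).
rewrite powRM ?(ltW rr) ?invr_ge0// mulrC ler_wpM2r ?powR_ge0//.
rewrite -[2^-1]powR_inv1// -powRrM mulN1r opprK.
by rewrite -[leRHS]powRr1//; apply: ler_powR => //; [rewrite ler1n|exact: ltW].
Qed.

(** The three terms are the squares of the jump at 1, of the jump at -1 and of the
    integration-by-parts error. *)
Let sqr_deriv_le : exists2 C : R, 0 < C & forall x y, x ^+ 2 + y ^+ 2 < 1 ->
  normc (herglotz_deriv h (x +i* y)) ^+ 2 <=
  C * (L (rad x y / 2) ^+ 2 / rad x y ^+ 2 + (den x y pi)^-1 + (rad x y * gap x y)^-1).
Proof.
pose Cg := alpha / 2 + ln 2 / kap.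
have l2 : 0 <= ln 2 :> R by rewrite ln_ge0// ler1n.
have Cg0 : 0 <= Cg by apply: addr_ge0; apply: divr_ge0 => //; exact: ltW.
have pi0 := pi_gt0 R.
exists (12 * (Cg ^+ 2 + (ln 2) ^+ 2 + (2 + pi) ^+ 2)).
  rewrite mulr_gt0// ltr_wpDl ?addr_ge0 ?sqr_ge0//.
  by rewrite exprn_gt0// addr_gt0.
move=> x y xy.
have /andP[r0 rp] := rad2_pi xy; have L0 := loginv_rad_gt0 xy.
have rr := rad_gt0 xy; have d0 := gap_gt0 xy.
have gL := hgap_le alpha_gt0 beta_gt0 r0 rp.
have g0 : 0 <= g (rad x y / 2) by apply: le_trans l2 (hgap_ge_ln2 alpha_gt0 beta_gt0 r0 rp).
have D0 := den_gt0 xy pi.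
have J := normc_herglotz_deriv_le alpha_gt0 alpha_lt1 beta_gt0 xy.
set e1 := ln 2 / _ in J; set e2 := (2 + pi) / _ in J.
have E1 : e1 ^+ 2 = (ln 2) ^+ 2 * (den x y pi)^-1.
  by rewrite /e1 expr_div_n sqr_sqrtr// ltW.
have E2 : e2 ^+ 2 = (2 + pi) ^+ 2 * (rad x y * gap x y)^-1.
  by rewrite /e2 expr_div_n sqr_sqrtr// mulr_ge0// ltW.
apply: le_trans (_ : (2 * (g (rad x y / 2) / rad x y + (e1 + e2))) ^+ 2 <= _).
  rewrite lerXn2r ?nnegrE ?normc_ge0//.
  have e10 : 0 <= e1 by rewrite divr_ge0 ?sqrtr_ge0.
  have e20 : 0 <= e2 by rewrite divr_ge0 ?sqrtr_ge0// addr_ge0// ltW.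
  by apply: mulr_ge0 => //; apply: addr_ge0; [rewrite divr_ge0// ltW|exact: addr_ge0].
have G : (g (rad x y / 2) / rad x y) ^+ 2 <= Cg ^+ 2 * (L (rad x y / 2) ^+ 2 / rad x y ^+ 2).
  rewrite expr_div_n mulrA ler_pM2r ?invr_gt0 ?exprn_gt0// -exprMn.
  by rewrite lerXn2r ?nnegrE// mulr_ge0// ltW.
rewrite exprMn addrA.
apply: le_trans (ler_wpM2l _ (sqrD3_le _ _ _)) _; first by rewrite sqr_ge0.
rewrite E1 E2; move: G; set G2 := (_ / _) ^+ 2; set a := L _ ^+ 2 / _; set b := (den _ _ _)^-1.
set k := (rad x y * _)^-1 => G.
have a0 : 0 <= a by rewrite divr_ge0 ?sqr_ge0.
have b0 : 0 <= b by rewrite invr_ge0 ltW.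
have k0 : 0 <= k by rewrite invr_ge0 mulr_ge0// ltW.
have -> : 2 ^+ 2 * (3 * (G2 + ln 2 ^+ 2 * b + (2 + pi) ^+ 2 * k)) =
   12 * (G2 + ln 2 ^+ 2 * b + (2 + pi) ^+ 2 * k) by ring.
rewrite -[leRHS]mulrA ler_pM2l//.
move: (sqr_ge0 Cg) (sqr_ge0 (ln 2 : R)) (sqr_ge0 (2 + pi : R)) G.
move: (Cg ^+ 2) (ln 2 ^+ 2) ((2 + pi) ^+ 2) => u v w u0 v0 w0 G.
have := mulr_ge0 u0 b0; have := mulr_ge0 u0 k0; have := mulr_ge0 v0 a0.
have := mulr_ge0 v0 k0; have := mulr_ge0 w0 a0; have := mulr_ge0 w0 b0.
clear -G; lra.
Qed.

(** Let N = |1 + z|. If N >= 1 the ratio d/r is at most 1. If N < 1 then r >= 1, hence d/r <= d <=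
    N. This gain softens the factor N^(-2) of the jump at -1 to the integrable N^(eta - 2). *)
Let ratio_powR_le x y eta : x ^+ 2 + y ^+ 2 < 1 -> 0 < eta -> eta <= alpha ->
  (gap x y / rad x y) `^ alpha <= Num.sqrt (den x y pi) `^ eta.
Proof.
move=> xy e0 ea; have rr := rad_gt0 xy; have d0 := gap_gt0 xy.
set N := Num.sqrt _; set s := _ / _.
have s0 : 0 < s by rewrite divr_gt0.
have s1 : s <= 1 by rewrite ler_pdivrMr// mul1r; exact: gap_le_rad.
have N0 : 0 < N by rewrite sqrtr_gt0; exact: den_gt0.
have [N1|N1] := leP 1 N.
  apply: le_trans (_ : s `^ 0 <= _); first by apply: ger_powR; rewrite ?s0// ltW.
  rewrite powRr0; have {1}<- : 1 `^ eta = 1 :> R by rewrite powR1.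
  by apply: ge0_ler_powR; rewrite ?nnegrE ?(ltW e0) ?(ltW N0).
have r1 : 1 <= rad x y.
  rewrite leNgt; apply/negP => r1.
  have H1 : den x y pi < 1 by rewrite -(sqr_sqrtr (ltW (den_gt0 xy pi))) -/N expr_lt1 ?(ltW N0).
  have H2 : (1 - x) ^+ 2 + y ^+ 2 < 1.
    by move: r1; rewrite /rad -[X in _ < X -> _]sqrtr1 ltr_sqrt.
  by move: H1 H2; rewrite /den cospi sinpi; have := sqr_ge0 x; have := sqr_ge0 y; nra.
apply: le_trans (_ : s `^ eta <= _).
  by apply: ger_powR; rewrite ?s0.
apply: ge0_ler_powR; rewrite ?nnegrE ?(ltW e0) ?(ltW s0) ?(ltW N0)//.
rewrite ler_pdivrMr// -[leLHS]mulr1; apply: ler_pM; rewrite ?(ltW d0) ?sqrt_den_ge_gap//.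
Qed.

(** Multiply the bounds for |O|^2 and |O'/O|^2 by d^alpha and write everything with s = d/r: the
    r^(-alpha) of h^2 and d^alpha make s^alpha, and the error 1/(r d) becomes s^(alpha-1)/r^2. *)
Lemma dirichlet_density_le : exists2 c : R, 0 < c <= alpha & exists2 C : R, 0 < C &
  forall eta x y, 0 < eta -> eta <= alpha -> x ^+ 2 + y ^+ 2 < 1 ->
  let r := rad x y in let s := gap x y / r in let l := L (r / 2) in
  dirichlet_density alpha beta (x, y) <=
  C * (l `^ (- (2 * beta)) * expR (- (c * (l * s))) *
       (l ^+ 2 * s `^ alpha + s `^ (alpha - 1)) / r ^+ 2 +
       Num.sqrt (den x y pi) `^ (eta - 2)).
Proof.
have [c c0 oc] := sqr_outer_le; have [C C0 dC] := sqr_deriv_le.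
exists c => //; pose A1 := kap `^ (- (2 * beta)).
pose K := 2 * expR 2 * C / pi ^+ 2.
have K0 : 0 < K by rewrite divr_gt0 ?exprn_gt0 ?pi_gt0// mulr_gt0 ?mulr_gt0 ?expR_gt0.
have A10 : 0 < A1 by rewrite powR_gt0.
exists (K * (1 + A1)); first by rewrite mulr_gt0// addr_gt0.
move=> eta x y e0 ea xy; rewrite dirichlet_densityE//.
have rr := rad_gt0 xy; have d0 := gap_gt0 xy; have l0 := loginv_rad_gt0 xy.
have D0 := den_gt0 xy pi; have := ratio_powR_le xy e0 ea.
have := oc x y xy; have := dC x y xy.
have /andP[r2 rp] := rad2_pi xy; have := loginv_ge alpha beta r2 rp.
have N0 : 0 < Num.sqrt (den x y pi) by rewrite sqrtr_gt0.
have D : den x y pi = Num.sqrt (den x y pi) ^+ 2 by rewrite sqr_sqrtr// ltW.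
move: D; set r := rad x y in rr l0 *; set l := L (r / 2) in l0 *.
set N := Num.sqrt _ in N0 *; set d := gap x y in d0 *.
move=> -> kl J O sN /=; rewrite -/l; set s := d / r in sN *.
have s0 : 0 < s by rewrite divr_gt0.
pose A0 := l `^ (- (2 * beta)); pose E := expR (- (c * (l * s))).
rewrite -/A0 -/E.
have A00 : 0 <= A0 by exact: powR_ge0.
have E0 : 0 <= E by exact: expR_ge0.
have A0A1 : A0 <= A1.
  rewrite /A0 /A1 !powRN lef_pV2 ?posrE ?powR_gt0//.
  have b2 : 0 <= 2 * beta by rewrite mulr_ge0// ltW.
  by apply: ge0_ler_powR; rewrite ?nnegrE ?b2 ?(ltW l0) ?(ltW kap_gt0).
have /andP[cp _] := c0.
have E1 : E <= 1 by rewrite expR_le1 oppr_le0 mulr_ge0 ?(ltW cp)// mulr_ge0 ?(ltW l0) ?(ltW s0).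
have N2 : 0 < N ^+ 2 by rewrite exprn_gt0.
have T : A0 * E * s `^ alpha / N ^+ 2 <= A1 * N `^ (eta - 2).
  rewrite powRD; last by rewrite (gt_eqF N0) implybT.
  rewrite (powRN N 2) powR_mulrn ?(ltW N0)// mulrA ler_pM2r ?invr_gt0//.
  apply: ler_pM; rewrite ?mulr_ge0 ?powR_ge0//.
  by rewrite -[leRHS]mulr1; apply: ler_pM.
apply: le_trans (_ : 2 * expR 2 * (r `^ (- alpha) * A0 * E) *
    (C * (l ^+ 2 / r ^+ 2 + (N ^+ 2)^-1 + (r * d)^-1) / pi ^+ 2) * d `^ alpha <= _).
  rewrite ler_wpM2r ?powR_ge0//; apply: ler_pM => //.
  - by rewrite divr_ge0 ?sqr_ge0.
  - by rewrite ler_wpM2r ?invr_ge0 ?sqr_ge0.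
have S : r `^ (- alpha) * d `^ alpha = s `^ alpha.
  by rewrite /s powRM ?(ltW d0) ?invr_ge0 ?(ltW rr)// -[r^-1]powR_inv1 ?(ltW rr)// -powRrM mulN1r mulrC.
have S1 : s `^ alpha * (r * d)^-1 = s `^ (alpha - 1) / r ^+ 2.
  rewrite powRD; last by rewrite (gt_eqF s0) implybT.
  rewrite powR_inv1 ?(ltW s0)//; have -> : r * d = s * r ^+ 2 by rewrite /s; field; rewrite gt_eqF.
  by field; rewrite !gt_eqF.
have -> : 2 * expR 2 * (r `^ (- alpha) * A0 * E) *
    (C * (l ^+ 2 / r ^+ 2 + (N ^+ 2)^-1 + (r * d)^-1) / pi ^+ 2) * d `^ alpha =
    K * (A0 * E * (l ^+ 2 * (r `^ (- alpha) * d `^ alpha) +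
      r ^+ 2 * ((r `^ (- alpha) * d `^ alpha) * (r * d)^-1)) / r ^+ 2 +
     A0 * E * (r `^ (- alpha) * d `^ alpha) / N ^+ 2).
  rewrite /K; move: (expR 2) (pi : R) (pi_gt0 R) => e P P0.
  by field; rewrite !gt_eqF.
rewrite S S1 -[leRHS]mulrA ler_pM2l//.
have -> : r ^+ 2 * (s `^ (alpha - 1) / r ^+ 2) = s `^ (alpha - 1) by field; rewrite gt_eqF.
move: T; set t1 := A0 * E * (_ + _) / _; set t2 := _ / N ^+ 2; set t3 := N `^ _ => T.
have t10 : 0 <= t1.
  rewrite divr_ge0 ?sqr_ge0// mulr_ge0 ?(mulr_ge0 A00 E0)//.
  by rewrite addr_ge0 ?powR_ge0// mulr_ge0 ?powR_ge0 ?sqr_ge0.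
have t30 : 0 <= t3 by exact: powR_ge0.
have := mulr_ge0 (ltW A10) t10; move: T t10 t30; clear; lra.
Qed.

End dirichlet_upper.

(** * The factor of r^(-2) in the density bound, in three regimes *)

Section bracket.
Context {R : realType}.
Implicit Types (a p q u v c l s t K M : R).

Lemma npos_ler_powR p u v : p <= 0 -> 0 < u -> u <= v -> v `^ p <= u `^ p.
Proof.
move=> p0 u0 uv; have v0 := lt_le_trans u0 uv.
rewrite -[p]opprK !(powRN _ (- p)) lef_pV2 ?posrE ?powR_gt0//.
by apply: ge0_ler_powR; rewrite ?nnegrE ?oppr_ge0 ?(ltW u0) ?(ltW v0).
Qed.

Lemma powR_le_expR a c u : 0 <= a <= 1 -> 0 < c -> 0 <= u ->
  u `^ a <= (1 + 2 / c) * expR (c * u / 2).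
Proof.
move=> /andP[a0 a1] c0 u0.
have c2 : 0 < 2 / c by rewrite divr_gt0.
apply: le_trans (_ : 1 + u <= _).
  have [u1|u1] := leP 1 u.
    by apply: le_trans (ler1_powR u1 a1) _; rewrite lerDr.
  apply: le_trans (_ : 1 <= _); last by rewrite lerDl.
  have {1}<- : 1 `^ a = 1 :> R by rewrite powR1.
  by apply: ge0_ler_powR; rewrite ?nnegrE ?(ltW u1).
have E := expR_ge1Dx (c * u / 2).
have E1 : 1 <= expR (c * u / 2) by rewrite -expR0 ler_expR !mulr_ge0// ltW.
have {1}-> : u = 2 / c * (c * u / 2) by field; rewrite gt_eqF.
rewrite [leRHS]mulrDl mul1r.
by apply: lerD => //; rewrite ler_pM2l//; apply: le_trans E; rewrite lerDr.
Qed.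

Lemma sqr_le_expR c l : 0 < c -> 0 <= l -> l ^+ 2 <= (2 / c) ^+ 2 * expR (c * l).
Proof.
move=> c0 l0; have -> : expR (c * l) = expR (c * l / 2) ^+ 2.
  by rewrite -expRM_natl; congr expR; field.
rewrite -exprMn lerXn2r ?nnegrE//; first by rewrite mulr_ge0 ?expR_ge0// divr_ge0// ltW.
have {1}-> : l = 2 / c * (c * l / 2) by field; rewrite gt_eqF.
by rewrite ler_pM2l ?divr_gt0//; apply: le_trans (expR_ge1Dx _); rewrite lerDr.
Qed.

Context (alpha b : R).
(** The coefficient of r^(-2) in [dirichlet_density_le], where l = L(r/2), s = d/r and b = 2
    beta. *)
Definition bracket c l s : R :=
  l `^ (- b) * expR (- (c * (l * s))) * (l ^+ 2 * s `^ alpha + s `^ (alpha - 1)).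

Context (alpha_gt0 : 0 < alpha) (alpha_lt1 : alpha < 1) (b_ge0 : 0 <= b).

Let powR_le1 s : 0 < s -> s <= 1 -> s `^ alpha <= 1.
Proof.
move=> s0 s1; have {1}<- : 1 `^ alpha = 1 :> R by rewrite powR1.
by apply: ge0_ler_powR; rewrite ?nnegrE ?(ltW alpha_gt0) ?(ltW s0).
Qed.

(** For s >= 1/8 the exponential is at most exp(-c l/8); half of this exponent absorbs l^2, the
    other half remains. *)
Lemma bracket_far c k l s : 0 < c -> 0 < k -> k <= l -> 8^-1 <= s -> s <= 1 ->
  bracket c l s <= k `^ (- b) * ((32 / c) ^+ 2 + 8) * expR (- (c * l / 16)).
Proof.
have a0 := alpha_gt0; have a1 := alpha_lt1; move=> c0 k0 kl s8 s1; have s0 : 0 < s by apply: lt_le_trans s8; rewrite invr_gt0.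
have l0 := lt_le_trans k0 kl.
have H1 : l `^ (- b) <= k `^ (- b) by apply: npos_ler_powR; rewrite // oppr_le0.
have H2 : expR (- (c * (l * s))) <= expR (- (c * l / 16)) * expR (- (c * l / 16)).
  rewrite -expRD ler_expR -opprD lerN2.
  have -> : c * l / 16 + c * l / 16 = c * (l * 8^-1) by field.
  by rewrite !ler_pM2l.
have H3 : l ^+ 2 * s `^ alpha + s `^ (alpha - 1) <=
    ((32 / c) ^+ 2 + 8) * expR (c * l / 16).
  rewrite mulrDl; apply: lerD.
    apply: le_trans (_ : l ^+ 2 <= _).
      by rewrite -[leRHS]mulr1 ler_wpM2l ?sqr_ge0// powR_le1.
    have := @sqr_le_expR (c / 16) l; rewrite divr_gt0// (ltW l0) => /(_ isT isT).
    have -> : 2 / (c / 16) = 32 / c by field; rewrite gt_eqF.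
    by have -> : c / 16 * l = c * l / 16 by ring.
  apply: le_trans (_ : 8 <= _).
    apply: le_trans (npos_ler_powR (_ : alpha - 1 <= 0) _ s8) _; first by lra.
      by rewrite invr_gt0.
    rewrite -[8^-1]powR_inv1// -powRrM mulN1r opprB -[leRHS]powRr1//.
    by apply: ler_powR; [rewrite ler1n|lra].
  by rewrite -[leLHS]mulr1 ler_pM2l// -expR0 ler_expR !mulr_ge0// ltW.
have -> : k `^ (- b) * ((32 / c) ^+ 2 + 8) * expR (- (c * l / 16)) =
    k `^ (- b) * (expR (- (c * l / 16)) * expR (- (c * l / 16))) *
    (((32 / c) ^+ 2 + 8) * expR (c * l / 16)).
  by rewrite [expR (- _)]expRN; field; rewrite ?(gt_eqF c0) ?gt_eqF ?expR_gt0.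
apply: ler_pM => //; rewrite ?mulr_ge0 ?powR_ge0 ?expR_ge0//.
  by rewrite addr_ge0 ?powR_ge0// mulr_ge0 ?powR_ge0 ?sqr_ge0.
by apply: ler_pM => //; rewrite ?powR_ge0 ?expR_ge0.
Qed.

Lemma bracket_mid c k m l s : 0 < c -> 0 < k -> k <= l -> l <= m -> 0 < s -> s <= 1 ->
  bracket c l s <= k `^ (- b) * (m ^+ 2 + 1) * s `^ (alpha - 1).
Proof.
have a0 := alpha_gt0; have a1 := alpha_lt1; move=> c0 k0 kl lm s0 s1; have l0 := lt_le_trans k0 kl.
have H1 : l `^ (- b) <= k `^ (- b) by apply: npos_ler_powR; rewrite // oppr_le0.
have s1' : 1 <= s `^ (alpha - 1).
  have {1}<- : 1 `^ (alpha - 1) = 1 :> R by rewrite powR1.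
  by apply: npos_ler_powR => //; lra.
rewrite -mulrA /bracket -mulrA; apply: ler_pM => //.
- exact: powR_ge0.
- by rewrite mulr_ge0 ?expR_ge0// addr_ge0 ?powR_ge0// mulr_ge0 ?powR_ge0 ?sqr_ge0.
have E1 : expR (- (c * (l * s))) <= 1 by rewrite expR_le1 oppr_le0 !mulr_ge0// ltW.
have H : l ^+ 2 * s `^ alpha + s `^ (alpha - 1) <= (m ^+ 2 + 1) * s `^ (alpha - 1).
  rewrite mulrDl mul1r lerD2r; apply: ler_pM; rewrite ?sqr_ge0 ?powR_ge0//.
    by rewrite lerXn2r ?nnegrE ?(ltW l0)// (le_trans (ltW l0)).
  by apply: le_trans s1'; exact: powR_le1.
rewrite -[leRHS]mul1r; apply: ler_pM; rewrite ?expR_ge0//.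
by rewrite addr_ge0 ?powR_ge0// mulr_ge0 ?powR_ge0 ?sqr_ge0.
Qed.

(** Replaces l by a comparable M and s by a lower bound u. As s^alpha increases with s it is first
    written l^(-alpha) (l s)^alpha, and (l s)^alpha is absorbed by half of the exponential. This is
    how the power L^(-alpha) of the threshold appears. *)
Lemma bracket_near c K M l s u : 0 < c -> 1 <= K -> 0 < M -> M / K <= l -> l <= K * M ->
  0 < u -> u <= s ->
  bracket c l s <= K `^ (b + alpha + 2) * (2 + 2 / c) *
    (M `^ (2 - b - alpha) * expR (- (c / (2 * K) * (M * u))) + M `^ (- b) * u `^ (alpha - 1)).
Proof.
have a0 := alpha_gt0; have a1 := alpha_lt1; move=> c0 K1 M0 Ml lM u0 us; have K0 : 0 < K by lra.
have s0 := lt_le_trans u0 us.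
have MK0 : 0 < M / K by rewrite divr_gt0.
have l0 := lt_le_trans MK0 Ml.
have neg p : 0 <= p -> l `^ (- p) <= K `^ p * M `^ (- p).
  move=> p0; apply: le_trans (npos_ler_powR (_ : - p <= 0) MK0 Ml) _; first by rewrite oppr_le0.
  rewrite powRM ?(ltW M0) ?invr_ge0 ?(ltW K0)// -[K^-1]powR_inv1 ?(ltW K0)// -powRrM.
  by rewrite mulN1r opprK mulrC.
have E1 : expR (- (c * (l * s))) <= 1 by rewrite expR_le1 oppr_le0 !mulr_ge0// ltW.
have T2 : l `^ (- b) * expR (- (c * (l * s))) * s `^ (alpha - 1) <=
    K `^ b * (M `^ (- b) * u `^ (alpha - 1)).
  rewrite [leRHS]mulrA; apply: ler_pM; rewrite ?mulr_ge0 ?powR_ge0 ?expR_ge0//; last first.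
    by apply: npos_ler_powR => //; lra.
  by rewrite -[leRHS]mulr1; apply: ler_pM; rewrite ?powR_ge0 ?expR_ge0 ?neg.
have T1 : l `^ (- b) * expR (- (c * (l * s))) * (l ^+ 2 * s `^ alpha) <=
    K `^ (b + alpha + 2) * (1 + 2 / c) *
    (M `^ (2 - b - alpha) * expR (- (c / (2 * K) * (M * u)))).
  have -> : s `^ alpha = l `^ (- alpha) * (l * s) `^ alpha.
    by rewrite powRM ?(ltW l0) ?(ltW s0)// mulrA powRN mulVf ?mul1r// gt_eqF// powR_gt0.
  have P : (l * s) `^ alpha <= (1 + 2 / c) * expR (c * (l * s) / 2).
    by apply: powR_le_expR; rewrite ?(ltW alpha_gt0) ?(ltW alpha_lt1) ?mulr_ge0 ?(ltW l0) ?(ltW s0).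
  have Q : expR (- (c * (l * s))) * expR (c * (l * s) / 2) <=
      expR (- (c / (2 * K) * (M * u))).
    rewrite -expRD ler_expR.
    have -> : - (c * (l * s)) + c * (l * s) / 2 = - (c / 2 * (l * s)) by field.
    have -> : c / (2 * K) * (M * u) = c / 2 * (M / K * u) by field; rewrite gt_eqF.
    by rewrite lerN2 ler_pM2l ?divr_gt0//; apply: ler_pM => //; exact: ltW.
  have K2 : l ^+ 2 <= K `^ 2 * M `^ 2.
    rewrite !powR_mulrn ?(ltW K0) ?(ltW M0)// -exprMn lerXn2r ?nnegrE ?(ltW l0)//.
    by rewrite mulr_ge0 ?(ltW K0) ?(ltW M0).
  have -> : K `^ (b + alpha + 2) = K `^ b * K `^ alpha * K `^ 2.
    by rewrite !powRD// (gt_eqF K0) implybT.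
  have -> : M `^ (2 - b - alpha) = M `^ 2 * M `^ (- b) * M `^ (- alpha).
    by rewrite !powRD// (gt_eqF M0) implybT.
  apply: le_trans (_ : (K `^ b * M `^ (- b)) * ((K `^ 2 * M `^ 2) *
     (K `^ alpha * M `^ (- alpha))) *
     (expR (- (c * (l * s))) * ((1 + 2 / c) * expR (c * (l * s) / 2))) <= _).
    have -> : l `^ (- b) * expR (- (c * (l * s))) * (l ^+ 2 * (l `^ (- alpha) * (l * s) `^ alpha)) =
      l `^ (- b) * (l ^+ 2 * l `^ (- alpha)) * (expR (- (c * (l * s))) * (l * s) `^ alpha) by ring.
    apply: ler_pM.
    - by apply: mulr_ge0; [exact: powR_ge0|apply: mulr_ge0; [exact: sqr_ge0|exact: powR_ge0]].
    - by rewrite mulr_ge0 ?powR_ge0 ?expR_ge0.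
    - apply: ler_pM; [exact: powR_ge0|by apply: mulr_ge0; [exact: sqr_ge0|exact: powR_ge0]|exact: neg|].
      by apply: ler_pM; [exact: sqr_ge0|exact: powR_ge0|by []|apply: neg; exact: ltW].
    - by rewrite ler_wpM2l ?expR_ge0.
  have -> : K `^ b * M `^ (- b) * (K `^ 2 * M `^ 2 * (K `^ alpha * M `^ (- alpha))) *
      (expR (- (c * (l * s))) * ((1 + 2 / c) * expR (c * (l * s) / 2))) =
    (K `^ b * K `^ alpha * K `^ 2 * (1 + 2 / c) * (M `^ 2 * M `^ (- b) * M `^ (- alpha))) *
      (expR (- (c * (l * s))) * expR (c * (l * s) / 2)) by ring.
  rewrite [leRHS]mulrA; apply: ler_wpM2l => //.
  have c2 : 0 <= 1 + 2 / c by rewrite addr_ge0// divr_ge0// ltW.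
  by do !apply: mulr_ge0 => //; exact: powR_ge0.
have c2 : 0 < 2 / c by rewrite divr_gt0.
rewrite /bracket mulrDr.
have Kb : K `^ b <= K `^ (b + alpha + 2).
  apply: ler_powR => //; have := alpha_gt0; lra.
apply: (le_trans (lerD T1 T2)).
move: (M `^ (2 - b - alpha) * _) (M `^ (- b) * u `^ _)
  (mulr_ge0 (powR_ge0 M (2 - b - alpha)) (expR_ge0 (- (c / (2 * K) * (M * u)))))
  (mulr_ge0 (powR_ge0 M (- b)) (powR_ge0 u (alpha - 1))) => X Y X0 Y0.
move: Kb; move: (K `^ b) (K `^ (b + alpha + 2)) (powR_ge0 K b) => k1 k2 k10 kk.
have k20 : 0 <= k2 by exact: le_trans k10 kk.
have -> : k2 * (2 + 2 / c) * (X + Y) = k2 * (1 + 2 / c) * X + k2 * Y + (k2 * X + k2 * (1 + 2 / c) * Y) by ring.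
have := ler_wpM2r Y0 kk.
have := mulr_ge0 k20 X0; have := mulr_ge0 (mulr_ge0 k20 (_ : 0 <= 1 + 2 / c)) Y0.
move: (k2 * (1 + 2 / c) * X) => ? /(_ ltac:(lra)); lra.
Qed.

End bracket.

(** * An explicit majorant of the density in the first quadrant *)

Section majorant.
Context {R : realType} (alpha beta : R)
  (alpha_gt0 : 0 < alpha) (alpha_lt1 : alpha < 1) (beta_gt0 : 0 < beta).
Local Notation L := (loginv alpha beta).
Local Notation kap := (2 * beta / alpha).
Local Notation bracket := (bracket alpha (2 * beta)).
Implicit Types (x y v w t c eta : R).

(** A substitute for 1 - |z|, comparable to it within a factor 2 when x >= 0, since 1 - |z|^2 = (X -
    x)(X + x) with X = sqrt(1 - y^2). It is affine in x, so integrals along horizontal slices become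
    explicit. *)
Definition depth (p : R * R) : R :=
  (Num.sqrt (1 - p.2 ^+ 2) - p.1) * Num.sqrt (1 - p.2 ^+ 2).

(** A product form dominating a^(eta - 2) for every a that is at least 1 - x and y; after reflection
    it covers both points 1 and -1. *)
Definition corner_term eta (p : R * R) : R :=
  (1 - p.1) `^ (eta / 2 - 1) * p.2 `^ (eta / 2 - 1).

Definition boundary_term (p : R * R) : R := depth p `^ (alpha - 1).

(** The part s^(alpha-1)/r^2 of the bound near 1, where r is comparable to y and the depth is
    smaller than y; the cut-off is what makes its slice integrals small enough. *)
Definition wedge_term (p : R * R) : R :=
  if depth p < p.2
  then L p.2 `^ (- (2 * beta)) * p.2 `^ (- 1 - alpha) * depth p `^ (alpha - 1) else 0.

(** The main part, of size y^(-2) L^(2 - 2 beta - alpha) in the layer of depth about y/L; it decides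
    the threshold. *)
Definition exp_term c (p : R * R) : R :=
  p.2 `^ (- 2) * L p.2 `^ (2 - 2 * beta - alpha) *
  expR (- (c * (L p.2 * depth p / p.2))).

Definition majorant eta c (p : R * R) : R :=
  corner_term eta p + boundary_term p + (wedge_term p + exp_term c p).

Lemma corner_term_ge0 eta p : 0 <= corner_term eta p.
Proof. by rewrite mulr_ge0 ?powR_ge0. Qed.

Lemma boundary_term_ge0 p : 0 <= boundary_term p.
Proof. exact: powR_ge0. Qed.

Lemma wedge_term_ge0 p : 0 <= wedge_term p.
Proof. by rewrite /wedge_term; case: ifP => // _; rewrite !mulr_ge0 ?powR_ge0. Qed.

Lemma exp_term_ge0 c p : 0 <= exp_term c p.
Proof. by rewrite !mulr_ge0 ?powR_ge0 ?expR_ge0. Qed.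

Let kap_gt0 : 0 < kap. Proof. by rewrite divr_gt0// mulr_gt0. Qed.

Section point.
Context (x y : R) (y_neq0 : y != 0) (xy1 : x ^+ 2 + y ^+ 2 < 1).
Local Notation r := (rad x y).
Local Notation d := (gap x y).
Local Notation s := (gap x y / rad x y).
Local Notation l := (L (rad x y / 2)).
Local Notation w := (depth (`|x|, `|y|)).

Let v_gt0 : 0 < `|y|. Proof. by rewrite normr_gt0. Qed.

Let absx_lt1 : `|x| < 1.
Proof.
rewrite -sqrtr_sqr -[ltRHS]sqrtr1 ltr_sqrt//; have := xy1; have := sqr_ge0 y; lra.
Qed.

Lemma depth_bounds : [/\ 0 < w, w <= 1, w / 2 <= d & d <= 2 * w].
Proof.
have xy := xy1; have /andP[g1 g2] := gap_sqr xy.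
move: g1 g2; rewrite /depth /= real_normK ?num_real//.
set X := Num.sqrt _.
have X2 : X ^+ 2 = 1 - y ^+ 2 by rewrite sqr_sqrtr//; have := sqr_ge0 x; lra.
have X0 : 0 <= X by exact: sqrtr_ge0.
have x2 : `|x| ^+ 2 = x ^+ 2 by rewrite real_normK ?num_real.
have x0 : 0 <= `|x| by [].
have xX : `|x| < X.
  by rewrite -sqrtr_sqr ltr_sqrt ?real_normK ?num_real//; have := sqr_ge0 x; lra.
have E : 1 - (x ^+ 2 + y ^+ 2) = (X - `|x|) * (X + `|x|) by rewrite -subr_sqr X2 x2; ring.
have X1 : X <= 1 by rewrite -[leRHS]sqrtr1 ler_sqrt//; have := sqr_ge0 y; lra.
rewrite E; move: x0 xX X1; move: `|x| (X) => a b a0 ab b1 g1 g2.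
have b0 : 0 < b by lra.
split; [by rewrite mulr_gt0 ?subr_gt0|nra|nra|nra].
Qed.

Lemma powR_corner eta a : eta <= 2 -> 1 - `|x| <= a -> `|y| <= a ->
  a `^ (eta - 2) <= corner_term eta (`|x|, `|y|).
Proof.
move=> e2 xa ya; have a0 := lt_le_trans v_gt0 ya; have ax := absx_lt1; have v0 := v_gt0.
have -> : eta - 2 = (eta / 2 - 1) + (eta / 2 - 1) by field.
rewrite powRD; last by rewrite (gt_eqF a0) implybT.
by apply: ler_pM; rewrite ?powR_ge0//; apply: npos_ler_powR; rewrite ?subr_gt0//; lra.
Qed.

Lemma rad_ge : 1 - `|x| <= r /\ `|y| <= r.
Proof.
split.
  apply: le_trans (_ : `|1 - x| <= _).
    by have := ler_norm x; have := ler_norm (1 - x); lra.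
  by rewrite -sqrtr_sqr ler_sqrt ?lerDl ?sqr_ge0// addr_ge0 ?sqr_ge0.
by rewrite -sqrtr_sqr ler_sqrt ?lerDr ?sqr_ge0// addr_ge0 ?sqr_ge0.
Qed.

Lemma sqrt_den_pi_ge : 1 - `|x| <= Num.sqrt (den x y pi) /\ `|y| <= Num.sqrt (den x y pi).
Proof.
rewrite /den cospi sinpi sub0r sqrrN; split.
  apply: le_trans (_ : `|- 1 - x| <= _).
    apply: le_trans (_ : - (- 1 - x) <= _); last by rewrite -normrN ler_norm.
    by have := ler_norm (- x); rewrite normrN; lra.
  by rewrite -sqrtr_sqr ler_sqrt ?lerDl ?sqr_ge0// addr_ge0 ?sqr_ge0.
by rewrite -sqrtr_sqr ler_sqrt ?lerDr ?sqr_ge0// addr_ge0 ?sqr_ge0.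
Qed.

Let r_gt0 : 0 < r. Proof. exact: rad_gt0. Qed.
Let s_gt0 : 0 < s. Proof. by rewrite divr_gt0// gap_gt0. Qed.
Let s_le1 : s <= 1. Proof. by rewrite ler_pdivrMr// mul1r gap_le_rad. Qed.

Let r2_gt0 : 0 < r / 2. Proof. by rewrite divr_gt0. Qed.
Let r2_le : r / 2 <= pi.
Proof. by have := rad_lt2 xy1; have := pi_ge2 R; lra. Qed.

Let l_ge : kap <= l. Proof. exact: loginv_ge. Qed.

(** Since l >= -ln r, exp(-c l/16) is at most r^(c/16), so the bound becomes r^(eta - 2) with eta =
    c/16. *)
Lemma bracket_far_le c : 0 < c -> c <= 16 -> 8^-1 <= s ->
  bracket c l s / r ^+ 2 <=
  kap `^ (- (2 * beta)) * ((32 / c) ^+ 2 + 8) * corner_term (c / 16) (`|x|, `|y|).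
Proof.
move=> c0 c16 s8; have b0 : 0 <= 2 * beta by rewrite mulr_ge0// ltW.
have [r1 r2] := rad_ge.
have e2 : c / 16 <= 2 by lra.
have B := bracket_far alpha_gt0 alpha_lt1 b0 c0 kap_gt0 l_ge s8 s_le1.
have C := powR_corner e2 r1 r2.
apply: le_trans (_ : kap `^ (- (2 * beta)) * ((32 / c) ^+ 2 + 8) * expR (- (c * l / 16)) / r ^+ 2 <= _).
  by rewrite ler_pM2r// invr_gt0 exprn_gt0.
rewrite -[leLHS]mulrA ler_wpM2l//.
  by rewrite mulr_ge0 ?powR_ge0// addr_ge0// sqr_ge0.
apply: le_trans C.
rewrite powRD; last by rewrite (gt_eqF r_gt0) implybT.
rewrite (powRN r 2) powR_mulrn ?(ltW r_gt0)// ler_pM2r ?invr_gt0 ?exprn_gt0//.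
rewrite /powR (gt_eqF r_gt0) ler_expR.
have -> : c * l / 16 = c / 16 * l by ring.
rewrite -mulrN ler_pM2l ?divr_gt0// lerNl.
rewrite loginvE// ln_div ?posrE//.
have := kap_gt0; have : 0 <= ln 2 :> R by rewrite ln_ge0// ler1n.
have : 0 <= ln pi :> R by rewrite ln_ge0//; have := pi_ge2 R; lra.
move: (ln r) (kap) (ln pi) (ln 2) => *; lra.
Qed.

(** Away from 1 the logarithm is bounded by L(1/2), and r < 2 makes s comparable to the depth. *)
Lemma bracket_mid_le c : 0 < c -> 1 <= r ->
  bracket c l s / r ^+ 2 <=
  kap `^ (- (2 * beta)) * (L 2^-1 ^+ 2 + 1) * 4 * boundary_term (`|x|, `|y|).
Proof.
move=> c0 r1; have b0 : 0 <= 2 * beta by rewrite mulr_ge0// ltW.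
have a0 := alpha_gt0; have a1 := alpha_lt1.
have lm : l <= L 2^-1.
  by apply: loginv_le; rewrite ?invr_gt0//; have := r1; lra.
have [w0 w1 wd dw] := depth_bounds.
have B := bracket_mid alpha_gt0 alpha_lt1 b0 c0 kap_gt0 l_ge lm s_gt0 s_le1.
have ws : w / 4 <= s.
  rewrite ler_pdivlMr//; apply: le_trans wd.
  have -> : w / 2 = w / 4 * 2 by field.
  by rewrite ler_pM2l ?divr_gt0//; apply: ltW; exact: rad_lt2.
have S : s `^ (alpha - 1) <= 4 * boundary_term (`|x|, `|y|).
  apply: le_trans (npos_ler_powR _ _ ws) _; [lra|by rewrite divr_gt0|].
  rewrite powRM ?(ltW w0) ?invr_ge0// mulrC ler_wpM2r ?powR_ge0//.
  rewrite -[4^-1]powR_inv1// -powRrM mulN1r opprB -[leRHS]powRr1//.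
  by apply: ler_powR; [rewrite ler1n|lra].
have K0 : 0 <= kap `^ (- (2 * beta)) * (L 2^-1 ^+ 2 + 1).
  by rewrite mulr_ge0 ?powR_ge0// addr_ge0 ?sqr_ge0.
rewrite ler_pdivrMr ?exprn_gt0//; apply: (le_trans B).
rewrite -[leLHS]mulr1; apply: ler_pM => //.
- by rewrite mulr_ge0 ?powR_ge0.
- by rewrite -[leRHS]mulrA ler_wpM2l.
- by rewrite -[leLHS](expr1n _ 2) lerXn2r ?nnegrE ?(ltW r_gt0).
Qed.

(** A point much closer to the circle than to 1 sits beside 1 rather than behind it, so its height
    carries a fixed share of the distance r. *)
Lemma rad_le_near : r < 1 -> s < 8^-1 -> r <= 5 / 2 * `|y|.
Proof.
move=> r1 s8; have r0 := r_gt0; have d0 := gap_gt0 xy1; have [_ vr] := rad_ge.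
have d8 : d < r / 8 by move: s8; rewrite ltr_pdivrMr// mulrC.
have v2 : `|y| ^+ 2 = y ^+ 2 by rewrite real_normK ?num_real.
have r2 : r ^+ 2 = (1 - x) ^+ 2 + `|y| ^+ 2.
  by rewrite v2 sqr_sqrtr// addr_ge0 ?sqr_ge0.
have q2 : (1 - d) ^+ 2 = x ^+ 2 + `|y| ^+ 2.
  by rewrite v2 /gap subKr sqr_sqrtr// addr_ge0 ?sqr_ge0.
have q0 : 0 <= 1 - d by rewrite subr_ge0 gap_le1.
have v0 := v_gt0.
move: r r0 d d0 d8 r1 vr r2 q2 q0 v0 => a a0 b b0 ba a1 va.
move: `|y| va => v va a2 q2 q0 v0.
have x0 : 0 < x by nra.
have xq : x <= 1 - b by nra.
have x1 : 0 <= 1 - x by lra.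
have H1 : (1 - b - x) * (1 - b + x) = v ^+ 2 by rewrite -subr_sqr q2; ring.
have H2 : (1 - b - x) * (7 / 8) <= v by nra.
have H3 : a <= 1 - x + v by nra.
lra.
Qed.

Lemma bracket_near_le c K : 0 < c -> K = 1 + ln 2 / kap -> r < 1 -> s < 8^-1 ->
  bracket c l s / r ^+ 2 <=
  K `^ (2 * beta + alpha + 2) * (2 + 2 / c) * 5 *
  (wedge_term (`|x|, `|y|) + exp_term (c / (10 * K)) (`|x|, `|y|)).
Proof.
move=> c0 KE r1 s8; have b0 : 0 <= 2 * beta by rewrite mulr_ge0// ltW.
have a0 := alpha_gt0; have a1 := alpha_lt1; have k0 := kap_gt0; have v0 := v_gt0.
have [w0 w1 wd dw] := depth_bounds; have [_ vr] := rad_ge; have rv := rad_le_near r1 s8.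
have r0 := r_gt0; have d0 := gap_gt0 xy1; have pi2 := pi_ge2 R; have lk := l_ge.
pose M := L `|y|.
have Mk : kap <= M by apply: loginv_ge => //; lra.
have l2 : 0 < ln 2 :> R by rewrite ln_gt0// ltr1n.
have l2k : 0 < ln 2 / kap by rewrite divr_gt0.
have K1 : 1 <= K by rewrite KE; lra.
have K0 : 0 < K by lra.
have lnr : ln (r / 2) = ln r - ln 2 by rewrite ln_div ?posrE.
have lE : l = kap + ln pi - ln (r / 2) by exact: loginvE.
have ME : M = kap + ln pi - ln `|y| by exact: loginvE.
have ln1 : ln `|y| <= ln r by rewrite ler_ln ?posrE.
have ln2 : ln (r / 2) <= ln 2 + ln `|y|.
  by rewrite -lnM ?posrE// ler_ln ?posrE ?mulr_gt0//; lra.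
(* Changing the argument of L by a factor 2 shifts L by ln 2, at most (ln 2/kap) L; this is the
   origin of K = 1 + ln 2/kap, which compares l with L(|y|). *)
have Klow t : kap <= t -> t + ln 2 <= K * t.
  move=> kt; rewrite KE mulrDl mul1r lerD2l -mulrA ler_pMr// mulrC ler_pdivlMr// mul1r.
  exact: kt.
have Ml : M / K <= l.
  by rewrite ler_pdivrMr// mulrC; apply: le_trans (Klow _ lk); rewrite lE ME lnr; lra.
have lM : l <= K * M by apply: le_trans (Klow _ Mk); rewrite lE ME; lra.
have M0 : 0 < M by lra.
(* A lower bound for s = d/r, from d >= w/2 and r <= (5/2)|y|. *)
pose u := w / (5 * `|y|).
have u0 : 0 < u by rewrite divr_gt0// mulr_gt0.
have us : u <= s.
  rewrite /u ler_pdivrMr ?mulr_gt0//; apply: le_trans (_ : 2 * d <= _); first by lra.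
  rewrite mulrAC ler_pdivlMr//; rewrite [leRHS]mulrC.
  have -> : 2 * d * r = 2 * r * d by ring.
  by rewrite ler_pM2r//; lra.
have B := bracket_near alpha_gt0 alpha_lt1 b0 c0 K1 M0 Ml lM u0 us.
have wv : w < `|y|.
  have d8 : d < r / 8 by move: s8; rewrite ltr_pdivrMr// mulrC.
  lra.
set C := K `^ _ * _ in B *.
have C0 : 0 <= C by rewrite mulr_ge0 ?powR_ge0// addr_ge0// divr_ge0// ltW.
have r2v : (r ^+ 2)^-1 <= `|y| `^ (- 2).
  rewrite (powRN _ 2) powR_mulrn// lef_pV2 ?posrE ?exprn_gt0//.
  by rewrite lerXn2r ?nnegrE ?(ltW r0).
have T1 : M `^ (2 - 2 * beta - alpha) * expR (- (c / (2 * K) * (M * u))) * `|y| `^ (- 2) <=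
    5 * exp_term (c / (10 * K)) (`|x|, `|y|).
  have -> : M `^ (2 - 2 * beta - alpha) * expR (- (c / (2 * K) * (M * u))) * `|y| `^ (- 2) =
      exp_term (c / (10 * K)) (`|x|, `|y|).
    rewrite /exp_term /= -/M mulrAC [_ * `|y| `^ _]mulrC; congr (_ * expR (- _)).
    by rewrite /u; field; rewrite !gt_eqF.
  by rewrite ler_peMl ?exp_term_ge0// ler1n.
have T2 : M `^ (- (2 * beta)) * u `^ (alpha - 1) * `|y| `^ (- 2) <=
    5 * wedge_term (`|x|, `|y|).
  rewrite /wedge_term /= wv -/M.
  have -> : u `^ (alpha - 1) = w `^ (alpha - 1) * (5 `^ (1 - alpha) * `|y| `^ (1 - alpha)).
    rewrite /u; move: (w) w0 => W W0; rewrite powRM ?(ltW W0)//.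
    rewrite -[(5 * _)^-1]powR_inv1 ?mulr_ge0// -powRrM mulN1r opprB powRM//.
  have -> : `|y| `^ (- 1 - alpha) = `|y| `^ (1 - alpha) * `|y| `^ (- 2).
    by rewrite -powRD ?(gt_eqF v0) ?implybT//; congr (_ `^ _); ring.
  have five : 5 `^ (1 - alpha) <= 5 :> R.
    by rewrite -[leRHS]powRr1//; apply: ler_powR; [rewrite ler1n|lra].
  have := powR_ge0 M (- (2 * beta)); have := powR_ge0 w (alpha - 1).
  have := powR_ge0 `|y| (1 - alpha); have := powR_ge0 `|y| (- 2).
  move: five; move: (5 `^ _) (M `^ _) (w `^ _) (`|y| `^ (1 - alpha)) (`|y| `^ (- 2)).
  move=> f1 f2 f3 f4 f5 H H5 H4 H3 H2.
  have -> : f2 * (f3 * (f1 * f4)) * f5 = f1 * (f2 * (f4 * f5) * f3) by ring.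
  by rewrite ler_wpM2r// !mulr_ge0.
apply: le_trans (_ : C * (M `^ (2 - 2 * beta - alpha) * expR (- (c / (2 * K) * (M * u))) +
    M `^ (- (2 * beta)) * u `^ (alpha - 1)) * `|y| `^ (- 2) <= _).
  apply: ler_pM => //; last by rewrite invr_ge0 sqr_ge0.
  apply: mulr_ge0; first by rewrite mulr_ge0 ?powR_ge0 ?expR_ge0.
  by rewrite addr_ge0 ?powR_ge0// mulr_ge0 ?powR_ge0 ?sqr_ge0.
have := lerD T1 T2; rewrite -mulrDl -mulrDr [exp_term _ _ + _]addrC => T.
by rewrite -(mulrA C 5) -(mulrA C); exact: ler_wpM2l.
Qed.

End point.

End majorant.

Section majorant_bound.
Context {R : realType} (alpha beta : R)
  (alpha_gt0 : 0 < alpha) (alpha_lt1 : alpha < 1) (beta_gt0 : 0 < beta).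
Local Notation L := (loginv alpha beta).
Local Notation kap := (2 * beta / alpha).
Local Notation wedge_term := (wedge_term alpha beta).
Local Notation boundary_term := (boundary_term alpha).
Local Notation exp_term := (exp_term alpha beta).
Local Notation majorant := (majorant alpha beta).
Implicit Types (x y c eta : R).

(** Each regime (s >= 1/8; s < 1/8 with r >= 1; s < 1/8 with r < 1) is dominated by its own part of
    the majorant; the jump at -1 goes into the corner term. *)
Lemma dirichlet_density_le_majorant : exists eta c C : R, [/\ 0 < eta, 0 < c, 0 < C &
  forall x y, y != 0 -> x ^+ 2 + y ^+ 2 < 1 ->
    dirichlet_density alpha beta (x, y) <= C * majorant eta c (`|x|, `|y|)].
Proof.
have [c /andP[c0 ca] [C C0 dC]] := dirichlet_density_le alpha_gt0 alpha_lt1 beta_gt0.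
have k0 : 0 < kap by rewrite divr_gt0// mulr_gt0.
have l2k : 0 <= ln 2 / kap by rewrite divr_ge0 ?ln_ge0 ?ler1n// ltW.
pose K := 1 + ln 2 / kap.
have K0 : 0 < K by rewrite ltr_pwDl.
pose K1 := kap `^ (- (2 * beta)) * ((32 / c) ^+ 2 + 8).
pose K2 := kap `^ (- (2 * beta)) * (L 2^-1 ^+ 2 + 1) * 4.
pose K3 := K `^ (2 * beta + alpha + 2) * (2 + 2 / c) * 5.
have K10 : 0 <= K1 by rewrite mulr_ge0 ?powR_ge0// addr_ge0 ?sqr_ge0.
have K20 : 0 <= K2 by rewrite !mulr_ge0 ?powR_ge0// addr_ge0 ?sqr_ge0.
have c2 : 0 < 2 / c by rewrite divr_gt0.
have K30 : 0 <= K3 by rewrite !mulr_ge0 ?powR_ge0// addr_ge0// ltW.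
exists (c / 16), (c / (10 * K)), (C * (K1 + K2 + K3 + 1)); split.
- by rewrite divr_gt0.
- by rewrite divr_gt0// mulr_gt0.
- by rewrite mulr_gt0// ltr_wpDl// !addr_ge0.
move=> x y y0 xy.
have e0 : 0 < c / 16 by rewrite divr_gt0.
have ea : c / 16 <= alpha by lra.
apply: le_trans (dC (c / 16) x y e0 ea xy) _.
rewrite -[leRHS]mulrA ler_pM2l// [leRHS]mulrDl mul1r -/(bracket _ _ _ _ _).
have [N1 N2] := sqrt_den_pi_ge x y.
have c2' : c / 16 <= 2 by have := alpha_lt1; lra.
have T0 := powR_corner y0 xy c2' N1 N2.
set M := majorant _ _ _.
have t1 : corner_term (c / 16) (`|x|, `|y|) <= M.
  by rewrite /M /majorant -addrA lerDl !addr_ge0 ?boundary_term_ge0 ?wedge_term_ge0 ?exp_term_ge0.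
have t2 : boundary_term (`|x|, `|y|) <= M.
  rewrite /M /majorant addrAC lerDr !addr_ge0 ?corner_term_ge0 ?wedge_term_ge0 ?exp_term_ge0//.
have t3 : wedge_term (`|x|, `|y|) + exp_term (c / (10 * K)) (`|x|, `|y|) <= M.
  by rewrite /M /majorant lerDr !addr_ge0 ?corner_term_ge0 ?boundary_term_ge0.
have M0 : 0 <= M by apply: le_trans t1; exact: corner_term_ge0.
apply: lerD; last exact: le_trans t1.
have [M1 M2 M3] : [/\ 0 <= K1 * M, 0 <= K2 * M & 0 <= K3 * M] by split; exact: mulr_ge0.
rewrite [leRHS]mulrDl [in leRHS]mulrDl.
have [s8|s8] := leP 8^-1 (gap x y / rad x y).
  apply: le_trans (_ : K1 * M <= _); last by rewrite -addrA lerDl addr_ge0.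
  apply: le_trans (bracket_far_le _ _ _ _ _ _ _ _) _ => //.
    by have := alpha_lt1; lra.
  by rewrite ler_wpM2l.
have [r1|r1] := leP 1 (rad x y).
  apply: le_trans (_ : K2 * M <= _); last by rewrite addrAC lerDr addr_ge0.
  apply: le_trans (bracket_mid_le alpha_gt0 alpha_lt1 beta_gt0 xy c0 r1) _ => //.
  by rewrite ler_wpM2l.
apply: le_trans (_ : K3 * M <= _); last by rewrite lerDr addr_ge0.
apply: le_trans (bracket_near_le _ _ _ y0 xy c0 (erefl K) r1 s8) _ => //.
by rewrite ler_wpM2l.
Qed.

Lemma measurable_depth : measurable_fun [set: R * R] (@depth R).
Proof.
have mX : measurable_fun [set: R * R] (fun p : R * R => Num.sqrt (1 - p.2 ^+ 2)).
  by apply: measurable_fun_sqrt; apply: measurable_funB => //; exact: measurable_funX.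
by apply: measurable_funM => //; exact: measurable_funB.
Qed.

Lemma measurable_wedge_term : measurable_fun [set: R * R] wedge_term.
Proof.
have md := measurable_depth.
apply: measurable_fun_ifT => //; first exact: measurable_fun_ltr.
apply: measurable_funM; last exact: measurable_fun_powRl.
apply: measurable_funM; apply: measurable_fun_powRl => //; exact: measurable_loginv.
Qed.

Lemma measurable_exp_term c : measurable_fun [set: R * R] (exp_term c).
Proof.
have md := measurable_depth.
apply: measurable_funM.
  by apply: measurable_funM; apply: measurable_fun_powRl => //; exact: measurable_loginv.
apply: measurableT_comp => //; apply: measurableT_comp => //; apply: measurable_funM => //.
by apply: measurable_fun_divr => //; apply: measurable_funM => //; exact: measurable_loginv.
Qed.

Lemma measurable_boundary_term : measurable_fun [set: R * R] boundary_term.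
Proof. by apply: measurable_fun_powRl; exact: measurable_depth. Qed.

Lemma measurable_corner_term eta : measurable_fun [set: R * R] (corner_term eta).
Proof.
by apply: measurable_funM; apply: measurable_fun_powRl => //; exact: measurable_funB.
Qed.

Lemma measurable_majorant eta c : measurable_fun [set: R * R] (majorant eta c).
Proof.
apply: measurable_funD; apply: measurable_funD.
- exact: measurable_corner_term.
- exact: measurable_boundary_term.
- exact: measurable_wedge_term.
- exact: measurable_exp_term.
Qed.

End majorant_bound.

(** * Integrals of the majorant along horizontal slices *)

Section inner_integrals.
Context {R : realType} (alpha beta : R)
  (alpha_gt0 : 0 < alpha) (alpha_lt1 : alpha < 1) (beta_gt0 : 0 < beta).
Local Notation mu := (@lebesgue_measure R).
Local Notation L := (loginv alpha beta).
Local Notation kap := (2 * beta / alpha).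
Local Notation q := (2 * beta + alpha - 1).
Local Notation wedge_term := (wedge_term alpha beta).
Local Notation boundary_term := (boundary_term alpha).
Local Notation exp_term := (exp_term alpha beta).
Implicit Types (x c eta : R).

Context (y : R) (y_gt0 : 0 < y) (y_lt1 : y < 1).
Local Notation X := (Num.sqrt (1 - y ^+ 2)).

Let X_gt0 : 0 < X.
Proof. by rewrite sqrtr_gt0 subr_gt0 expr_lt1// ltW. Qed.

Let X_le1 : X <= 1.
Proof. by rewrite -[leRHS]sqrtr1 ler_sqrt// gerBl sqr_ge0. Qed.

Let L_gt0 : 0 < L y.
Proof. by apply: loginv_gt0 => //; have := pi_ge2 R; have := y_lt1; lra. Qed.

Let is_deriveBr a x : is_derive x 1 (fun t : R => a - t) (- 1).
Proof.
rewrite -[X in is_derive _ _ _ X]add0r.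
apply: (is_derive1D (f := cst a)); apply: (is_derive1N (f := id)).
Qed.

Lemma integral_corner_term_le eta : 0 < eta ->
  (\int[mu]_(x in `]0%R, X[) (corner_term eta (x, y))%:E <= (2 / eta * y `^ (eta / 2 - 1))%:E)%E.
Proof.
move=> e0.
apply: le_trans (_ : (\int[mu]_(x in `]0%R, 1%R[) (y `^ (eta / 2 - 1) * (1 - x) `^ (eta / 2 - 1))%:E <= _)%E).
  apply: le_trans (_ : (\int[mu]_(x in `]0%R, 1%R[) (corner_term eta (x, y))%:E <= _)%E).
    apply: (@ge0_subset_integral_nonmeas _ (measurableTypeR R) R mu).
      by move=> x _; rewrite lee_fin corner_term_ge0.
    by move=> x; rewrite /= !in_itv/= => /andP[-> /lt_le_trans]; apply.
  by under eq_integral do rewrite /corner_term mulrC.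
rewrite [in leRHS]mulrC; apply: ge0_integralZ_le => //; first exact: powR_ge0.
- by move=> x _; exact: powR_ge0.
- by apply: measurable_fun_powRl; exact: measurable_funB.
apply: le_trans (integral_powRB_le (_ : 0 < eta / 2) ltr01) _; first by rewrite divr_gt0.
by rewrite subr0 powR1 lee_fin mul1r invf_div.
Qed.

Lemma integral_boundary_term_le :
  (\int[mu]_(x in `]0%R, X[) (boundary_term (x, y))%:E <= (alpha^-1 * X^-1)%:E)%E.
Proof.
have a0 := alpha_gt0; have a1 := alpha_lt1.
under eq_integral => x xX.
  rewrite /boundary_term /depth /= powRM ?(ltW X_gt0)//; last first.
    by move: xX; rewrite inE /= in_itv/= => /andP[_ /ltW]; rewrite subr_ge0.
  rewrite mulrC; over.
apply: le_trans (ge0_integralZ_le (a := X `^ alpha / alpha) _ _ _ _ _) _ => //.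
- by move=> x _; exact: powR_ge0.
- by apply: measurable_fun_powRl; exact: measurable_funB.
- by apply: le_trans (integral_powRB_le alpha_gt0 X_gt0) _; rewrite subr0.
rewrite lee_fin mulrA mulrC ler_pM2l ?invr_gt0// -powRD ?(gt_eqF X_gt0) ?implybT//.
rewrite -[leRHS]powR_inv1 ?(ltW X_gt0)//.
by apply: ger_powR; rewrite ?X_gt0//; lra.
Qed.

(** Depth below y means x > X - y/X, so integrating depth^(alpha-1) yields y^alpha up to powers of
    X, and y^(-1-alpha) improves to y^(-1). The left end X - y/X may be negative, which only
    enlarges the bounding integral. *)
Lemma integral_wedge_term_le :
  (\int[mu]_(x in `]0%R, X[) (wedge_term (x, y))%:E <=
   (alpha^-1 * (y^-1 * L y `^ (- (2 * beta)) * X^-1))%:E)%E.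
Proof.
have a0 := alpha_gt0; have a1 := alpha_lt1.
pose C := L y `^ (- (2 * beta)) * y `^ (- 1 - alpha) * X `^ (alpha - 1).
have C0 : 0 <= C by rewrite !mulr_ge0 ?powR_ge0.
have yX0 : 0 < y / X by rewrite divr_gt0.
apply: le_trans (_ : (\int[mu]_(x in `](X - y / X)%R, X[) (C * (X - x) `^ (alpha - 1))%:E <= _)%E).
  rewrite integral_mkcond [leRHS]integral_mkcond.
  apply: (@ge0_le_integral_nonmeas _ (measurableTypeR R) R mu) => x _.
    by rewrite patchE; case: ifP => // _; rewrite lee_fin wedge_term_ge0.
  rewrite !patchE; case: ifPn => [/set_mem|_]; last first.
    by case: ifP => // _; rewrite lee_fin mulr_ge0 ?powR_ge0.
  rewrite /= in_itv/= => /andP[x0 xX].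
  rewrite /wedge_term; case: ifP => /= [wy|_]; last first.
    by case: ifP => // _; rewrite lee_fin mulr_ge0 ?powR_ge0.
  rewrite mem_set/=; last first.
    rewrite in_itv/= xX andbT ltrBlDr -ltrBlDl ltr_pdivlMr//.
  rewrite lee_fin /depth /= powRM ?subr_ge0 ?(ltW xX) ?(ltW X_gt0)//.
  by rewrite /C le_eqVlt; apply/orP; left; apply/eqP; ring.
apply: le_trans (ge0_integralZ_le (a := (y / X) `^ alpha / alpha) _ _ _ _ _) _ => //.
- by move=> x _; exact: powR_ge0.
- by apply: measurable_fun_powRl; exact: measurable_funB.
- apply: le_trans (integral_powRB_le alpha_gt0 (_ : X - y / X < X)) _.
    by rewrite gtrBl.
  by rewrite subKr.
rewrite lee_fin /C le_eqVlt; apply/orP; left; apply/eqP.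
have -> : y `^ (- 1 - alpha) = y^-1 * y `^ (- alpha).
  by rewrite powRD ?(gt_eqF y_gt0) ?implybT// powR_inv1 ?(ltW y_gt0).
have -> : X `^ (alpha - 1) = X^-1 * X `^ alpha.
  by rewrite powRD ?(gt_eqF X_gt0) ?implybT// powR_inv1 ?(ltW X_gt0)// mulrC.
rewrite powRM ?(ltW y_gt0) ?invr_ge0 ?(ltW X_gt0)//.
have -> : (X^-1) `^ alpha = X `^ (- alpha).
  by rewrite -powR_inv1 ?(ltW X_gt0)// -powRrM mulN1r.
have Y1 : y `^ (- alpha) * y `^ alpha = 1 by rewrite powRN mulVf// gt_eqF ?powR_gt0.
have X1 : X `^ alpha * X `^ (- alpha) = 1 by rewrite powRN mulfV// gt_eqF ?powR_gt0.
have -> : L y `^ (- (2 * beta)) * (y^-1 * y `^ (- alpha)) * (X^-1 * X `^ alpha) *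
    (y `^ alpha * X `^ (- alpha) / alpha) =
  alpha^-1 * (y^-1 * L y `^ (- (2 * beta)) * X^-1) * (y `^ (- alpha) * y `^ alpha) *
    (X `^ alpha * X `^ (- alpha)) by ring.
by rewrite Y1 X1 !mulr1.
Qed.

(** The exponential decays in X - x at rate a = c L X/y, so integration gains the factor 1/a, and
    y^(-2) L^(2 - 2 beta - alpha) turns into the test function y^(-1) L^(-q). *)
Lemma integral_exp_term_le c : 0 < c ->
  (\int[mu]_(x in `]0%R, X[) (exp_term c (x, y))%:E <= (c^-1 * (y^-1 * L y `^ (- q) * X^-1))%:E)%E.
Proof.
move=> c0; pose a := c * (L y * X / y).
have a0 : 0 < a by rewrite mulr_gt0// divr_gt0// mulr_gt0.
pose C := y `^ (- 2) * L y `^ (2 - 2 * beta - alpha).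
have C0 : 0 <= C by rewrite mulr_ge0 ?powR_ge0.
have aE x : c * (L y * depth (x, y) / y) = a * (X - x).
  by rewrite /depth /a /=; ring.
have dexp x : is_derive x 1 (fun t : R => expR (- (a * (X - t)))) (a * expR (- (a * (X - x)))).
  have d1 : is_derive x 1 (fun t : R => - (a * (X - t))) (- (a * -1)).
    by apply: is_derive1N; apply: is_derive1Z; exact: is_deriveBr.
  have := @is_derive1_comp' R (@expR R) (fun t : R => - (a * (X - t))) x _ _ (is_derive_expR _) d1.
  by rewrite mulrN1 opprK mulrC.
under eq_integral do rewrite /exp_term aE.
apply: le_trans (ge0_integralZ_le (a := a^-1) _ C0 _ _ _) _ => //.
- by apply: measurableT_comp => //; apply: measurableT_comp => //; apply: measurable_funM => //;
    exact: measurable_funB.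
- apply: (@ge0_integral_oo_le _ _ (fun t => a^-1 * expR (- (a * (X - t))))) => //.
  + by move=> x _; exact: (is_derive_continuous (dexp x)).
  + move=> x _; have := @is_derive1Z R (fun t => expR (- (a * (X - t)))) a^-1 x _ (dexp x).
    by rewrite mulKf// gt_eqF.
  + move=> u v _ uv vX; rewrite -mulrBr -[leRHS]mulr1 ler_pM2l ?invr_gt0//.
    apply: le_trans (_ : expR (- (a * (X - v))) <= _); first by rewrite gerBl expR_ge0.
    by rewrite expR_le1 oppr_le0 mulr_ge0 ?(ltW a0)// subr_ge0 ltW.
rewrite lee_fin /C /a le_eqVlt; apply/orP; left; apply/eqP.
have -> : 2 - 2 * beta - alpha = - q + 1 by ring.
rewrite (@powRD _ (L y)) ?(gt_eqF L_gt0) ?implybT// powRr1 ?(ltW L_gt0)//.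
rewrite (powRN y 2) powR_mulrn ?(ltW y_gt0)//.
by field; rewrite !gt_eqF.
Qed.

End inner_integrals.

(** * Convergence of the Dirichlet integral above the threshold *)

Section dirichlet_sufficient.
Context {R : realType} (alpha beta : R)
  (alpha_gt0 : 0 < alpha) (alpha_lt1 : alpha < 1) (beta_gt0 : 0 < beta).
Local Notation mu := (@lebesgue_measure R).
Local Notation L := (loginv alpha beta).
Local Notation kap := (2 * beta / alpha).
Local Notation q := (2 * beta + alpha - 1).
Local Notation majorant := (majorant alpha beta).
Local Notation disk := ((@of_plane R) @^-1` (@unit_disk R)).
Implicit Types (x y c eta : R).

Let kap_gt0 : 0 < kap. Proof. by rewrite divr_gt0// mulr_gt0. Qed.

Let integralD_le (D : set R) (f g : R -> R) (a b : R) : measurable D ->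
  (forall x, D x -> 0 <= f x) -> (forall x, D x -> 0 <= g x) ->
  measurable_fun D f -> measurable_fun D g ->
  (\int[mu]_(x in D) (f x)%:E <= a%:E)%E ->
  (\int[mu]_(x in D) (g x)%:E <= b%:E)%E ->
  (\int[mu]_(x in D) (f x + g x)%:E <= (a + b)%:E)%E.
Proof.
move=> mD f0 g0 mf mg fa gb.
have := ge0_integral_lincomb_le mD ler01 f0 g0 mf mg fa gb.
by rewrite mul1r; under eq_integral do rewrite mul1r.
Qed.

Let integral_majorant_le eta c : 0 < eta -> 0 < c ->
  forall y, 0 < y -> y < 1 ->
  (\int[mu]_(x in `]0%R, Num.sqrt (1 - y ^+ 2)[) (majorant eta c (x, y))%:E <=
   (2 / eta * y `^ (eta / 2 - 1) + alpha^-1 * (Num.sqrt (1 - y ^+ 2))^-1 +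
    (alpha^-1 * (y^-1 * L y `^ (- (2 * beta)) * (Num.sqrt (1 - y ^+ 2))^-1) +
     c^-1 * (y^-1 * L y `^ (- q) * (Num.sqrt (1 - y ^+ 2))^-1)))%:E)%E.
Proof.
move=> e0 c0 y y0 y1.
have mpair (f : R * R -> R) (D : set R) : measurable_fun setT f ->
    measurable_fun D (fun x => f (x, y)).
  move=> mf; apply: measurable_funTS; apply: measurableT_comp mf _.
  exact: measurable_fun_pair.
have m1 := measurable_corner_term eta; have m2 := measurable_boundary_term alpha.
have m3 := measurable_wedge_term alpha beta; have m4 := measurable_exp_term alpha beta c.
apply: integralD_le => //.
- by move=> x _; rewrite addr_ge0 ?corner_term_ge0 ?boundary_term_ge0.
- by move=> x _; rewrite addr_ge0 ?wedge_term_ge0 ?exp_term_ge0.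
- by apply: measurable_funD; apply: mpair.
- by apply: measurable_funD; apply: mpair.
- apply: integralD_le => //; try exact: mpair.
  + by move=> x _; exact: corner_term_ge0.
  + by move=> x _; exact: boundary_term_ge0.
  + exact: integral_corner_term_le.
  + exact: integral_boundary_term_le.
- apply: integralD_le => //; try exact: mpair.
  + by move=> x _; exact: wedge_term_ge0.
  + by move=> x _; exact: exp_term_ge0.
  + exact: integral_wedge_term_le.
  + exact: integral_exp_term_le.
Qed.

(** Separates the singularity of 1/X at y = 1, at most V = (1 - y)^(-1/2), from the one at y = 0. A
    product of the two is at most a sum because V <= 2 for y <= 1/2, while y^(-1) <= 2 and L^(-q) <=
    kap^(-q) for y > 1/2. *)
Let outer_weight_le y : 1 < q -> 0 < y -> y < 1 ->
  let V := (1 - y) `^ (2^-1 - 1) in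
  [/\ (Num.sqrt (1 - y ^+ 2))^-1 <= V,
    L y `^ (- (2 * beta)) <= kap `^ (alpha - 1) * L y `^ (- q) &
    y^-1 * L y `^ (- q) * V <= 2 * (y^-1 * L y `^ (- q)) + 2 * kap `^ (- q) * V].
Proof.
move=> q1 y0 y1 V; have a1 := alpha_lt1.
have V0 : 0 <= V by exact: powR_ge0.
have yl : 0 < 1 - y by lra.
have pi2 := pi_ge2 R; have k0 := kap_gt0.
have Lk : kap <= L y by apply: loginv_ge => //; lra.
have L0 : 0 < L y := lt_le_trans k0 Lk.
split.
- rewrite /V (_ : 2^-1 - 1 = - 2^-1); last by field.
  rewrite powRN powR12_sqrt ?(ltW yl)// lef_pV2 ?posrE ?sqrtr_gt0//; last by nra.
  by rewrite ler_sqrt; nra.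
- have -> : - (2 * beta) = (alpha - 1) + - q by ring.
  rewrite powRD ?(gt_eqF L0) ?implybT// ler_wpM2r ?powR_ge0//.
  by apply: npos_ler_powR => //; lra.
have A0 : 0 <= y^-1 * L y `^ (- q) by rewrite mulr_ge0 ?powR_ge0// invr_ge0 ltW.
have k1 : 0 <= kap `^ (- q) by exact: powR_ge0.
have [y2|y2] := leP y 2^-1.
  apply: le_trans (_ : 2 * (y^-1 * L y `^ (- q)) <= _); last by rewrite lerDl !mulr_ge0.
  rewrite mulrC ler_wpM2r//.
  apply: le_trans (npos_ler_powR (_ : _ <= 0) (_ : 0 < 2^-1) (_ : 2^-1 <= 1 - y)) _ => //; [lra|lra|].
  rewrite -[X in X `^ _]powR_inv1// -powRrM mulN1r -[leRHS]powRr1//.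
  by apply: ler_powR; [rewrite ler1n|lra].
apply: le_trans (_ : 2 * kap `^ (- q) * V <= _); last by rewrite lerDr mulr_ge0.
rewrite ler_wpM2r//; apply: ler_pM => //; rewrite ?powR_ge0 ?invr_ge0 ?(ltW y0)//.
  by rewrite -[leRHS]invrK lef_pV2 ?posrE ?invr_gt0// ltW.
by apply: npos_ler_powR => //; lra.
Qed.

Let majorant_ge0 eta c p : 0 <= majorant eta c p.
Proof.
by rewrite !addr_ge0 ?corner_term_ge0 ?boundary_term_ge0 ?wedge_term_ge0 ?exp_term_ge0.
Qed.

Let weight_arith (k m n V W a d e f z t : R) :
  0 < a -> 0 < d -> 0 < e -> 0 <= f -> 0 < z -> 0 <= k -> 0 <= m -> 0 <= V -> 0 <= t ->
  W <= V -> n <= k * m -> z * m * V <= 2 * (z * m) + 2 * f * V -> 0 <= W -> 0 <= n ->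
  e * t + a * W + (a * (z * n * W) + d * (z * m * W)) <=
  (e + a + (a * k + d) * 2 + (a * k + d) * (2 * f)) * (t + (V + z * m)).
Proof.
move=> a0 d0 e0 f0 z0 k0 m0 V0 t0 WV nm H W0 n0.
have ak : 0 <= a * k + d by rewrite addr_ge0 ?mulr_ge0// ltW.
have zm : 0 <= z * m by rewrite mulr_ge0// ltW.
have P1 : a * W <= a * V by rewrite ler_pM2l.
have P2 : a * (z * n * W) <= a * (z * (k * m) * V).
  rewrite ler_pM2l//; apply: ler_pM => //; first by rewrite mulr_ge0// ltW.
  by rewrite ler_pM2l.
have P3 : d * (z * m * W) <= d * (z * m * V) by rewrite ler_pM2l// ler_wpM2l.
have P4 := ler_wpM2l ak H.
have E1 := mulr_ge0 (ltW e0) (addr_ge0 V0 zm).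
have E2 := mulr_ge0 (ltW a0) (addr_ge0 t0 zm).
have E3 := mulr_ge0 ak (addr_ge0 t0 V0).
have E4 := mulr_ge0 (mulr_ge0 ak f0) (addr_ge0 t0 zm).
move: ak zm; lra.
Qed.

(** The hypothesis is q > 1 for q = 2 beta + alpha - 1. The slice integrals are then dominated by
    y^(eta/2 - 1), (1 - y)^(-1/2) and y^(-1) L^(-q), each integrable over ]0, 1[. *)
Lemma dirichlet_density_integrable : 1 - 2^-1 * alpha < beta ->
  (\int[mu \x mu]_(p in disk) (dirichlet_density alpha beta p)%:E < +oo)%E.
Proof.
move=> ba; have a0 := alpha_gt0; have a1 := alpha_lt1.
have q1 : 1 < q by lra.
have [eta [c [C [e0 c0 C0 dC]]]] := dirichlet_density_le_majorant alpha_gt0 alpha_lt1 beta_gt0.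
pose D := alpha^-1 * kap `^ (alpha - 1) + c^-1.
pose B := 2 / eta + alpha^-1 + D * 2 + D * (2 * kap `^ (- q)).
pose G y := y `^ (eta / 2 - 1) + ((1 - y) `^ (2^-1 - 1) + y^-1 * L y `^ (- q)).
have ai : 0 < alpha^-1 by rewrite invr_gt0.
have ci : 0 < c^-1 by rewrite invr_gt0.
have ei : 0 < 2 / eta by rewrite divr_gt0.
have D0 : 0 < D by rewrite addr_gt0// mulr_gt0// powR_gt0.
have kq : 0 <= kap `^ (- q) by exact: powR_ge0.
have B0 : 0 < B by rewrite ltr_wpDr ?mulr_ge0 ?(ltW D0)// !addr_gt0// mulr_gt0.
have mM := measurable_majorant alpha beta eta c.
have mG3 : measurable_fun [set: R] (fun y => y^-1 * L y `^ (- q)).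
  apply: measurable_funM; first exact: measurable_invr.
  by apply: measurable_fun_powRl; exact: measurable_loginv.
have mG2 : measurable_fun [set: R] (fun y => (1 - y) `^ (2^-1 - 1) + y^-1 * L y `^ (- q)).
  by apply: measurable_funD mG3; apply: measurable_fun_powRl; exact: measurable_funB.
have mG : measurable_fun [set: R] G.
  by apply: measurable_funD mG2; exact: measurable_fun_powRl.
apply: le_lt_trans (@ge0_disk_integral_le R (dirichlet_density alpha beta)
  (fun p => C * majorant eta c p) (fun y => C * (B * G y)) _ _ _ _ _ _) _.
- exact: measurable_funM.
- by move=> p; rewrite mulr_ge0 ?(ltW C0)// majorant_ge0.
- exact: dirichlet_density_ge0.
- by move=> x y _ y0 xy; exact: dC.
- move=> y y0 y1; apply: ge0_integralZ_le => //.
  + exact: ltW.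
  + by apply: measurable_funTS; apply: measurableT_comp mM _; exact: measurable_fun_pair.
  apply: le_trans (integral_majorant_le e0 c0 y0 y1) _; rewrite lee_fin.
  have [H1 H2 H3] := outer_weight_le q1 y0 y1.
  apply: weight_arith => //; rewrite ?powR_ge0 ?invr_ge0 ?sqrtr_ge0 ?invr_gt0//.
- by do 2!apply: measurable_funM => //.
have GE : (\int[mu]_(y in `]0%R, 1%R[) (G y)%:E <=
    (1 `^ (eta / 2) / (eta / 2) + ((1 - 0) `^ 2^-1 / 2^-1 + kap `^ (1 - q) / (q - 1)))%:E)%E.
  apply: integralD_le => //.
  - by move=> x _; exact: powR_ge0.
  - move=> x; rewrite /= in_itv/= => /andP[x0 _].
    by rewrite addr_ge0 ?powR_ge0// mulr_ge0 ?powR_ge0// invr_ge0 ltW.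
  - exact: measurable_fun_powRl.
  - by apply: measurable_funTS; exact: mG2.
  - by apply: integral_powR_le => //; rewrite divr_gt0.
  apply: integralD_le => //.
  - by move=> x _; exact: powR_ge0.
  - by move=> x; rewrite /= in_itv/= => /andP[x0 _]; rewrite mulr_ge0 ?powR_ge0// invr_ge0 ltW.
  - by apply: measurable_fun_powRl; exact: measurable_funB.
  - by apply: measurable_funTS; exact: mG3.
  - by apply: integral_powRB_le; rewrite ?ltr01 ?invr_gt0.
  apply: le_trans (integral_loginv_le alpha_gt0 beta_gt0 q1).
  apply: (@ge0_subset_integral_nonmeas _ (measurableTypeR R) R mu) => x; rewrite /= !in_itv/=.
    by move=> /andP[x0 _]; rewrite lee_fin mulr_ge0 ?powR_ge0// invr_ge0 ltW.
  by move=> /andP[-> x1]; have := pi_ge2 R; lra.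
have G0 x : (`]0, 1[ : set R)%classic x -> 0 <= G x.
  rewrite /= in_itv/= => /andP[x0 _]; rewrite !addr_ge0 ?powR_ge0//.
  by rewrite mulr_ge0 ?powR_ge0// invr_ge0 ltW.
have BG : (\int[mu]_(y in `]0%R, 1%R[) (C * (B * G y))%:E < +oo)%E.
  apply: le_lt_trans (ge0_integralZ_le _ (ltW C0) _ _ (ge0_integralZ_le _ (ltW B0) G0 _ GE)) _ => //.
  - by move=> x /G0 ?; rewrite mulr_ge0 ?(ltW B0).
  - by apply: measurable_funTS; exact: measurable_funM.
  - by apply: measurable_funTS.
  - exact: ltry.
by rewrite lte_mul_pinfty.
Qed.

End dirichlet_sufficient.

Theorem theorem1p4 (R : realType) (alpha beta : R)
    (alpha_gt0 : 0 < alpha) (alpha_lt1 : alpha < 1) (beta_gt0 : 0 < beta) :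
  [/\ (Nalpha alpha (hbeta alpha beta) < +oo)%E <-> 2^-1 < beta,
      Dspace alpha (outer (hbeta alpha beta)) <-> 1 - 2^-1 * alpha < beta
    & (Calpha alpha (hbeta alpha beta) < +oo)%E <-> 1 < beta].
Proof.
split; [exact: Nalpha_hbeta| |exact: Calpha_hbeta].
have pi0 := pi_gt0 R.
have DE : dirichlet alpha (outer (hbeta alpha beta)) =
    ((pi^-1)%:E * \int[lebesgue_measure \x lebesgue_measure]_(p in
      (@of_plane R) @^-1` (@unit_disk R)) (dirichlet_density alpha beta p)%:E)%E by [].
have I0 : (0 <= \int[lebesgue_measure \x lebesgue_measure]_(p in
    (@of_plane R) @^-1` (@unit_disk R)) (dirichlet_density alpha beta p)%:E)%E.
  by apply: integral_ge0 => p _; rewrite lee_fin dirichlet_density_ge0.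
split=> [[_]|ba].
  rewrite DE => dfin; apply: (dirichlet_density_lt_pinfty alpha_gt0 alpha_lt1 beta_gt0).
  rewrite ltey; apply/eqP => Ioo; move: dfin.
  by rewrite Ioo gt0_muley ?ltxx// lte_fin invr_gt0.
split; first by apply: outer_analytic; exact: integrable_ln_hbeta.
rewrite DE; apply: lte_mul_pinfty; rewrite ?lee_fin ?invr_ge0 ?(ltW pi0)//.
exact: dirichlet_density_integrable.
Qed.
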